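(* Let $Z,Z_1,Z_2,\ldots$ be i.i.d. non-negative random variables with $\mathbf P(Z\ge x)=\exp(-L(x)x^\alpha)$ for $x>0$, where $\alpha\in(0,1)$ and $L$ is slowly varying at infinity, and assume that $x\mapsto L(x)x^{\alpha-1}$ is non-increasing for all sufficiently large $x$. Let $\bar S_n(t)=\frac1n\sum_{i=1}^{[nt]}(Z_i-\mathbf E Z)$, $t\in[0,1]$. Then $\bar S_n$ satisfies the extended large deviation principle in $\mathbb D[0,1]$ equipped with the $J_1$ metric, with speed $L(n)n^\alpha$ and rate function $$\tilde I(\xi)=\begin{cases}\sum_{t:\,\xi(t)\ne\xi(t-)}\big(\xi(t)-\xi(t-)\big)^\alpha & \text{if }\xi\in\tilde{\mathbb D}_{\leqslant\infty},\\ \infty&\text{otherwise.}\end{cases}$$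
   Context: $\mathbb D[0,1]$ is the space of càdlàg functions $[0,1]\to\mathbb R$ with the Skorokhod metric $d_{J_1}(\xi,\zeta)=\inf_{\lambda\in\Lambda}\max\{\|\xi-\zeta\circ\lambda\|_\infty,\|\lambda-e\|_\infty\}$, where $\Lambda$ is the set of non-decreasing homeomorphisms of $[0,1]$ onto itself and $e(t)=t$. $\tilde{\mathbb D}_{\leqslant\infty}$ is the set of non-decreasing pure jump functions vanishing at the origin, not necessarily continuous at $1$: functions $\xi=\sum_{i=1}^\infty x_i\mathbf 1_{[u_i,1]}$ with $x_i\ge0$ and distinct $u_i\in(0,1]$. Extended LDP: random elements $X_n$ of a metric space $(\mathbb S,d)$ satisfy the extended LDP with speed $a_n$ ($a_n>0$, $a_n\to\infty$) and rate function $I$ (non-negative, possibly infinite, lower semi-continuous) if for every measurable $A$, $$-\inf_{x\in A^\circ}I(x)\le\liminf_{n\to\infty}\frac{\log\mathbf P(X_n\in A)}{a_n}\le\limsup_{n\to\infty}\frac{\log\mathbf P(X_n\in A)}{a_n}\le-\lim_{\epsilon\to0}\inf_{x\in A^\epsilon}I(x),$$ where $A^\circ$ is the interior and $A^\epsilon=\{x: d(x,A)\le\epsilon\}$ with $d(x,A)=\inf_{y\in A}d(x,y)$. *)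

(* Defs.v *)
From HB Require Import structures.
From mathcomp Require Import all_boot all_order all_algebra.
From mathcomp Require Import all_classical all_reals all_analysis.
From mathcomp Require Import lra.

Set Implicit Arguments.
Unset Strict Implicit.
Unset Printing Implicit Defensive.

Import Order.TTheory GRing.Theory Num.Theory.
Import numFieldNormedType.Exports.

Local Open Scope classical_set_scope.
Local Open Scope ring_scope.

Definition unit_itv (R : realType) := set_type [set` `[0 : R, 1]].

HB.instance Definition _ (R : realType) := PseudoMetric.on (unit_itv R).

Definition uval (R : realType) (t : unit_itv R) : R := \val t.

Definition uright (R : realType) (t : unit_itv R) : set_system (unit_itv R) :=
  within [set s | uval t < uval s] (nbhs t).

Definition uleft (R : realType) (t : unit_itv R) : set_system (unit_itv R) :=
  within [set s | uval s < uval t] (nbhs t).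

#[global] Instance uright_filter (R : realType) (t : unit_itv R) :
  Filter (uright t).
Proof. exact: within_filter. Qed.

#[global] Instance uleft_filter (R : realType) (t : unit_itv R) :
  Filter (uleft t).
Proof. exact: within_filter. Qed.

(* [uright 1] and [uleft 0] are the improper filter, so right-continuity at 1
   and the left limit at 0 impose nothing. *)
Definition cadlag_fun (R : realType) (f : unit_itv R -> R) : Prop :=
  forall t, f @ uright t --> f t /\ (exists l : R, f @ uleft t --> l).

Record cadlag (R : realType) := Cadlag {
  cadlag_val :> unit_itv R -> R ;
  cadlagP : cadlag_fun cadlag_val }.

HB.instance Definition _ (R : realType) := gen_eqMixin (cadlag R).
HB.instance Definition _ (R : realType) := gen_choiceMixin (cadlag R).

Definition time_change (R : realType) : set (unit_itv R -> unit_itv R) :=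
  [set l | {homo l : s t / uval s <= uval t >-> uval s <= uval t} /\
           continuous l /\
           exists m, [/\ cancel l m, cancel m l & continuous m]].

Definition unorm (R : realType) (f : unit_itv R -> R) : R :=
  sup (range (fun t => `|f t|)).

Definition J1_cost (R : realType) (xi zeta : unit_itv R -> R)
    (l : unit_itv R -> unit_itv R) : R :=
  Num.max (unorm (fun t => xi t - zeta (l t)))
          (unorm (fun t => uval (l t) - uval t)).

Definition J1_dist (R : realType) (xi zeta : cadlag R) : R :=
  inf [set J1_cost xi zeta l | l in @time_change R].

Section J1_metric.
Variable R : realType.
Local Notation I := (unit_itv R).
Implicit Types (s t : I) (f g h : cadlag R) (l m : I -> I).

Lemma uval_itv t : 0 <= uval t <= 1.
Proof. by have := set_valP t; rewrite /uval /= in_itv. Qed.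

Lemma uval_inj : injective (@uval R). Proof. exact: val_inj. Qed.

Lemma uval_surj (x : R) : 0 <= x <= 1 -> exists t : I, uval t = x.
Proof.
move=> x01; have xI : x \in [set` `[0, 1]] by rewrite inE /= in_itv.
by exists (exist _ x xI).
Qed.

Lemma near_uvalP t (U : set I) : nbhs t U <->
  exists2 e : R, 0 < e & forall s, `|uval t - uval s| < e -> U s.
Proof.
split.
  by move=> /nbhs_ballP[e /= e0 eU]; exists e => // s se; apply: eU.
by move=> [e e0 eU]; apply/nbhs_ballP; exists e => // s se; exact: eU.
Qed.

Lemma cadlag_right f t e : 0 < e -> exists2 d : R, 0 < d &
  forall s, uval t <= uval s < uval t + d -> `|f t - f s| < e.
Proof.
move=> e0; have [+ _] := cadlagP f t.
move=> /cvgr_dist_lt => /(_ e e0) /near_uvalP [d d0 H].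
exists d => // s /andP[]; rewrite le_eqVlt => /orP[/eqP /uval_inj <- _|ts sd].
  by rewrite subrr normr0.
apply: H => //; rewrite distrC gtr0_norm ?subr_gt0//; lra.
Qed.

Lemma cadlag_left f t : exists l : R, forall e : R, 0 < e -> exists2 d : R, 0 < d &
  forall s, uval t - d < uval s < uval t -> `|l - f s| < e.
Proof.
have [_ [l fl]] := cadlagP f t; exists l => e e0.
move: fl => /cvgr_dist_lt => /(_ e e0) /near_uvalP [d d0 H].
exists d => // s /andP[sd st]; apply: H => //.
by rewrite gtr0_norm ?subr_gt0//; lra.
Qed.

Lemma cadlag_bounded f : exists M : R, forall t, `|f t| <= M.
Proof.
have /compact_near_coveringP : compact [set` `[0 : R, 1]].
  exact: segment_compact.
move=> /(_ R (@pinfty_nbhs R) (fun M x => forall s, uval s = x -> `|f s| <= M)).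
have cov : forall x : R, [set` `[0 : R, 1]] x ->
    \forall x' \near x & M \near +oo, forall s, uval s = x' -> `|f s| <= M.
  move=> x; rewrite /= in_itv/= => /uval_surj [t <-].
  have [d d0 fd] := cadlag_right f t ltr01.
  have [l /(_ _ ltr01) [d' d'0 fd']] := cadlag_left f t.
  exists (ball (uval t) (Num.min d d'), [set M | `|f t| + `|l| + 1 < M]).
    split => /=; first by apply: nbhsx_ballx; rewrite lt_min d0.
    by exists (`|f t| + `|l| + 1); split => //; rewrite num_real.
  move=> [y M] /= [ty HM] s sy.
  have {ty} : `|uval t - uval s| < Num.min d d' by rewrite sy.
  rewrite lt_min => /andP[]; rewrite !ltr_norml => /andP[a1 a2] /andP[b1 b2].
  have [ts|st] := leP (uval t) (uval s).
    have /fd : uval t <= uval s < uval t + d by rewrite ts/=; lra.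
    have := ler_normD (f t) (- (f t - f s)).
    by rewrite normrN opprB addrC subrK; have := normr_ge0 l; lra.
  have /fd' : uval t - d' < uval s < uval t by rewrite st andbT; lra.
  have := ler_normD l (- (l - f s)).
  by rewrite normrN opprB addrC subrK; have := normr_ge0 (f t); lra.
move=> /(_ _ cov) [M [_ H]].
exists (M + 1) => t; apply: (H (M + 1) _ (uval t)) => //.
  by rewrite ltrDl.
by rewrite /= in_itv/=; exact: uval_itv.
Qed.

Lemma range_unorm_nonempty (F : I -> R) : range (fun t => `|F t|) !=set0.
Proof.
have [|t _] := @uval_surj 0; first by rewrite lexx ler01.
by exists `|F t|, t.
Qed.

Lemma unorm_le (F : I -> R) c : (forall t, `|F t| <= c) -> unorm F <= c.
Proof.
move=> Fc; apply: ge_sup; first exact: range_unorm_nonempty.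
by move=> _ [t _ <-].
Qed.

Lemma le_unorm (F : I -> R) c t : (forall t, `|F t| <= c) -> `|F t| <= unorm F.
Proof.
move=> Fc; apply: ub_le_sup; last by exists t.
by exists c => _ [s _ <-].
Qed.

Lemma J1_cost_le f g l c : (forall t, `|f t - g (l t)| <= c) ->
  (forall t, `|uval (l t) - uval t| <= c) -> J1_cost f g l <= c.
Proof. by move=> *; rewrite /J1_cost ge_max !unorm_le. Qed.

Lemma le_J1_cost f g l t : `|f t - g (l t)| <= J1_cost f g l /\
  `|uval (l t) - uval t| <= J1_cost f g l.
Proof.
have [M fM] := cadlag_bounded f; have [N gN] := cadlag_bounded g.
rewrite /J1_cost !le_max; split; apply/orP; [left|right].
  apply: (le_unorm (F := fun t => f t - g (l t)) (c := M + N)) => s.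
  by rewrite (le_trans (ler_normB _ _))// lerD.
apply: (le_unorm (F := fun t => uval (l t) - uval t) (c := 2)) => s.
have := uval_itv s; have := uval_itv (l s); rewrite ler_norml; lra.
Qed.

Lemma J1_cost_ge0 f g l : 0 <= J1_cost f g l.
Proof.
have [|t _] := @uval_surj 0; first by rewrite lexx ler01.
exact: le_trans (normr_ge0 _) (le_J1_cost f g l t).1.
Qed.

Lemma time_change_id : time_change (@id I).
Proof.
split=> //; split; first by move=> t; exact: cvg_id.
by exists id; split => // t; exact: cvg_id.
Qed.

Lemma time_change_inv l m : time_change l ->
  cancel l m -> cancel m l -> continuous m -> time_change m.
Proof.
move=> [lm [lc _]] lK mK mc; split.
  move=> s t st; have [//|ts] := leP (uval (m s)) (uval (m t)).
  have := lm _ _ (ltW ts); rewrite !mK => ts'.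
  have /eqP : uval s = uval t by apply/eqP; rewrite eq_le st.
  by move=> /eqP /uval_inj E; move: ts; rewrite E ltxx.
by split => //; exists l.
Qed.

Lemma time_change_comp l m : time_change l -> time_change m ->
  time_change (m \o l).
Proof.
move=> [lh [lc [l' [lK l'K l'c]]]] [mh [mc [m' [mK m'K m'c]]]]; split.
  by move=> s t st; apply: mh; exact: lh.
split; first by move=> t; apply: continuous_comp; [exact: lc|exact: mc].
exists (l' \o m'); split; [exact: can_comp|exact: can_comp|].
by move=> t; apply: continuous_comp; [exact: m'c|exact: l'c].
Qed.

Lemma time_change1 l t : time_change l -> uval t = 1 -> l t = t.
Proof.
move=> [lm [_ [m [lK mK _]]]] t1; apply: uval_inj.
have : uval (l (m t)) <= uval (l t).
  by apply: lm; rewrite t1; have /andP[] := uval_itv (m t).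
rewrite mK => lt_ge; apply/eqP; rewrite eq_le lt_ge andbT t1.
by have /andP[] := uval_itv (l t).
Qed.

Lemma J1_dist_lt f g c : J1_dist f g < c ->
  exists2 l, time_change l & J1_cost f g l < c.
Proof.
move=> /inf_lt [|_ [l tl <-] lc]; last by exists l.
by exists (J1_cost f g id), id => //; exact: time_change_id.
Qed.

Lemma J1_dist_le f g l : time_change l -> J1_dist f g <= J1_cost f g l.
Proof.
move=> tl; apply: ge_inf; last by exists l.
by exists 0 => _ [m _ <-]; exact: J1_cost_ge0.
Qed.

Lemma J1_dist_ge0 f g : 0 <= J1_dist f g.
Proof.
apply: lb_le_inf.
  by exists (J1_cost f g id), id => //; exact: time_change_id.
by move=> _ [l _ <-]; exact: J1_cost_ge0.
Qed.

Lemma J1_distxx f : J1_dist f f = 0.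
Proof.
apply/eqP; rewrite eq_le J1_dist_ge0 andbT.
apply: (le_trans (J1_dist_le f f time_change_id)).
by apply: J1_cost_le => t; rewrite subrr normr0.
Qed.

Lemma J1_dist_sym_le f g : J1_dist f g <= J1_dist g f.
Proof.
apply/ler_addgt0Pr => e e0.
have [|l tl lc] := @J1_dist_lt g f (J1_dist g f + e); first by rewrite ltrDl.
have [_ [_ [m [lK mK mc]]]] := tl.
have tm := time_change_inv tl lK mK mc.
apply: (le_trans (J1_dist_le f g tm)); apply: le_trans (ltW lc).
apply: J1_cost_le => t; have [a b] := le_J1_cost g f l (m t);
  by rewrite distrC; rewrite mK in a b.
Qed.

Lemma J1_dist_sym f g : J1_dist f g = J1_dist g f.
Proof. by apply/eqP; rewrite eq_le !J1_dist_sym_le. Qed.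

Lemma J1_dist_triangle g f h : J1_dist f h <= J1_dist f g + J1_dist g h.
Proof.
apply/ler_addgt0Pr => e e0.
have [|l tl lc] := @J1_dist_lt f g (J1_dist f g + e / 2).
  by rewrite ltrDl divr_gt0.
have [|m tm mc] := @J1_dist_lt g h (J1_dist g h + e / 2).
  by rewrite ltrDl divr_gt0.
apply: (le_trans (J1_dist_le f h (time_change_comp tl tm))).
apply: J1_cost_le => t /=; have [a1 a2] := le_J1_cost f g l t;
  have [b1 b2] := le_J1_cost g h m (l t).
  have := ler_distD (g (l t)) (f t) (h (m (l t))); lra.
have := ler_distD (uval (l t)) (uval (m (l t))) (uval t); lra.
Qed.

Lemma J1_dist_eq0 f g : J1_dist f g = 0 -> f = g.
Proof.
move=> d0.
have small e : 0 < e -> exists l, [/\ time_change l,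
    forall t, `|f t - g (l t)| < e & forall t, `|uval (l t) - uval t| < e].
  move=> e0; have [|l tl lc] := @J1_dist_lt f g e; first by rewrite d0.
  by exists l; split => // t; have [a b] := le_J1_cost f g l t;
    [exact: le_lt_trans a lc|exact: le_lt_trans b lc].
suff fg t : f t = g t.
  by case: f g fg {d0 small} => [f pf] [g pg] /= /funext fg; subst g;
     congr Cadlag; exact: Prop_irrelevance.
have [t1|/eqP t1] := eqVneq (uval t) 1.
  apply/eqP; rewrite -subr_eq0 -normr_le0; apply/ler_addgt0Pr => e e0.
  have [l [tl la _]] := small e e0; rewrite add0r.
  by have := la t; rewrite (time_change1 tl t1) => /ltW.
have {}t1 : uval t < 1.
  by have /andP[_] := uval_itv t; rewrite le_eqVlt => /orP[/eqP/t1|].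
apply/eqP; rewrite -subr_eq0 -normr_le0; apply/ler_addgt0Pr => e e0.
rewrite add0r; have e3 : 0 < e / 3 by rewrite divr_gt0.
have [d1 d10 H1] := cadlag_right f t e3; have [d2 d20 H2] := cadlag_right g t e3.
pose d := Num.min (Num.min d1 d2) (1 - uval t).
have d_gt0 : 0 < d by rewrite !lt_min d10 d20 subr_gt0.
have [dd1 dd2 dd3] : [/\ d <= d1, d <= d2 & d <= 1 - uval t].
  by rewrite /d; split; rewrite !ge_min lexx ?orbT.
have /andP[t0 _] := uval_itv t.
have [|s sE] := @uval_surj (uval t + d / 2); first by apply/andP; split; lra.
have [|l [tl la lb]] := small (Num.min (e / 3) (d / 2)).
  by rewrite lt_min e3 divr_gt0.
have := la s; have := lb s; rewrite !lt_min => /andP[_ bs] /andP[as_ _].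
have /H1 fs : uval t <= uval s < uval t + d1 by apply/andP; split; lra.
have /H2 gs : uval t <= uval (l s) < uval t + d2.
  by move: bs; rewrite ltr_norml => /andP[? ?]; apply/andP; split; lra.
have := ler_distD (f s) (f t) (g t); have := ler_distD (g (l s)) (f s) (g t).
rewrite (distrC (g (l s))); lra.
Qed.

End J1_metric.

HB.instance Definition _ (R : realType) := @isMetric.Build R (cadlag R)
  (@J1_dist R) (@J1_distxx R) (@J1_dist_eq0 R) (@J1_dist_sym R)
  (@J1_dist_triangle R).

Definition borel (S : topologicalType) : set (set S) := <<s [set U | open U] >>.

(* The infimum is taken in the extended reals so that the neighborhoods of the
   empty set are empty. *)
Definition closed_nbhd (R : realType) (S : metricType R) (A : set S) (e : R) :
    set S :=
  [set x | (ereal_inf [set (mdist x y)%:E | y in A] <= e%:E)%E].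

Definition rate_function (R : realType) (S : topologicalType)
    (I : S -> \bar R) : Prop :=
  (forall x, (0 <= I x)%E) /\ lower_semicontinuous I.

(* [0 < a n] only has to hold eventually: a speed such as L(n)n^alpha may vanish
   for small n, and finitely many n do not affect the limits. *)
Definition extended_LDP (R : realType) (d : measure_display)
    (T : measurableType d) (P : probability T R) (S : metricType R)
    (X : nat -> T -> S) (a : nat -> R) (I : S -> \bar R) : Prop :=
  [/\ forall n A, borel A -> measurable (X n @^-1` A),
      \forall n \near \oo, 0 < a n,
      a n @[n --> \oo] --> +oo,
      rate_function I &
      forall A, borel A ->
        let r := fun n => (lne (P (X n @^-1` A)) / (a n)%:E)%E in
        [/\ (- ereal_inf (I @` A°) <= limn_einf r)%E,
            (limn_einf r <= limn_esup r)%E &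
            (limn_esup r <=
               - lim (ereal_inf (I @` closed_nbhd A e) @[e --> 0^'+]))%E]].

Definition independent_RVs (R : realType) (d : measure_display)
    (T : measurableType d) (P : probability T R) (Z : nat -> T -> R) : Prop :=
  forall (J : seq nat) (A : nat -> set R), uniq J ->
    (forall i, measurable (A i)) ->
    P (\bigcap_(i in [set` J]) (Z i @^-1` A i)) =
    (\prod_(i <- J) P (Z i @^-1` A i))%E.

Definition slowly_varying (R : realType) (L : R -> R) : Prop :=
  (exists x0 : R, measurable_fun `[x0, +oo[ L /\
     forall x, x0 <= x -> 0 < L x) /\
  forall c : R, 0 < c -> L (c * x) / L x @[x --> +oo] --> (1 : R).

Definition sum_path (R : realType) (n : nat) (y : nat -> R) (t : unit_itv R) :
    R :=
  n%:R^-1 * \sum_(1 <= i < (Num.truncn (n%:R * uval t)).+1) y i.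

Lemma cadlag_sum_path (R : realType) (n : nat) (y : nat -> R) :
  cadlag_fun (sum_path n y).
Proof.
pose G (k : nat) : R := n%:R^-1 * \sum_(1 <= i < k.+1) y i.
move=> t; have /andP[t0 t1] := uval_itv t.
set F := sum_path n y.
have FE s : F s = G (Num.truncn (n%:R * uval s)) by [].
have n0 : (0 : R) <= n%:R by [].
case: (posnP n) => [nE|n_gt0].
  have -> : F = fun=> 0 by apply/funext => s; rewrite FE /G nE invr0 mul0r.
  by split; [exact: cvg_cst|exists 0; exact: cvg_cst].
have np : (0 : R) < n%:R by rewrite ltr0n.
have nt0 : 0 <= n%:R * uval t by rewrite mulr_ge0.
split.
  set k := Num.truncn (n%:R * uval t).
  have /andP[k1 k2] := truncn_itv nt0; rewrite -/k in k1 k2.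
  apply: (@cvg_trans _ (cst (F t) @ uright t)); last exact: cvg_cst.
  apply: near_eq_cvg; apply/near_uvalP.
  exists (k.+1%:R / n%:R - uval t).
    by rewrite subr_gt0 ltr_pdivlMr// mulrC.
  move=> s ts st; rewrite /cst !FE -/k; congr G; apply/esym/truncn_def.
  have {}st : uval t < uval s := st.
  have nst : n%:R * uval t < n%:R * uval s by rewrite ltr_pM2l.
  rewrite (le_trans k1 (ltW nst))/=.
  move: ts; rewrite distrC gtr0_norm ?subr_gt0// ltrD2r.
  by rewrite ltr_pdivlMr// mulrC.
have [tE|tN0] := eqVneq (uval t) 0.
  exists 0 => U _; apply/near_uvalP; exists 1 => // s _ /=.
  by rewrite tE ltNge; have /andP[-> _] := uval_itv s.
have tp : 0 < uval t by rewrite lt_neqAle eq_sym tN0.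
have [k /andP[k1 k2]] : exists k : nat, k%:R < n%:R * uval t <= k.+1%:R.
  have /andP[] := truncn_itv nt0; set j := Num.truncn _.
  rewrite le_eqVlt => /orP[/eqP jE _|j1 j2]; last first.
    by exists j; rewrite j1 ltW.
  case: j jE => [|j] jE.
    by have := mulr_gt0 np tp; rewrite -jE ltxx.
  by exists j; rewrite -jE ltr_nat ltnSn lexx.
exists (G k); apply: (@cvg_trans _ (cst (G k) @ uleft t)); last exact: cvg_cst.
apply: near_eq_cvg; apply/near_uvalP.
exists (uval t - k%:R / n%:R); first by rewrite subr_gt0 ltr_pdivrMr// mulrC.
move=> s ts st; rewrite /cst !FE; congr G; apply/esym/truncn_def.
have {}st : uval s < uval t := st.
have nst : n%:R * uval s < n%:R * uval t by rewrite ltr_pM2l.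
rewrite (lt_le_trans nst k2) andbT mulrC -ler_pdivrMr//.
by move: ts; rewrite gtr0_norm ?subr_gt0// ltrD2l ltrN2 => /ltW.
Qed.

Definition sum_cadlag (R : realType) (n : nat) (y : nat -> R) : cadlag R :=
  Cadlag (cadlag_sum_path n y).

(* At [t = 0] the filter [uleft t] is improper and [jump f 0] is meaningless;
   the elements of [pure_jump] vanish at 0 and do not jump there. *)
Definition jump (R : realType) (f : unit_itv R -> R) (t : unit_itv R) : R :=
  f t - lim (f @ uleft t).

Definition jump_times (R : realType) (f : unit_itv R -> R) :
    set (unit_itv R) :=
  [set t | 0 < uval t /\ f t != lim (f @ uleft t)].

Definition pure_jump (R : realType) : set (cadlag R) :=
  [set xi : cadlag R | exists (x : nat -> R) (u : nat -> unit_itv R),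
     [/\ forall i, 0 <= x i, forall i, 0 < uval (u i), injective u &
         forall t, (\sum_(0 <= i < k) x i * (uval (u i) <= uval t)%R%:R)
                     @[k --> \oo] --> xi t]].

Definition weibull_rate (R : realType) (alpha : R) (xi : cadlag R) : \bar R :=
  if `[< pure_jump xi >] then
    (\esum_(t in jump_times xi) (jump xi t `^ alpha)%:E)%E
  else +oo%E.

(* Main.v *)
(* One big jump. Split each Z_i at level [delta n]. By Chernoff's bound at the
   exponential scale [theta = s q(n)/n], where [q(x) = L(x) x^alpha], the centered
   sums of the truncated variables are uniformly small up to an event of
   probability [exp (- s' q(n))] with [s'] arbitrarily large; here monotonicity
   of [q(x)/x] lets [exp (theta Z 1{Z <= delta n})] be dominated by an integrable
   function of [Z]. So the path is close, in the uniform norm, to the pure jump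
   path formed by the few jumps [Z_i > delta n].
   Upper bound: since [q(z) ~ (z/n)^alpha q(n)] uniformly for [delta n < z <= M n],
   the variables [exp (theta (Z_i/n)^alpha q(n) 1{Z_i > delta n})], [theta < 1],
   have mean [1 + o(1/n)], and Markov's inequality shows that the rate of that jump
   path exceeds [c] with probability at most [exp (- c' q(n))] for each [c' < c]
   (a single jump above [M n], [M^alpha = c], is already that unlikely).
   Lower bound: an element of finite rate is approximated, with smaller rate, by
   finitely many jumps [x_i] at grid times [k_i/n]; prescribe [Z_{k_i}] to lie just
   above [n x_i] and apply the small-jump estimate to the other variables.
   No compactness is available: the upper bound only concerns the closed
   neighborhood of [A], and the good approximants need not converge. *)

Require Import Defs.
From HB Require Import structures.
From mathcomp Require Import all_boot all_order all_algebra.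
From mathcomp Require Import all_classical all_reals all_analysis.
From mathcomp Require Import measurable_realfun lra zify.

Set Implicit Arguments.
Unset Strict Implicit.
Unset Printing Implicit Defensive.

Import Order.TTheory GRing.Theory Num.Theory.
Import numFieldNormedType.Exports.

Local Open Scope classical_set_scope.
Local Open Scope ring_scope.

(** * Pure jump paths *)

Section jumps.
Variable R : realType.
Local Notation I := (unit_itv R).
Implicit Types (s t : I) (xi : cadlag R) (x : nat -> R) (u : nat -> I).

(** Besides the two bounds, the rate has to be lower semi-continuous, and there a limit of pure jump
    paths might acquire a continuous part out of many vanishing jumps. Concavity of the power
    forbids this: a jump x <= 2 delta satisfies x <= (2 delta)^(1 - alpha) x^alpha, so under a rate
    bound a all such jumps add up to at most (2 delta)^(1 - alpha) a, which vanishes with delta.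
    Uniform smallness of the truncated sums is a plain union bound over the indices: regular
    variation of positive index makes q(n) outgrow every multiple of ln n, so factors of order n are
    free. Only the lower bound needs more than the uniform distance, as the jump times of a path are
    arbitrary while the walk jumps on the grid; a piecewise linear time change aligns the finitely
    many large jumps exactly. *)

Definition jump_series xi x u :=
  [/\ forall i, 0 <= x i, forall i, 0 < uval (u i), injective u &
      forall t, (\sum_(0 <= i < k) x i * (uval (u i) <= uval t)%R%:R)
        @[k --> \oo] --> xi t].

Lemma uleft_proper t : 0 < uval t -> ProperFilter (uleft t).
Proof.
move=> t0; apply: Build_ProperFilter_ex => U /near_uvalP [e e0 eU].
have /andP[_ t1] := uval_itv t.
pose m := Num.min e (uval t) / 2.
have m0 : 0 < m by rewrite divr_gt0// lt_min e0.
have [me mt] : m < e /\ m < uval t.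
  rewrite /m; have : Num.min e (uval t) <= e by rewrite ge_min lexx.
  have : Num.min e (uval t) <= uval t by rewrite ge_min lexx orbT.
  by move: m0; rewrite /m => ? ? ?; split; lra.
have [|s sE] := @uval_surj R (uval t - m); first by apply/andP; split; lra.
exists s; apply: eU; last by rewrite /= sE; lra.
by rewrite sE opprB addrC subrK gtr0_norm.
Qed.

Lemma cvg_uleft (f : I -> R) t l :
  (forall e, 0 < e -> exists2 d, 0 < d &
     forall s, uval t - d < uval s < uval t -> `|l - f s| <= e) ->
  f @ uleft t --> l.
Proof.
move=> H; apply/cvgrPdist_le => e e0; have [d d0 Hd] := H e e0.
apply/near_uvalP; exists d => // s ts st; apply: Hd.
move: ts; rewrite gtr0_norm ?subr_gt0// => ts; apply/andP; split => //.
by rewrite ltrBlDr -ltrBlDl.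
Qed.

Lemma lim_uleft (f : I -> R) t l : 0 < uval t -> f @ uleft t --> l ->
  lim (f @ uleft t) = l.
Proof. by move=> t0 fl; have F := uleft_proper t0; apply/cvg_lim. Qed.

Lemma cadlag_uleft xi t : 0 < uval t -> forall e, 0 < e -> exists2 d, 0 < d &
  forall s, uval t - d < uval s < uval t ->
    `|lim (xi @ uleft t) - xi s| < e.
Proof.
move=> t0; have [l xil] := cadlag_left xi t.
suff -> : lim (xi @ uleft t) = l by [].
apply: lim_uleft => //; apply: cvg_uleft => e /xil [d d0 H].
by exists d => // s /H/ltW.
Qed.

Lemma jump_series_ge xi x u t k : jump_series xi x u ->
  \sum_(0 <= i < k) x i * (uval (u i) <= uval t)%R%:R <= xi t.
Proof.
move=> [x0 _ _ /(_ t) xit]; rewrite -(cvg_lim _ xit)//.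
apply: nondecreasing_cvgn_le; last by apply/cvg_ex; exists (xi t).
apply/nondecreasing_seqP => n; rewrite big_nat_recr//= lerDl.
by rewrite mulr_ge0.
Qed.

Lemma jump_series_approx xi x u t e : jump_series xi x u -> 0 < e ->
  exists N, forall k, (N <= k)%N ->
    xi t - e < \sum_(0 <= i < k) x i * (uval (u i) <= uval t)%R%:R.
Proof.
move=> [_ _ _ /(_ t) /cvgrPdist_lt H] /H [N _ HN]; exists N => k /HN /=.
by rewrite ltr_norml => /andP[_ ?]; lra.
Qed.

Lemma jump_series_le xi x u t c : jump_series xi x u ->
  (forall k, \sum_(0 <= i < k) x i * (uval (u i) <= uval t)%R%:R <= c) ->
  xi t <= c.
Proof.
move=> S H; apply/ler_addgt0Pr => e e0.
have [N /(_ _ (leqnn _))] := jump_series_approx t S e0.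
by have := H N; lra.
Qed.

(** Finitely many times leave a gap to the left of [t], on which the first [N] indicators already
    have their left limits at [t]. *)
Lemma left_gap u t N : exists2 d, 0 < d & forall s, uval t - d < uval s < uval t ->
  forall i, (i < N)%N ->
    (uval (u i) <= uval s) = (uval (u i) <= uval t) && (u i != t).
Proof.
elim: N => [|N [d d0 IH]]; first by exists 1.
have [ut|tu] := ltP (uval (u N)) (uval t); last first.
  exists d => // s sd i; rewrite ltnS leq_eqVlt => /orP[/eqP->|]; last exact: IH.
  have /andP[_ st] := sd.
  rewrite leNgt (lt_le_trans st tu)/=; apply/esym/negbTE.
  rewrite negb_and negbK -ltNge orbC; move: tu; rewrite le_eqVlt.
  by move=> /orP[/eqP /uval_inj ->|->]; rewrite ?eqxx ?orbT.
exists (Num.min d (uval t - uval (u N))); first by rewrite lt_min d0 subr_gt0.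
move=> s /andP[s1 s2] i.
have ds : uval t - d < uval s < uval t.
  rewrite s2 andbT; apply: le_lt_trans s1.
  by rewrite lerD2l lerN2 ge_min lexx.
rewrite ltnS leq_eqVlt => /orP[/eqP->|]; last exact: IH.
rewrite (ltW ut) /=; have -> : u N != t by apply: contraTneq ut => ->; rewrite ltxx.
apply/ltW; apply: le_lt_trans s1.
have : Num.min d (uval t - uval (u N)) <= uval t - uval (u N).
  by rewrite ge_min lexx orbT.
by lra.
Qed.

(** The hypothesis on [J] covers both a time [t] of the series and a time outside it. Only the left
    limit [xi t - J] has to be found: from above by adding the terms at [t] to a partial sum at [s],
    from below by cutting the series where its tail at [t] is below [e]. *)
Lemma jump_series_jump xi x u t J N : jump_series xi x u -> 0 < uval t ->
  (forall k, (N <= k)%N -> \sum_(0 <= i < k) x i * (u i == t)%:R = J) ->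
  jump xi t = J.
Proof.
move=> S t0 HJ; have [x0 _ _ _] := S.
suff /(lim_uleft t0) E : xi @ uleft t --> xi t - J.
  by rewrite /jump E opprB addrC subrK.
apply: cvg_uleft => e e0.
have [M HM] := jump_series_approx t S e0.
pose K := maxn N M; have [NK MK] : (N <= K /\ M <= K)%N.
  by rewrite leq_maxl leq_maxr.
have [d d0 Hd] := left_gap u t K; exists d => // s sd.
have /andP[_ st] := sd.
have up : xi s <= xi t - J.
  apply: (jump_series_le S) => k; rewrite lerBrDr.
  apply: le_trans (jump_series_ge t (maxn N k) S).
  rewrite -(HJ (maxn N k)) ?leq_maxl// [in X in _ <= X](big_cat_nat (n := k))//= ?leq_maxr//.
  rewrite [X in _ + X <= _](big_cat_nat (n := k))//= ?leq_maxr// addrA lerD//.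
    rewrite -big_split/=; apply: ler_sum => i _.
    rewrite -mulrDr ler_wpM2l// -natrD ler_nat.
    have [->|/eqP ut] := eqVneq (u i) t; first by rewrite lexx leNgt st.
    rewrite addn0; case: (leP (uval (u i)) (uval s)) => // us.
    by rewrite (le_trans us (ltW st)).
  apply: ler_sum => i _; rewrite ler_wpM2l// ler_nat.
  by have [->|//] := eqVneq (u i) t; rewrite lexx.
have lo : xi t - e < xi s + J.
  apply: (lt_le_trans (HM K MK)); rewrite -(HJ K NK).
  apply: le_trans (lerD (jump_series_ge s K S) (lexx _)).
  rewrite -big_split/=; rewrite !big_nat; apply: ler_sum => i /andP[_ iK].
  rewrite -mulrDr ler_wpM2l// -natrD ler_nat (Hd s sd i iK).
  by have [->|/eqP ut] := eqVneq (u i) t; rewrite ?andbT ?andbF ?addn0 ?lexx// leq_b1.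
by rewrite ler_norml; apply/andP; split; lra.
Qed.

Lemma jump_series_jumpE xi x u i : jump_series xi x u -> jump xi (u i) = x i.
Proof.
move=> S; have [_ u0 uI _] := S.
apply: (jump_series_jump (N := i.+1) S (u0 i)) => k ik.
rewrite (bigD1_seq i)/= ?mem_index_iota ?iota_uniq//.
rewrite eqxx mulr1 big1 ?addr0// => j /negPf ji.
by rewrite (inj_eq uI) ji mulr0.
Qed.

Lemma jump_series_jump0 xi x u t : jump_series xi x u -> 0 < uval t ->
  (forall i, u i != t) -> jump xi t = 0.
Proof.
move=> S t0 ut; apply: (jump_series_jump (N := 0%N) S t0) => k _.
by rewrite big1// => i _; rewrite (negPf (ut i)) mulr0.
Qed.

Lemma jump_series_jump_ge0 xi x u t : jump_series xi x u -> 0 < uval t ->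
  0 <= jump xi t.
Proof.
move=> S t0; have [[i <-]|H] := pselect (exists i, u i = t).
  by rewrite (jump_series_jumpE _ S); have [] := S.
rewrite (jump_series_jump0 S t0)// => i; apply/eqP => ut.
by apply: H; exists i.
Qed.

(** Arbitrary lists of positive times are allowed: where there is no jump the power is 0, as [alpha]
    is positive. A time change can then carry a list along without a check that the images are jump
    times. *)
Lemma weibull_rateP (alpha a : R) xi : 0 < alpha ->
  (weibull_rate alpha xi <= a%:E)%E <->
  pure_jump xi /\ forall s : seq I, uniq s -> {in s, forall t, 0 < uval t} ->
    \sum_(t <- s) jump xi t `^ alpha <= a.
Proof.
move=> alpha0; rewrite /weibull_rate; split.
  case: asboolP => [pj|//]; move=> H; split => // s us s0.
  pose A := [set` s] `&` jump_times xi.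
  have fA : finite_set A by apply: finite_setIl; exact: finite_seq.
  rewrite -lee_fin; apply: le_trans H.
  rewrite -sumEFin (fsbig_seq _ _ us)//.
  have -> : (\sum_(i \in [set` s]) (jump xi i `^ alpha)%:E =
             \sum_(i \in A) (jump xi i `^ alpha)%:E)%E.
    apply/esym/fsbig_widen => [t []//|t [/= ts nA]].
    have : ~ jump_times xi t by move=> ?; apply: nA.
    rewrite /jump_times /= => /not_andP [|/negP]; first by move=> []; exact: s0.
    by rewrite negbK /jump => /eqP <-; rewrite subrr powR0 ?gt_eqF.
  by apply: esum_ge; exists A => //; split => // t [].
move=> [pj H]; rewrite asboolT//; apply: ge_ereal_sup => _ [A [fA At]] <-.
rewrite fsbig_finite//= sumEFin lee_fin; apply: H; first exact: finmap.fset_uniq.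
by move=> t; rewrite in_fset_set// inE => /At [].
Qed.

End jumps.

(** * Finite sums, subadditivity of powers, enumeration of countable sets *)

Section sums.
Variable R : realType.

Lemma ler_sum_subset (T : eqType) (s s' : seq T) (F : T -> R) :
  uniq s -> uniq s' -> {subset s <= s'} -> {in s', forall i, 0 <= F i} ->
  \sum_(i <- s) F i <= \sum_(i <- s') F i.
Proof.
move=> us us' ss' F0; rewrite [leRHS](bigID (mem s))/= -[X in _ <= X + _]big_filter.
have -> : \sum_(i <- s) F i = \sum_(i <- [seq i <- s' | i \in s]) F i.
  apply: perm_big; apply: uniq_perm => //; first exact: filter_uniq.
  by move=> i; rewrite mem_filter; case: (boolP (i \in s)) => //= /ss' ->.
by rewrite lerDl big_seq_cond sumr_ge0// => i /andP[/F0].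
Qed.

Lemma sum_const_seq (T : Type) (s : seq T) (c : R) :
  \sum_(i <- s) c = c * (size s)%:R.
Proof. by rewrite big_const_seq count_predT iter_addr addr0 mulr_natr. Qed.

Lemma sum_pred1_uniq (T : eqType) (s : seq T) (a : T) : uniq s ->
  \sum_(v <- s) (a == v)%:R = (a \in s)%:R :> R.
Proof.
move=> us; rewrite -natr_sum; congr _%:R.
rewrite -count_uniq_mem// -sum1_count [RHS]big_mkcond/=.
by apply: eq_bigr => v _; rewrite eq_sym; case: eqP.
Qed.

(** A ratio [z / (x + y)] at most 1 is bounded by its own power of exponent [alpha]; the ratios for
    [z = x] and [z = y] add up to 1. *)
Lemma powR_subadd (x y alpha : R) : 0 <= x -> 0 <= y -> 0 < alpha <= 1 ->
  (x + y) `^ alpha <= x `^ alpha + y `^ alpha.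
Proof.
move=> x0 y0 /andP[a0 a1].
have [->|xN] := eqVneq x 0; first by rewrite add0r powR0 ?gt_eqF// add0r.
have xp : 0 < x by rewrite lt_neqAle eq_sym xN.
have [->|yN] := eqVneq y 0; first by rewrite addr0 powR0 ?gt_eqF// addr0.
have yp : 0 < y by rewrite lt_neqAle eq_sym yN.
have s0 : 0 < x + y by rewrite addr_gt0.
have key z : 0 < z -> z <= x + y ->
    z / (x + y) * (x + y) `^ alpha <= z `^ alpha.
  move=> z0 zs.
  have -> : z `^ alpha = (z / (x + y)) `^ alpha * (x + y) `^ alpha.
    by rewrite -powRM ?divrK ?unitfE ?gt_eqF// ?divr_ge0// ltW.
  rewrite ler_wpM2r ?powR_ge0// ger1_powR// divr_gt0//=.
  by rewrite ler_pdivrMr// mul1r.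
have Kx := key x xp; have Ky := key y yp.
rewrite -[leLHS]mul1r -[X in X * _](@divff _ (x + y)) ?gt_eqF//.
by rewrite mulrDl mulrDl lerD ?Kx ?Ky// ?lerDl ?lerDr.
Qed.

(** Serves [pure_jump], which asks for an injective sequence of times indexed by all of [nat]. *)
Lemma enum_countable (T : Type) (A : set T) : countable A -> infinite_set A ->
  exists e : nat -> T, injective e /\ range e = A.
Proof.
move=> /eq_card_nat/[apply] /card_set_bijP[f [_ fI fS]].
have /choice [e eP] : forall n : nat, exists t, A t /\ f t = n.
  by move=> n; have [t At <-] := fS n Logic.I; exists t.
exists e; split.
  by move=> i j ij; rewrite -(eP i).2 -(eP j).2 ij.
apply/seteqP; split => [_ [n _ <-]|t At]; first exact: (eP n).1.
by exists (f t) => //; apply: fI; rewrite ?inE ?(eP (f t)).2//; exact: (eP _).1.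
Qed.

End sums.

(** * Lower semi-continuity of the rate *)

Section lsc.
Variable R : realType.
Local Notation I := (unit_itv R).
Implicit Types (s t : I) (xi y : cadlag R) (x : nat -> R) (u : nat -> I).

Lemma time_change_lt (l : I -> I) s t : time_change l ->
  uval s < uval t -> uval (l s) < uval (l t).
Proof.
move=> [lh [_ [m [lK _ _]]]] st; rewrite lt_neqAle lh ?(ltW st)// andbT.
by apply: contraTneq st => /uval_inj /(can_inj lK) ->; rewrite ltxx.
Qed.

Lemma time_change_gt0 (l : I -> I) t : time_change l ->
  0 < uval t -> 0 < uval (l t).
Proof.
move=> tl t0; have [|o oE] := @uval_surj R 0; first by rewrite lexx ler01.
have /(time_change_lt tl) : uval o < uval t by rewrite oE.
by apply: le_lt_trans; have /andP[] := uval_itv (l o).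
Qed.

(** An increasing homeomorphism carries left limits to left limits, so the value and the left limit
    each move by at most [rho]. *)
Lemma jump_time_change xi y (l : I -> I) t rho : time_change l ->
  (forall s, `|xi s - y (l s)| <= rho) -> 0 < uval t ->
  `|jump xi t - jump y (l t)| <= 2 * rho.
Proof.
move=> tl xy t0; have lt0 := time_change_gt0 tl t0.
suff H : `|lim (xi @ uleft t) - lim (y @ uleft (l t))| <= rho.
  have -> : jump xi t - jump y (l t) = (xi t - y (l t)) -
      (lim (xi @ uleft t) - lim (y @ uleft (l t))) by rewrite /jump; lra.
  by apply: le_trans (ler_normB _ _) _; have := xy t; lra.
apply/ler_addgt0Pr => e e0; have e2 : 0 < e / 2 by rewrite divr_gt0.
have [d1 d10 H1] := cadlag_uleft xi t0 e2.
have [d2 d20 H2] := cadlag_uleft y lt0 e2.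
have /near_uvalP [d3 d30 H3] :
    nbhs t (l @^-1` [set v | `|uval (l t) - uval v| < d2]).
  by apply: (tl.2.1 t); apply/near_uvalP; exists d2.
pose d := Num.min (Num.min d1 d3) (uval t).
have dp : 0 < d by rewrite !lt_min d10 d30.
have [dd1 dd3 ddt] : [/\ d <= d1, d <= d3 & d <= uval t].
  by rewrite /d; split; rewrite !ge_min lexx ?orbT.
have /andP[_ t1] := uval_itv t.
have [|s sE] := @uval_surj R (uval t - d / 2); first by apply/andP; split; lra.
have st : uval s < uval t by rewrite sE; lra.
have /H1 A : uval t - d1 < uval s < uval t by rewrite st andbT sE; lra.
have ls := time_change_lt tl st.
have /H2 B : uval (l t) - d2 < uval (l s) < uval (l t).
  rewrite ls andbT.
  have /H3 : `|uval t - uval s| < d3.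
    by rewrite gtr0_norm ?subr_gt0// sE; lra.
  by rewrite /= gtr0_norm ?subr_gt0//; lra.
have := xy s; rewrite !ler_norml => /andP[C1 C2].
move: A B; rewrite !ltr_norml => /andP[A1 A2] /andP[B1 B2].
by apply/andP; split; lra.
Qed.

Lemma jump_series_partial xi x u v : jump_series xi x u -> 0 < uval v ->
  exists N, forall k, (N <= k)%N ->
    \sum_(0 <= i < k) x i * (u i == v)%:R = jump xi v.
Proof.
move=> S v0; have [_ u0 uI _] := S.
have [[i <-]|H] := pselect (exists i, u i = v).
  exists i.+1 => k ik; rewrite (jump_series_jumpE _ S).
  rewrite (bigD1_seq i)/= ?mem_index_iota ?iota_uniq//.
  rewrite eqxx mulr1 big1 ?addr0// => j /negPf ji.
  by rewrite (inj_eq uI) ji mulr0.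
have uv i : u i != v by apply/eqP => ?; apply: H; exists i.
exists 0%N => k _; rewrite (jump_series_jump0 S v0)// big1// => i _.
by rewrite (negPf (uv i)) mulr0.
Qed.

Lemma jump_series_partial_le xi x u v k : jump_series xi x u -> 0 < uval v ->
  \sum_(0 <= i < k) x i * (u i == v)%:R <= jump xi v.
Proof.
move=> S v0; have [x0 _ _ _] := S.
have [N H] := jump_series_partial S v0.
rewrite -(H (maxn N k)) ?leq_maxl// [in leRHS](big_cat_nat (n := k))//= ?leq_maxr//.
by rewrite lerDl sumr_ge0// => i _; rewrite mulr_ge0.
Qed.

Lemma sum_jump_le xi x u (s : seq I) t : jump_series xi x u -> uniq s ->
  {in s, forall v, 0 < uval v} -> {in s, forall v, uval v <= uval t} ->
  \sum_(v <- s) jump xi v <= xi t.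
Proof.
move=> S us s0 st; have [x0 _ _ _] := S.
have [N HN] : exists N, {in s, forall v k, (N <= k)%N ->
    \sum_(0 <= i < k) x i * (u i == v)%:R = jump xi v}.
  elim: s s0 {us st} => [|v s IH] s0; first by exists 0%N.
  have [M HM] : exists N, {in s, forall v k, (N <= k)%N ->
      \sum_(0 <= i < k) x i * (u i == v)%:R = jump xi v}.
    by apply: IH => w ws; apply: s0; rewrite inE ws orbT.
  have [N HN] : exists N, forall k, (N <= k)%N ->
      \sum_(0 <= i < k) x i * (u i == v)%:R = jump xi v.
    by apply: (jump_series_partial S); apply: s0; rewrite mem_head.
  exists (maxn M N) => w; rewrite inE => + k; rewrite geq_max => + /andP[k1 k2].
  by move=> /orP[/eqP ->|ws]; [exact: HN|exact: HM].
apply: le_trans (jump_series_ge t N S).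
under eq_big_seq => v vs do rewrite -(HN v vs N (leqnn N)).
rewrite exchange_big/=; apply: ler_sum => i _; rewrite -mulr_sumr ler_wpM2l//.
rewrite sum_pred1_uniq// ler_nat; case: (boolP (u i \in s)) => // uis.
by rewrite st.
Qed.

(** The time change is explicit because the infimum in [J1_dist] need not be attained. Its spatial
    cost is what is recorded: values and jump sizes are the quantities that pass to the limit. *)
Definition approx (alpha a : R) xi rho y (l : I -> I) :=
  [/\ time_change l, forall s, `|xi s - y (l s)| <= rho &
      (weibull_rate alpha y <= a%:E)%E].

End lsc.

(** * Sublevel sets of the rate are closed *)

Section lsc_closed.
Variables (R : realType) (alpha a : R).
Local Notation I := (unit_itv R).
Hypothesis alpha01 : 0 < alpha < 1.
Variable xi : cadlag R.
Hypothesis close : forall rho : R, 0 < rho -> exists y l, approx alpha a xi rho y l.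
Implicit Types (s t : I).

Let alpha0 : 0 < alpha. Proof. by case/andP: alpha01. Qed.

Let a_ge0 : 0 <= a.
Proof.
have [y [l [_ _ /(weibull_rateP _ _ alpha0) [_ /(_ [::] isT)]]]] := close ltr01.
by rewrite big_nil; apply.
Qed.

Lemma limit_jump_ge0 t : 0 < uval t -> 0 <= jump xi t.
Proof.
move=> t0; apply/ler_addgt0Pr => e e0; have e2 : 0 < e / 2 by rewrite divr_gt0.
have [y [l [tl xy /(weibull_rateP _ _ alpha0) [[x [u S]] _]]]] := close e2.
have := jump_time_change tl xy t0; rewrite ler_norml => /andP[+ _].
have := jump_series_jump_ge0 S (time_change_gt0 tl t0).
lra.
Qed.

Lemma limit_sum_powR (s : seq I) : uniq s -> {in s, forall t, 0 < uval t} ->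
  \sum_(t <- s) jump xi t `^ alpha <= a.
Proof.
move=> us s0; apply/ler_addgt0Pr => e e0.
pose h := e / (size s).+1%:R; have h0 : 0 < h by rewrite divr_gt0.
(* Solves (2 rho)^alpha = [h], the error that subadditivity adds for each jump; over [s] the errors
   total at most [e]. *)
pose rho : R := h `^ alpha^-1 / 2.
have rho0 : 0 < rho by rewrite divr_gt0// powR_gt0.
have [y [l [tl xy /(weibull_rateP _ _ alpha0) [[x [u S]] Sy]]]] := close rho0.
have [_ [_ [m [lK _ _]]]] := tl.
have /Sy H : uniq (map l s) by rewrite map_inj_uniq//; exact: can_inj lK.
have {H} : \sum_(t <- s) jump y (l t) `^ alpha <= a.
  rewrite -(big_map l predT (fun t => jump y t `^ alpha)); apply: H.
  by move=> _ /mapP[t ts ->]; apply: time_change_gt0 => //; exact: s0.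
have E : h * (size s)%:R <= e.
  rewrite /h mulrAC ler_pdivrMr// ler_wpM2l// ?ler_nat// ltW//.
suff : \sum_(t <- s) jump xi t `^ alpha <=
    \sum_(t <- s) (jump y (l t) `^ alpha + h).
  rewrite big_split/= sum_const_seq => H1 H2.
  by apply: (le_trans H1); rewrite lerD.
rewrite !big_seq; apply: ler_sum => t ts; have t0 := s0 t ts.
have J0 := limit_jump_ge0 t0.
have K0 := jump_series_jump_ge0 S (time_change_gt0 tl t0).
have := jump_time_change tl xy t0; rewrite ler_norml => /andP[_ H].
have -> : h = (2 * rho) `^ alpha.
  by rewrite /rho mulrC divfK// -powRrM mulVf ?gt_eqF// powRr1// ltW.
have rho2 : 0 <= 2 * rho by lra.
apply: le_trans (powR_subadd K0 rho2 _); last by case/andP: alpha01 => -> /ltW.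
apply: ge0_ler_powR; rewrite ?nnegrE//; [exact: ltW|exact: addr_ge0|].
by move: H; lra.
Qed.

Lemma limit_sum_jump_le (s : seq I) t : uniq s -> {in s, forall v, 0 < uval v} ->
  {in s, forall v, uval v <= uval t} -> \sum_(v <- s) jump xi v <= xi t.
Proof.
move=> us s0 st; apply/ler_addgt0Pr => e e0.
pose rho : R := e / (2 * (size s).+1%:R).
have d0 : 0 < 2 * (size s).+1%:R :> R by rewrite mulr_gt0.
have rho0 : 0 < rho by rewrite divr_gt0.
have [y [l [tl xy /(weibull_rateP _ _ alpha0) [[x [u S]] Sy]]]] := close rho0.
have [lh [_ [m [lK _ _]]]] := tl.
have H : \sum_(v <- map l s) jump y v <= y (l t).
  apply: (sum_jump_le S).
  - by rewrite map_inj_uniq//; exact: can_inj lK.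
  - by move=> _ /mapP[v vs ->]; apply: time_change_gt0 => //; exact: s0.
  - by move=> _ /mapP[v vs ->]; apply: lh; exact: st.
rewrite big_map in H.
have : \sum_(v <- s) jump xi v <= \sum_(v <- s) (jump y (l v) + 2 * rho).
  rewrite !big_seq; apply: ler_sum => v vs.
  have := jump_time_change tl xy (s0 v vs); rewrite ler_norml => /andP[_].
  lra.
rewrite [X in _ <= X -> _]big_split/= sum_const_seq => H1.
have E : rho * (2 * (size s).+1%:R) = e by rewrite divfK// gt_eqF.
rewrite -[(size s).+1%:R]natr1 in E.
have := xy t; rewrite ler_norml => /andP[+ _].
set A := \sum_(v <- s) jump xi v in H1 *.
set B := \sum_(v <- s) jump y (l v) in H H1.
move: E H H1; set C := (size s)%:R; lra.
Qed.

(** Otherwise such lists exist in every length, and one with more than a / delta^alpha times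
    violates the rate bound. *)
Lemma limit_large_jumps (delta : R) : 0 < delta -> exists F : seq I,
  [/\ uniq F, {in F, forall t, 0 < uval t /\ delta <= jump xi t} &
     forall t, 0 < uval t -> delta <= jump xi t -> t \in F].
Proof.
move=> delta0; pose good (F : seq I) :=
  uniq F /\ {in F, forall t, 0 < uval t /\ delta <= jump xi t}.
apply: contrapT => H.
have ext n : exists2 F, good F & size F = n.
  elim: n => [|n [F [uF gF] sF]]; first by exists [::].
  have [t [t0 tj tF]] : exists t, [/\ 0 < uval t, delta <= jump xi t & t \notin F].
    apply: contrapT => H'; apply: H; exists F; split => // t t0 tj.
    by apply/negPn/negP => tF; apply: H'; exists t.
  exists (t :: F); last by rewrite /= sF.
  by split; [rewrite /= tF|move=> v; rewrite inE => /orP[/eqP ->|/gF]].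
have da : 0 < delta `^ alpha by rewrite powR_gt0.
have [F [uF gF] sF] := ext (Num.truncn (a / delta `^ alpha)).+1.
have := limit_sum_powR uF (fun t tF => (gF t tF).1).
apply/negP; rewrite -ltNge.
apply: (@lt_le_trans _ _ (\sum_(t <- F) delta `^ alpha)).
  rewrite sum_const_seq sF -ltr_pdivrMl// mulrC.
  by rewrite truncnS_gt.
rewrite !big_seq; apply: ler_sum => t /gF [t0 tj].
by apply: ge0_ler_powR; rewrite ?nnegrE ?(ltW alpha0)//; lra.
Qed.

(** This keeps a continuous part out of the limit: the jumps of a close [y] outside the image of [F]
    are at most [delta + 2 * rho <= 2 * delta], and the rate bound then controls their sum by
    concavity. *)
Lemma limit_le_large_jumps (delta : R) (F : seq I) t : 0 < delta -> uniq F ->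
  {in F, forall t, 0 < uval t} ->
  (forall t, 0 < uval t -> delta <= jump xi t -> t \in F) ->
  xi t <= \sum_(s <- F | uval s <= uval t) jump xi s +
          (2 * delta) `^ (1 - alpha) * a.
Proof.
move=> delta0 uF F0 HF; apply/ler_addgt0Pr => e e0.
(* Pays for an error [2 * rho] at each time of [F] and for the error [rho] in the value at [t]. *)
pose K : R := 2 * (size F).+1%:R; have K0 : 0 < K by rewrite mulr_gt0.
pose rho : R := Num.min (delta / 2) (e / K).
have rho0 : 0 < rho by rewrite lt_min !divr_gt0.
have rd : rho <= delta / 2 by rewrite /rho ge_min lexx.
have re : rho * K <= e by rewrite -ler_pdivlMr// /rho ge_min lexx orbT.
have [y [l [tl xy /(weibull_rateP _ _ alpha0) [[x [u S]] Sy]]]] := close rho0.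
have [x0 u0 uI _] := S.
have [lh [_ [m [lK mK mc]]]] := tl.
have tm := time_change_inv tl lK mK mc; have [mh _] := tm.
have J v : 0 < uval v -> `|jump xi v - jump y (l v)| <= 2 * rho.
  by move=> ?; apply: jump_time_change.
have yb : y (l t) <= \sum_(s <- F | uval s <= uval t) jump y (l s) +
    (2 * delta) `^ (1 - alpha) * a.
  apply: (jump_series_le S) => k.
  apply: (@le_trans _ _ (\sum_(0 <= i < k)
      (x i * (\sum_(s <- F | uval s <= uval t) (u i == l s)%:R) +
       (2 * delta) `^ (1 - alpha) * (x i `^ alpha)))).
    apply: ler_sum => i _.
    have xa : 0 <= (2 * delta) `^ (1 - alpha) * (x i `^ alpha).
      by rewrite mulr_ge0 ?powR_ge0.
    have s0 : 0 <= \sum_(s <- F | uval s <= uval t) (u i == l s)%:R :> R.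
      by rewrite sumr_ge0.
    have [ul|ul] := leP (uval (u i)) (uval (l t)); last first.
      by rewrite mulr0 addr_ge0// mulr_ge0.
    rewrite mulr1; have [mF|mF] := boolP (m (u i) \in F).
      rewrite -[leLHS]addr0 lerD// -[leLHS]mulr1 ler_wpM2l//.
      rewrite big_mkcond (bigD1_seq (m (u i)))//= mK eqxx.
      have -> : uval (m (u i)) <= uval t by rewrite -(lK t); apply: mh.
      by rewrite lerDl sumr_ge0// => s _; case: ifP.
    rewrite -[leLHS]add0r lerD// ?mulr_ge0//.
    have [->|xN] := eqVneq (x i) 0; first by rewrite mulr_ge0 ?powR_ge0.
    have xp : 0 < x i by rewrite lt_neqAle eq_sym xN x0.
    have mu0 := time_change_gt0 tm (u0 i).
    have jm : jump xi (m (u i)) < delta.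
      by rewrite ltNge; apply/negP => /(HF _ mu0); rewrite (negPf mF).
    have := J _ mu0; rewrite mK (jump_series_jumpE _ S) ler_norml => /andP[B _].
    have xd : x i <= 2 * delta by lra.
    rewrite -[in leLHS](powRr1 (x0 i)) -[in leLHS](subrK alpha 1).
    rewrite powRD; last by apply/implyP => _.
    rewrite ler_wpM2r ?powR_ge0//; apply: ge0_ler_powR; rewrite ?nnegrE//.
      by case/andP: alpha01 => _ ?; lra.
    by lra.
  rewrite big_split/= lerD//.
    under eq_bigr do rewrite mulr_sumr.
    rewrite exchange_big/= big_seq_cond [leRHS]big_seq_cond.
    apply: ler_sum => s /andP[sF _].
    by apply: (jump_series_partial_le _ S); apply: time_change_gt0 => //; exact: F0.
  rewrite -mulr_sumr ler_wpM2l ?powR_ge0//.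
  have := Sy (map u (iota 0 k)); rewrite big_map.
  under eq_bigr do rewrite (jump_series_jumpE _ S).
  rewrite /index_iota subn0; apply; first by rewrite map_inj_uniq// iota_uniq.
  by move=> _ /mapP[i _ ->].
have : \sum_(s <- F | uval s <= uval t) jump y (l s) <=
    \sum_(s <- F | uval s <= uval t) jump xi s + 2 * rho * (size F)%:R.
  apply: (@le_trans _ _ (\sum_(s <- F | uval s <= uval t) (jump xi s + 2 * rho))).
    rewrite big_seq_cond [leRHS]big_seq_cond; apply: ler_sum => s /andP[sF _].
    by have := J s (F0 s sF); rewrite ler_norml => /andP[+ _]; lra.
  rewrite big_split/= lerD2l// -sum_const_seq.
  rewrite [leRHS](bigID (fun s => uval s <= uval t))/= lerDl sumr_ge0// => _ _.
  lra.
have := xy t; rewrite ler_norml => /andP[_].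
have {re} : 2 * rho * (size F)%:R + 2 * rho <= e.
  apply: le_trans re; rewrite /K -[(size F).+1%:R]natr1.
  by set N := (size F)%:R; lra.
move: yb.
set A := \sum_(s <- F | uval s <= uval t) jump xi s.
set B := \sum_(s <- F | uval s <= uval t) jump y (l s).
set C := 2 * rho * (size F)%:R; set D := _ `^ _ * _; lra.
Qed.

Lemma limit_pure_jump : pure_jump xi.
Proof.
have Hp (n : nat) : exists t : I, uval t = n.+1%:R^-1.
  by apply: uval_surj; rewrite invr_ge0 ler0n/= invf_le1 ?ler1n.
have /choice [p pE] := Hp.
(* The times [p] make [D] infinite even when [xi] has finitely many jumps; at the added times the
   jump may be 0. *)
pose D := [set t | 0 < uval t /\ 0 < jump xi t] `|` range p.
have pI : injective p.
  move=> i j ij; have := pE i; rewrite ij pE => /invr_inj /eqP.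
  by rewrite eqr_nat => /eqP [].
have D0 t : D t -> 0 < uval t.
  by move=> [[]//|[n _ <-]]; rewrite pE invr_gt0.
have Di : infinite_set D.
  apply: (@sub_infinite_set _ (range p)); first by move=> ? ?; right.
  have := @inj_card_eq _ _ setT p (fun i j _ _ => @pI i j).
  by rewrite card_eq_le => /andP[_]; rewrite infiniteP.
have n0 (n : nat) : (0 : R) < n.+1%:R^-1 by rewrite invr_gt0.
have Dc : countable D.
  have /choice [F HF] := fun n => limit_large_jumps (n0 n).
  apply: (@sub_countable _ _ _ (\bigcup_n ([set` F n] `|` [set p n]))).
    apply: subset_card_le => t [[t0 tj]|[n _ <-]]; last by exists n => //; right.
    have [n nj] : exists n : nat, n.+1%:R^-1 <= jump xi t.
      exists (Num.truncn (jump xi t)^-1).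
      by rewrite invf_ple ?posrE// ltW// truncnS_gt.
    by exists n => //; left; have [_ _] := HF n; apply.
  apply: bigcup_countable => // n _; apply: finite_set_countable.
  by rewrite finite_setU; split; [exact: finite_seq|exact: finite_set1].
have [e [eI eD]] := enum_countable Dc Di.
have e0 i : 0 < uval (e i) by apply: D0; rewrite -eD; exists i.
exists (fun i => jump xi (e i)), e; split => //.
  by move=> i; apply: limit_jump_ge0.
move=> t.
have up k : \sum_(0 <= i < k) jump xi (e i) * (uval (e i) <= uval t)%R%:R <= xi t.
  have -> : \sum_(0 <= i < k) jump xi (e i) * (uval (e i) <= uval t)%R%:R =
      \sum_(v <- [seq v <- map e (iota 0 k) | uval v <= uval t]) jump xi v.
    rewrite big_filter big_map /index_iota subn0 [RHS]big_mkcond/=.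
    by apply: eq_bigr => i _; case: ifP => _; rewrite ?mulr1 ?mulr0.
  apply: limit_sum_jump_le.
  - by rewrite filter_uniq// map_inj_uniq// iota_uniq.
  - by move=> v; rewrite mem_filter => /andP[_ /mapP[i _ ->]].
  - by move=> v; rewrite mem_filter => /andP[].
apply/cvgrPdist_lt => eps eps0.
(* Makes (2 delta)^(1 - alpha) equal to [eps / (2 * (a + 1))], so that the small jumps total less
   than [eps]; the added 1 covers [a = 0]. *)
pose delta := (eps / (2 * (a + 1))) `^ (1 - alpha)^-1 / 2.
have a10 : 0 < 2 * (a + 1) by have := a_ge0; lra.
have a1' : 0 < 1 - alpha by case/andP: alpha01; lra.
have delta0 : 0 < delta by rewrite divr_gt0// powR_gt0// divr_gt0.
have [F [uF F1 F2]] := limit_large_jumps delta0.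
have lo := limit_le_large_jumps t delta0 uF (fun t tF => (F1 t tF).1) F2.
have small : (2 * delta) `^ (1 - alpha) * a < eps.
  rewrite /delta [2 * _]mulrC divfK// -powRrM mulVf ?gt_eqF// powRr1.
    rewrite mulrAC ltr_pdivrMr// ltr_pM2l//.
    by have := a_ge0; lra.
  by rewrite divr_ge0// ltW.
have [N FN] : exists N, {subset F <= map e (iota 0 N)}.
  have FD : {in F, forall v, exists i, e i = v}.
    move=> v /F1 [v0 vj]; have : D v by left; split => //; lra.
    by rewrite -eD => -[i _ <-]; exists i.
  elim: F FD {uF F1 F2 lo} => [|v F IH] FD; first by exists 0%N.
  have [N HN] : exists N, {subset F <= map e (iota 0 N)}.
    by apply: IH => w wF; apply: FD; rewrite inE wF orbT.
  have [i ei] := FD v (mem_head _ _).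
  exists (maxn i.+1 N) => w; rewrite inE => /orP[/eqP ->|/HN /mapP[j]].
    by rewrite -ei map_f// mem_iota/= add0n leq_max ltnSn.
  rewrite mem_iota/= add0n => jN ->.
  by rewrite map_f// mem_iota/= add0n leq_max jN orbT.
exists N => // k /= Nk; rewrite ger0_norm ?subr_ge0//.
have : \sum_(s <- F | uval s <= uval t) jump xi s <=
    \sum_(0 <= i < k) jump xi (e i) * (uval (e i) <= uval t)%R%:R.
  have -> : \sum_(0 <= i < k) jump xi (e i) * (uval (e i) <= uval t)%R%:R =
      \sum_(v <- [seq v <- map e (iota 0 k) | uval v <= uval t]) jump xi v.
    rewrite big_filter big_map /index_iota subn0 [RHS]big_mkcond/=.
    by apply: eq_bigr => i _; case: ifP => _; rewrite ?mulr1 ?mulr0.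
  rewrite -big_filter; apply: ler_sum_subset.
  - exact: filter_uniq.
  - by rewrite filter_uniq// map_inj_uniq// iota_uniq.
  - move=> v; rewrite !mem_filter => /andP[-> /FN /mapP[i]] /=.
    rewrite mem_iota/= add0n => iN ->.
    by rewrite map_f// mem_iota/= add0n (leq_trans iN).
  - by move=> v; rewrite mem_filter => /andP[_ /mapP[i _ ->]]; exact: limit_jump_ge0.
lra.
Qed.

Lemma weibull_rate_closed : (weibull_rate alpha xi <= a%:E)%E.
Proof.
apply/(weibull_rateP _ _ alpha0); split; first exact: limit_pure_jump.
exact: limit_sum_powR.
Qed.

End lsc_closed.

Lemma weibull_rate_lsc (R : realType) (alpha : R) : 0 < alpha < 1 ->
  rate_function (@weibull_rate R alpha).
Proof.
move=> alpha01; split.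
  move=> xi; rewrite /weibull_rate; case: asboolP => // _.
  by apply: esum_ge0 => t _; rewrite lee_fin powR_ge0.
(* Failure of lower semi-continuity at level [a] puts a path of rate at most [a] into every ball
   around [xi]. *)
move=> xi a xia; apply: contrapT => H.
suff : (weibull_rate alpha xi <= a%:E)%E by rewrite leNgt xia.
apply: weibull_rate_closed => // rho rho0.
have [y [xy ya]] : exists y, J1_dist xi y < rho /\ (weibull_rate alpha y <= a%:E)%E.
  apply: contrapT => H'; apply: H; exists (ball xi rho).
    exact: nbhsx_ballx.
  move=> y xy; rewrite ltNge; apply/negP => ya; apply: H'; exists y.
  by split.
have [l tl lr] := J1_dist_lt xy; exists y, l; split => // s.
by have [+ _] := le_J1_cost xi y l s; move=> /le_trans; apply; exact: ltW.
Qed.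

(** * Partial sum paths and time changes *)

Section sum_paths.
Variable R : realType.
Local Notation I := (unit_itv R).
Implicit Types (t : I) (n : nat) (y : nat -> R).

Lemma truncn_uval_le n t : (Num.truncn (n%:R * uval t) <= n)%N.
Proof.
have /andP[t0 t1] := uval_itv t.
rewrite -(ler_nat R); apply: (@le_trans _ _ (n%:R * uval t)).
  by rewrite truncn_le ?mulr_ge0.
by rewrite ler_piMr.
Qed.

Lemma leq_truncn_uval n t i : (0 < n)%N ->
  (i <= Num.truncn (n%:R * uval t))%N = (i%:R / n%:R <= uval t).
Proof.
move=> n0; have /andP[t0 t1] := uval_itv t.
by rewrite truncn_ge_nat ?mulr_ge0// ler_pdivrMr ?ltr0n// mulrC.
Qed.

Lemma sum_pathE n y t : (0 < n)%N -> sum_path n y t =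
  \sum_(1 <= i < n.+1) y i / n%:R * (i%:R / n%:R <= uval t)%R%:R.
Proof.
move=> n0; rewrite /sum_path (big_nat_widen _ _ n.+1)/=; last first.
  by rewrite ltnS truncn_uval_le.
rewrite mulr_sumr big_mkcond/=; apply: eq_bigr => i _.
by rewrite ltnS leq_truncn_uval//; case: ifP => _; rewrite ?mulr1 ?mulr0// mulrC.
Qed.

Lemma sum_path_jump_series n y : (0 < n)%N -> (forall i, 0 <= y i) ->
  exists u : nat -> I,
    jump_series (sum_cadlag n y) (fun i => (y i.+1 / n%:R) * (i < n)%N%:R) u.
Proof.
move=> n0 y0; have np : (0 : R) < n%:R by rewrite ltr0n.
(* Indices from [n] on carry zero jumps; their times lie strictly below [1 / n], off the grid, which
   keeps the times distinct. *)
pose v (i : nat) : R := if (i < n)%N then i.+1%:R / n%:R else (n * i.+2)%:R^-1.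
have /choice [u uE] : forall i, exists t : I, uval t = v i.
  move=> i; apply: uval_surj; rewrite /v; case: ifP => i_n.
    by rewrite divr_ge0//= ler_pdivrMr// mul1r ler_nat.
  by rewrite invr_ge0 ler0n/= invf_le1 ?ltr0n ?ler1n muln_gt0 n0.
exists u; split.
- by move=> i; rewrite mulr_ge0// divr_ge0.
- move=> i; rewrite uE /v; case: ifP => _; first by rewrite divr_gt0 ?ltr0n.
  by rewrite invr_gt0 ltr0n muln_gt0 n0.
- have small i j : (i < n)%N -> ~~ (j < n)%N -> v i != v j.
    move=> i_n /negPf j_n; rewrite /v i_n j_n gt_eqF//.
    rewrite natrM invfM mulrC ltr_pM2r ?invr_gt0//.
    by apply: (@lt_le_trans _ _ 1); rewrite ?invf_lt1 ?ltr0n ?ltr1n ?ler1n.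
  move=> i j /(congr1 (@uval R)); rewrite !uE.
  have [i_n|i_n] := boolP (i < n)%N; have [j_n|j_n] := boolP (j < n)%N.
  + rewrite /v i_n j_n => /(congr1 (fun z => z * n%:R)).
    by rewrite !divfK ?gt_eqF// => /eqP; rewrite eqr_nat => /eqP[].
  + by move=> /eqP; rewrite (negPf (small _ _ i_n j_n)).
  + by move=> /esym/eqP; rewrite (negPf (small _ _ j_n i_n)).
  + rewrite /v (negPf i_n) (negPf j_n) => /invr_inj/eqP.
    by rewrite eqr_nat eqn_pmul2l// => /eqP[].
- move=> t; apply: (@cvg_trans _ (cst (sum_path n y t) @ \oo)); last exact: cvg_cst.
  apply: near_eq_cvg; exists n => // k /= nk; rewrite /cst (sum_pathE _ _ n0).
  rewrite big_add1/= [RHS](big_cat_nat (n := n))//=.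
  rewrite [X in _ = _ + X]big_nat [X in _ = _ + X]big1 ?addr0.
    apply: eq_big_nat => i /andP[_ i_n].
    by rewrite uE /v i_n mulr1.
  by move=> i /andP[ni _]; rewrite ltnNge ni mulr0 mul0r.
Qed.

Lemma weibull_rate_sum_path (alpha : R) n y : 0 < alpha -> (0 < n)%N ->
  (forall i, 0 <= y i) ->
  (weibull_rate alpha (sum_cadlag n y) <=
     (\sum_(1 <= i < n.+1) (y i / n%:R) `^ alpha)%:E)%E.
Proof.
move=> alpha0 n0 y0; have [u S] := sum_path_jump_series n0 y0.
have [_ u0 uI _] := S.
apply/(weibull_rateP _ _ alpha0); split; first by do 2 eexists; exact: S.
move=> s us s0; rewrite big_add1/=.
apply: (@le_trans _ _ (\sum_(t <- s)
    \sum_(0 <= i < n) (y i.+1 / n%:R) `^ alpha * (u i == t)%:R)).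
  rewrite !big_seq; apply: ler_sum => t /s0 t0.
  have F0 i : 0 <= (y i.+1 / n%:R) `^ alpha * (u i == t)%:R :> R.
    by rewrite mulr_ge0// powR_ge0.
  have [[i uit]|H] := pselect (exists i, u i = t); last first.
    rewrite (jump_series_jump0 S t0); last first.
      by move=> i; apply/eqP => ?; apply: H; exists i.
    by rewrite powR0 ?gt_eqF// sumr_ge0.
  rewrite -uit (jump_series_jumpE _ S).
  have [i_n|i_n] := ltnP i n; last by rewrite mulr0 powR0 ?gt_eqF// uit sumr_ge0.
  rewrite (bigD1_seq i)/= ?mem_index_iota ?iota_uniq// eqxx !mulr1 lerDl.
  by rewrite uit sumr_ge0.
rewrite exchange_big/= ; apply: ler_sum => i _.
by rewrite -mulr_sumr sum_pred1_uniq// ler_piMr ?powR_ge0// lern1 leq_b1.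
Qed.

(** Both paths jump on the same grid, so the identity is a good enough time change. *)
Lemma J1_dist_sum_cadlag n y z (e : R) : 0 <= e ->
  (forall j, (j <= n)%N -> `|\sum_(1 <= i < j.+1) (y i - z i)| <= e * n%:R) ->
  J1_dist (sum_cadlag n y) (sum_cadlag n z) <= e.
Proof.
move=> e0 H; apply: (le_trans (J1_dist_le _ _ (@time_change_id R))).
apply: J1_cost_le => t /=; last by rewrite subrr normr0.
rewrite /sum_path -mulrBr -sumrB normrM ger0_norm ?invr_ge0//.
have [->|n0] := posnP n; first by rewrite invr0 mul0r.
by rewrite ler_pdivrMl ?ltr0n// [leRHS]mulrC H// truncn_uval_le.
Qed.

End sum_paths.

(** * Time changes built from tents *)

Section tents.
Variable R : realType.
Local Notation I := (unit_itv R).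

Lemma pos_lower_bound (s : seq R) : {in s, forall x, 0 < x} ->
  exists2 r, 0 < r & {in s, forall x, r <= x}.
Proof.
elim: s => [|x s IH] s0; first by exists 1.
have [|r r0 H] := IH; first by move=> z zs; apply: s0; rewrite inE zs orbT.
exists (Num.min x r); first by rewrite lt_min s0 ?mem_head.
move=> z; rewrite inE => /orP[/eqP ->|/H rz]; first by rewrite ge_min lexx.
by rewrite ge_min rz orbT.
Qed.

Lemma tent_lip (r u x z : R) : 0 < r ->
  `|Num.max 0 (1 - `|x - u| / r) - Num.max 0 (1 - `|z - u| / r)| <= `|x - z| / r.
Proof.
move=> r0; set A := `|x - u| / r; set B := `|z - u| / r; set C := _ / r.
have H1 : A - B <= C.
  rewrite -mulrBl ler_pM2r ?invr_gt0//.
  by have := ler_distD z x u; lra.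
have H2 : B - A <= C.
  rewrite -mulrBl ler_pM2r ?invr_gt0//.
  by have := ler_distD x z u; rewrite (distrC z x); lra.
by rewrite ler_norml /Num.max; do 2 case: ltP => ?; apply/andP; split; lra.
Qed.

(** The upper slope bound gives continuity and, through the intermediate value theorem,
    surjectivity; the lower one gives injectivity and a Lipschitz inverse. *)
Lemma bilipschitz_time_change (g : R -> R) : g 0 = 0 -> g 1 = 1 ->
  (forall x z, x <= z -> (z - x) / 2 <= g z - g x <= 2 * (z - x)) ->
  exists l : I -> I, time_change l /\ forall t, uval (l t) = g (uval t).
Proof.
move=> g0 g1 H.
have gm x z : x <= z -> g x <= g z.
  by move=> xz; have /andP[+ _] := H _ _ xz; lra.
have Hn x z : `|g x - g z| <= 2 * `|x - z| /\ `|x - z| <= 2 * `|g x - g z|.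
  wlog xz : x z / x <= z.
    move=> W; have [|/ltW] := leP x z; first exact: W.
    by move=> /W; rewrite (distrC (g x)) (distrC x).
  have /andP[H1 H2] := H _ _ xz.
  by rewrite !(distrC _ z) (distrC _ (g z)) !ger0_norm ?subr_ge0 ?gm//; split; lra.
have /choice [l lE] : forall t : I, exists s : I, uval s = g (uval t).
  move=> t; apply: uval_surj; have /andP[t0 t1] := uval_itv t.
  by have := gm _ _ t0; have := gm _ _ t1; rewrite g0 g1 => -> ->.
have gc : continuous g.
  move=> x; apply/cvgrPdist_lt => e e0; near=> z.
  apply: (le_lt_trans (Hn x z).1); rewrite -ltr_pdivlMl//.
  near: z; apply: cvgr_dist_lt; last by rewrite mulr_gt0// invr_gt0.
  exact: cvg_id.
have /choice [m mE] : forall t : I, exists s : I, l s = t.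
  move=> t; have t01 := uval_itv t.
  have [|x] := @IVT R g 0 1 (uval t) ler01 (continuous_subspaceT gc).
    by rewrite g0 g1 minEle maxEle ler01.
  rewrite in_itv/= => /uval_surj [s <-] gs.
  by exists s; apply: uval_inj; rewrite lE.
have lI : injective l.
  move=> s t st; apply: uval_inj; apply/eqP; rewrite -subr_eq0 -normr_le0.
  by apply: (le_trans (Hn _ _).2); rewrite -!lE st subrr normr0 mulr0.
exists l; split => //; split.
  by move=> s t st; rewrite !lE gm.
split.
  move=> t U /near_uvalP [e e0 eU]; apply/near_uvalP.
  exists (e / 2); first by rewrite divr_gt0.
  move=> s ts; apply: eU; rewrite !lE; apply: (le_lt_trans (Hn _ _).1).
  by rewrite mulrC -ltr_pdivlMr.
exists m; split => //; first by move=> t; apply: lI; rewrite mE.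
move=> t U /near_uvalP [e e0 eU]; apply/near_uvalP.
exists (e / 2); first by rewrite divr_gt0.
move=> s ts; apply: eU; apply: (le_lt_trans (Hn _ _).2).
by rewrite -!lE !mE mulrC -ltr_pdivlMr.
Unshelve. all: by end_near.
Qed.

(* Adding to the identity a tent of height [v i - u i] around each [u i] moves
   [u i] to [v i]; the slopes stay positive when the heights are small. *)
Lemma tent_time_change (m : nat) (u v : nat -> I) (r : R) : 0 < r ->
  (forall i, (i < m)%N -> r <= uval (u i)) ->
  (forall i, (i < m)%N -> uval (u i) = 1 -> uval (v i) = 1) ->
  (forall i, (i < m)%N -> uval (u i) != 1 -> r <= 1 - uval (u i)) ->
  (forall i j, (i < m)%N -> (j < m)%N -> i != j ->
     r <= `|uval (u i) - uval (u j)|) ->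
  \sum_(0 <= i < m) `|uval (v i) - uval (u i)| <= r / 2 ->
  exists l : I -> I, [/\ time_change l, forall i, (i < m)%N -> l (u i) = v i &
    forall t, `|uval (l t) - uval t| <=
      \sum_(0 <= i < m) `|uval (v i) - uval (u i)|].
Proof.
move=> r0 ru uv1 r1 ruu; set V := \sum_(0 <= i < m) _ => Vr.
pose T (i : nat) (x : R) : R := Num.max 0 (1 - `|x - uval (u i)| / r).
pose g (x : R) : R := x + \sum_(0 <= i < m) (uval (v i) - uval (u i)) * T i x.
have T0 i x : r <= `|x - uval (u i)| -> T i x = 0.
  move=> rx; rewrite /T max_l// subr_le0 ler_pdivlMr// mul1r//.
have Tu i : T i (uval (u i)) = 1 by rewrite /T subrr normr0 mul0r subr0 max_r.
have T01 i x : 0 <= T i x <= 1.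
  rewrite /T le_max lexx/= ge_max ler01/= lerBlDr lerDl divr_ge0// ltW//.
have g0 : g 0 = 0.
  rewrite /g add0r big_nat big1// => i /andP[_ im]; rewrite T0 ?mulr0//.
  by rewrite sub0r normrN ger0_norm ?ru// (le_trans (ltW r0))// ru.
have g1 : g 1 = 1.
  rewrite /g big_nat big1 ?addr0// => i /andP[_ im].
  have [u1|u1] := eqVneq (uval (u i)) 1; first by rewrite u1 uv1// subrr mul0r.
  by rewrite T0 ?mulr0// (le_trans (r1 _ im u1))// ler_norm.
have gl x z : x <= z -> (z - x) / 2 <= g z - g x <= 2 * (z - x).
  (* Each tent has slope at most [1 / r], so the correction has slope at most [V / r <= 1 / 2], and
     [g] has slopes between 1/2 and 3/2. *)
  move=> xz; suff : `|\sum_(0 <= i < m) (uval (v i) - uval (u i)) * (T i z - T i x)|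
      <= (z - x) / 2.
    have -> : g z - g x = (z - x) +
        \sum_(0 <= i < m) (uval (v i) - uval (u i)) * (T i z - T i x).
      rewrite /g; under [in RHS]eq_bigr do rewrite mulrBr.
      by rewrite sumrB; lra.
    by rewrite ler_norml => /andP[? ?]; apply/andP; split; lra.
  apply: (le_trans (ler_norm_sum _ _ _)).
  apply: (@le_trans _ _ (V * ((z - x) / r))).
    rewrite mulr_suml; apply: ler_sum => i _; rewrite normrM ler_wpM2l//.
    by have := tent_lip (uval (u i)) z x r0; rewrite [`|z - x|]ger0_norm ?subr_ge0.
  have -> : (z - x) / 2 = r / 2 * ((z - x) / r).
    by rewrite mulrAC mulrA (mulrC _ r^-1) mulrA mulVf ?gt_eqF// mul1r.
  by rewrite ler_wpM2r// divr_ge0 ?subr_ge0// ltW.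
have [l [tl lE]] := bilipschitz_time_change g0 g1 gl.
exists l; split => //.
  move=> i im; apply: uval_inj; rewrite lE /g (bigD1_seq i)/= ?mem_index_iota ?iota_uniq//.
  rewrite Tu mulr1 big_seq_cond big1.
    by rewrite addr0 addrC subrK.
  move=> j /andP[].
  rewrite mem_index_iota/= => jm ji.
  by rewrite T0 ?mulr0// ruu// eq_sym.
move=> t; rewrite lE /g addrC addrA addNr add0r.
apply: (le_trans (ler_norm_sum _ _ _)); apply: ler_sum => i _.
have /andP[a b] := T01 i (uval t).
by rewrite normrM ler_piMr// ger0_norm.
Qed.

End tents.

(** * Approximation of a pure jump path by partial sum paths *)

Section approximation.
Variable R : realType.
Local Notation I := (unit_itv R).
Implicit Types (xi : cadlag R) (x y : nat -> R) (u : nat -> I).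

(** Tents of this radius around the [u i] vanish at 0, at the other centres, and at 1 unless centred
    there. *)
Lemma separation_radius u (m : nat) : (forall i, 0 < uval (u i)) -> injective u ->
  exists r, [/\ 0 < r, forall i, (i < m)%N -> r <= uval (u i),
    forall i, (i < m)%N -> uval (u i) != 1 -> r <= 1 - uval (u i) &
    forall i j, (i < m)%N -> (j < m)%N -> i != j ->
      r <= `|uval (u i) - uval (u j)|].
Proof.
move=> u0 uI.
(* The entries 1 replace the excluded cases [u i = 1] and [i = j], so that every entry is
   positive. *)
pose s := [seq uval (u i) | i <- iota 0 m] ++
  [seq (if uval (u i) == 1 then 1 else 1 - uval (u i)) | i <- iota 0 m] ++
  [seq (if i == j then 1 else `|uval (u i) - uval (u j)|)
     | i <- iota 0 m, j <- iota 0 m].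
have [|r r0 rs] := @pos_lower_bound R s.
  move=> z; rewrite !mem_cat => /or3P[/mapP[i _ ->]//|/mapP[i _ ->]|].
    case: eqP => // /eqP u1; have /andP[_] := uval_itv (u i).
    by rewrite le_eqVlt (negPf u1)/= subr_gt0.
  move=> /allpairsP[[i j] [_ _ ->]] /=; case: eqP => // /eqP ij.
  rewrite normr_gt0 subr_eq0; apply: contra_neq ij => /uval_inj; exact: uI.
exists r; split => // [i im|i im u1|i j im jm ij]; apply: rs; rewrite !mem_cat.
- by apply/or3P/Or31; apply: map_f; rewrite mem_iota.
- apply/or3P/Or32; apply/mapP; exists i; first by rewrite mem_iota.
  by rewrite (negPf u1).
- apply/or3P/Or33; apply/allpairsP; exists (i, j); rewrite !mem_iota/=.
  by split => //; rewrite (negPf ij).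
Qed.

(** Rounding up, rather than down, avoids the index 0 and leaves the time 1 in place. *)
Lemma grid_point (n : nat) (t : I) : (0 < n)%N -> 0 < uval t ->
  exists k : nat, (0 < k <= n)%N /\
    0 <= k%:R / n%:R - uval t <= n%:R^-1.
Proof.
move=> n0 t0; have np : (0 : R) < n%:R by rewrite ltr0n.
have /andP[_ t1] := uval_itv t.
have nt : 0 < n%:R * uval t by rewrite mulr_gt0.
have ex : exists k : nat, n%:R * uval t <= k%:R by exists n; rewrite ler_piMr.
have [k kP kmin] := ex_minnP ex.
have kn : (k <= n)%N by apply: kmin; rewrite ler_piMr.
have k0 : (0 < k)%N by rewrite -(ltr0n R); exact: lt_le_trans kP.
exists k; rewrite k0 kn; split => //; rewrite subr_ge0 ler_pdivlMr// mulrC kP/=.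
case: k k0 {kn} kP kmin => // k _ _ kmin.
have kt : k%:R < n%:R * uval t by rewrite ltNge; apply/negP => /kmin; rewrite ltnn.
rewrite lerBlDr ler_pdivrMr// mulrDl mulVf ?gt_eqF// -natr1.
by rewrite [uval t * _]mulrC; lra.
Qed.

(** The tail at [t] is dominated by the tail at time 1, where every indicator is 1; hence one [m]
    serves all [t]. *)
Lemma jump_series_tail xi x u (e : R) : jump_series xi x u -> 0 < e ->
  exists m, forall t,
    0 <= xi t - \sum_(0 <= i < m) x i * (uval (u i) <= uval t)%R%:R <= e.
Proof.
move=> S e0; have [x0 _ _ _] := S.
have [|o oE] := @uval_surj R 1; first by rewrite lexx ler01.
have [m /(_ m (leqnn m)) Hm] := jump_series_approx o S e0.
exists m => t; rewrite subr_ge0 (jump_series_ge _ _ S)/= lerBlDl.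
apply: (jump_series_le S) => k.
have all1 j : \sum_(0 <= i < j) x i * (uval (u i) <= uval o)%R%:R =
    \sum_(0 <= i < j) x i.
  apply: eq_bigr => i _; rewrite oE; have /andP[_ ->] := uval_itv (u i).
  by rewrite mulr1.
have := jump_series_ge o (maxn m k) S; rewrite all1 in Hm.
rewrite all1 (big_cat_nat (n := m))//= ?leq_maxl// => H.
apply: (@le_trans _ _
    (\sum_(0 <= i < maxn m k) x i * (uval (u i) <= uval t)%R%:R)).
  rewrite [leRHS](big_cat_nat (n := k))//= ?leq_maxr// lerDl sumr_ge0// => i _.
  by rewrite mulr_ge0.
rewrite (big_cat_nat (n := m))//= ?leq_maxl// lerD2l.
apply: (@le_trans _ _ (\sum_(m <= i < maxn m k) x i)); last by lra.
by apply: ler_sum => i _; rewrite ler_piMr// lern1 leq_b1.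
Qed.

(** The deterministic half of the lower bound. Three errors of [rho / 4] add up: the discarded tail
    of the series, the heights of the [m] jumps that are kept, and the partial sums off the chosen
    indices. *)
Lemma jump_series_J1_dist_lt xi x u (rho : R) : jump_series xi x u -> 0 < rho ->
  exists m eta N, 0 < eta /\ forall n, (N <= n)%N -> exists k : nat -> nat,
    [/\ forall i, (i < m)%N -> (0 < k i <= n)%N,
        {in iota 0 m &, injective k} &
        forall y, (forall i, (i < m)%N -> `|y (k i) / n%:R - x i| <= eta) ->
          (forall j, (j <= n)%N ->
             `|\sum_(1 <= i < j.+1 | i \notin map k (iota 0 m)) y i|
               <= rho / 4 * n%:R) ->
          J1_dist xi (sum_cadlag n y) < rho].
Proof.
move=> S rho0; have [x0 u0 uI _] := S.
have rho4 : 0 < rho / 4 by rewrite divr_gt0.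
have [m Hm] := jump_series_tail S rho4.
have [r [r0 ru r1 ruu]] := separation_radius m u0 uI.
pose eta := rho / 4 / m.+1%:R; have eta0 : 0 < eta by rewrite divr_gt0.
have etam : eta * m%:R <= rho / 4.
  by rewrite /eta mulrAC ler_pdivrMr// ler_wpM2l// ?ler_nat// ltW.
(* [r / 2] makes the tents admissible and [rho / 4] bounds the displacement of time; the [m]
   roundings, each at most [1 / n], stay below [c] for large [n]. *)
pose c := Num.min (r / 2) (rho / 4).
have c0 : 0 < c by rewrite lt_min rho4 divr_gt0.
exists m, eta, (Num.truncn (m%:R / c)).+1; split => // n Nn.
have n0 : (0 < n)%N by exact: leq_trans Nn.
have np : (0 : R) < n%:R by rewrite ltr0n.
have mn : m%:R / n%:R <= c.
  rewrite ler_pdivrMr// mulrC -ler_pdivrMr//.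
  apply: (le_trans (ltW (truncnS_gt _))); rewrite ler_nat//.
have /choice [k kP] := fun i => grid_point n0 (u0 i).
have /choice [v vE] : forall i, exists t : I, uval t = (k i)%:R / n%:R.
  move=> i; apply: uval_surj; have [/andP[_ kn] _] := kP i.
  by rewrite divr_ge0//= ler_pdivrMr// mul1r ler_nat.
have V : \sum_(0 <= i < m) `|uval (v i) - uval (u i)| <= c.
  apply: le_trans mn; rewrite -[m in X in _ <= X]subn0 mulrC.
  rewrite mulr_natr -sumr_const_nat; apply: ler_sum => i _.
  by rewrite vE; have [_ /andP[? ?]] := kP i; rewrite ger0_norm.
have Vr : \sum_(0 <= i < m) `|uval (v i) - uval (u i)| <= r / 2.
  by apply: le_trans V _; rewrite /c ge_min lexx.
have uv1 i : (i < m)%N -> uval (u i) = 1 -> uval (v i) = 1.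
  move=> _ u1; have [_ /andP[+ _]] := kP i; rewrite -vE u1 subr_ge0 => v1.
  by apply/eqP; rewrite eq_le v1; have /andP[_ ->] := uval_itv (v i).
have [l [tl luv lt]] := tent_time_change r0 ru uv1 r1 ruu Vr.
have [lh [_ [l' [lK _ _]]]] := tl.
have kI : {in iota 0 m &, injective k}.
  move=> i j; rewrite !mem_iota/= !add0n => im jm kij.
  apply: uI; apply: (can_inj lK); rewrite !luv//.
  by apply: uval_inj; rewrite !vE kij.
exists k; split => //; first by move=> i _; have [] := kP i.
move=> y yk yN; apply: (le_lt_trans (J1_dist_le _ _ tl)).
apply: (@le_lt_trans _ _ (3 * (rho / 4))); last by lra.
apply: J1_cost_le => t; last first.
  by apply: (le_trans (lt t)); apply: (le_trans V); rewrite /c ge_min; apply/orP; right; lra.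
(* As [l] is increasing and sends [u i] exactly to its grid point, the indicators of the two paths
   agree: no error arises near a jump. *)
have vl i : (i < m)%N -> (uval (v i) <= uval (l t)) = (uval (u i) <= uval t).
  move=> im; apply/idP/idP; last by rewrite -luv//; exact: lh.
  by apply: contraTT; rewrite -!ltNge -luv//; exact: time_change_lt.
rewrite /= (sum_pathE _ _ n0) (bigID (mem (map k (iota 0 m))))/=.
set A := \sum_(1 <= i < n.+1 | i \in _) _; set B := \sum_(1 <= i < n.+1 | _) _.
have AE : A = \sum_(0 <= i < m) y (k i) / n%:R * (uval (u i) <= uval t)%R%:R.
  rewrite /A -big_filter (perm_big (map k (iota 0 m)))/=.
    rewrite big_map /index_iota subn0 !big_seq; apply: eq_bigr => i.
    by rewrite mem_iota/= add0n => im; rewrite -vE vl.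
  apply: uniq_perm; first by rewrite filter_uniq// iota_uniq.
    by rewrite map_inj_in_uniq ?iota_uniq.
  move=> j; rewrite mem_filter mem_index_iota ltnS.
  apply/idP/idP => [/andP[]//|jk]; rewrite jk/=.
  by have /mapP[i _ ->] := jk; have [] := kP i.
have BE : `|B| <= rho / 4.
  have := yN _ (truncn_uval_le n (l t)).
  rewrite (big_nat_widen _ _ n.+1)/= ?ltnS ?truncn_uval_le//.
  move=> H; rewrite -(ler_pM2r np); apply: le_trans H.
  rewrite -[X in _ * X](ger0_norm (ltW np)) -normrM mulr_suml le_eqVlt.
  apply/orP; left; apply/eqP; congr `|_|.
  rewrite [RHS]big_mkcond [LHS]big_mkcond/=; apply: eq_bigr => i _.
  rewrite ltnS leq_truncn_uval//; case: (i \notin _) => //=.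
  by case: ifP => _; rewrite ?mulr1 ?mulr0 ?mul0r// divfK// gt_eqF.
have /andP[H1 H2] := Hm t.
have AB : `|A - \sum_(0 <= i < m) x i * (uval (u i) <= uval t)%R%:R| <= rho / 4.
  rewrite AE -sumrB; apply: (le_trans (ler_norm_sum _ _ _)).
  apply: le_trans etam; rewrite mulr_natr -[m in X in _ <= X]subn0 -sumr_const_nat.
  rewrite !big_nat; apply: ler_sum => i /andP[_ im].
  rewrite -mulrBl normrM; apply: le_trans (yk i im).
  by rewrite ler_piMr// normr_nat lern1 leq_b1.
move: H1 H2 AB BE; set C := \sum_(0 <= i < m) _.
by rewrite !ler_norml => ? ? /andP[? ?] /andP[? ?]; apply/andP; split; lra.
Qed.

End approximation.

(** * Regularly varying exponents *)

Lemma bernoulli_exists (R : realType) (r M : R) : 1 < r -> exists k : nat, M <= r ^+ k.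
Proof.
move=> r1; have H k : 1 + k%:R * (r - 1) <= r ^+ k.
  elim: k => [|k IH]; first by rewrite mul0r addr0 expr0.
  rewrite exprS; apply: (@le_trans _ _ (r * (1 + k%:R * (r - 1)))); last first.
    by rewrite ler_pM2l// (lt_trans ltr01).
  have := mulr_ge0 (ler0n R k) (sqr_ge0 (r - 1)).
  by rewrite -[k.+1%:R]natr1 expr2; lra.
exists (Num.truncn (M / (r - 1))).+1; apply: le_trans (H _).
have r10 : 0 < r - 1 by rewrite subr_gt0.
have := truncnS_gt (M / (r - 1)); rewrite ltr_pdivrMr//.
set K := _%:R * _; lra.
Qed.

Lemma near_pinfty_nat (R : realType) (Q : R -> Prop) (c : R) : 0 < c ->
  (\forall x \near +oo, Q x) -> \forall n \near \oo, Q (c * n%:R).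
Proof.
move=> c0 [A [_ HA]]; near=> n; apply: HA; rewrite mulrC -ltr_pdivrMr//.
by near: n; exact: nbhs_infty_gtr.
Unshelve. all: by end_near.
Qed.

(** Abstracts q(x) = L(x) x^alpha, minus the logarithm of the tail. [exponent_regular] is regular
    variation of index [alpha]; [exponent_concave] is the trace of concavity provided by the
    hypothesis on [L]. *)
Record weibull_exponent (R : realType) (alpha : R) (q : R -> R) : Prop :=
  WeibullExponent {
    exponent_itv : 0 < alpha < 1 ;
    exponent_nd : forall x y : R, 0 < x -> x <= y -> q x <= q y ;
    exponent_ge0 : forall x : R, 0 < x -> 0 <= q x ;
    exponent_pinfty : forall M : R, \forall x \near +oo, M <= q x ;
    exponent_regular : forall c : R, 0 < c ->
      q (c * x) / q x @[x --> +oo] --> c `^ alpha ;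
    exponent_concave : exists x0 : R, forall x y : R, x0 <= x -> x <= y ->
      q y / y <= q x / x }.

Section exponent.
Variables (R : realType) (alpha : R) (q : R -> R).
Hypothesis qH : weibull_exponent alpha q.

Let alpha01 := exponent_itv qH.
Let q_nd := exponent_nd qH.
Let q_ge0 := exponent_ge0 qH.
Let q_pinfty := exponent_pinfty qH.
Let q_regular := exponent_regular qH.
Let q_concave := exponent_concave qH.

Let alpha0 : 0 < alpha. Proof. by case/andP: alpha01. Qed.

Lemma near_ratio (c eta : R) : 0 < c -> 0 < eta -> \forall x \near +oo,
  (c `^ alpha - eta) * q x <= q (c * x) <= (c `^ alpha + eta) * q x.
Proof.
move=> c0 e0; near=> x.
have qx : 0 < q x.
  by apply: (@lt_le_trans _ _ 1) => //; near: x; exact: q_pinfty.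
have : `|c `^ alpha - q (c * x) / q x| < eta.
  by near: x; have /cvgrPdist_lt := q_regular c0; apply.
rewrite ltr_norml => /andP[H1 H2]; apply/andP; split.
  by rewrite -ler_pdivlMr//; lra.
by rewrite -ler_pdivrMr//; lra.
Unshelve. all: by end_near.
Qed.

Lemma near_ratio_nat (c eta : R) : 0 < c -> 0 < eta -> \forall n \near \oo,
  (c `^ alpha - eta) * q n%:R <= q (c * n%:R) <= (c `^ alpha + eta) * q n%:R.
Proof.
move=> c0 e0; have := near_pinfty_nat ltr01 (near_ratio c0 e0).
by apply: filterS => n; rewrite mul1r.
Qed.

Lemma near_pinfty_q (M : R) : \forall n \near \oo, M <= q n%:R.
Proof.
by have := near_pinfty_nat ltr01 (q_pinfty M); apply: filterS => n; rewrite mul1r.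
Qed.

Lemma near_pinftyP (Q : R -> Prop) : (\forall x \near +oo, Q x) ->
  exists2 x0 : R, 1 <= x0 & forall x, x0 <= x -> Q x.
Proof.
move=> [A [_ HA]]; exists (Num.max 1 (A + 1)); first by rewrite le_max lexx.
by move=> x; rewrite ge_max => /andP[_ Ax]; apply: HA; lra.
Qed.

(* [q (2 x) >= q x + M ln 2] for large [x], as [q] is regularly varying and
   unbounded. *)
Lemma near_ln_le (M : R) : \forall x \near +oo, M * ln x <= q x.
Proof.
wlog M0 : M / 0 < M.
  move=> W; have [/W//|M0] := ltP 0 M.
  near=> x; apply: (@le_trans _ _ 0); last by apply: q_ge0; near: x; apply: nbhs_pinfty_gt; rewrite num_real.
  by rewrite mulr_le0_ge0// ln_ge0//; near: x; apply: nbhs_pinfty_ge; rewrite num_real.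
(* The surplus 1 absorbs the constant [N * ln (2 * x1)] once [ln x] exceeds it. *)
pose N := M + 1.
pose b : R := 2 `^ alpha; have b1 : 1 < b.
  by rewrite -[1](powRr0 2) /b /powR gt_eqF// ltr_expR ltr_pM2r ?ln_gt0// ltr1n.
have eta0 : 0 < (b - 1) / 2 by lra.
have l2 : 0 < ln 2 :> R by rewrite ln_gt0// ltr1n.
have [x1 x11 H] : exists2 x1 : R, 1 <= x1 & forall x, x1 <= x -> q x + N * ln 2 <= q (2 * x).
  apply: near_pinftyP; near=> x.
  have : (b - (b - 1) / 2) * q x <= q (2 * x) <= (b + (b - 1) / 2) * q x.
    by near: x; exact: near_ratio.
  have : N * ln 2 / ((b - 1) / 2) <= q x by near: x; exact: q_pinfty.
  rewrite ler_pdivrMr// => H1 /andP[H2 _].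
  apply: le_trans H2; set A := N * _ in H1 *; lra.
have key k x : x1 <= x -> x <= 2 ^+ k * (2 * x1) -> N * ln (x / (2 * x1)) <= q x.
  have x20 : 0 < 2 * x1 by lra.
  elim: k x => [|k IH] x x1x.
    rewrite mul1r => xx; apply: (@le_trans _ _ 0); last by apply: q_ge0; lra.
    rewrite mulr_ge0_le0//; first by rewrite /N; lra.
    by rewrite ln_le0// ler_pdivrMr// mul1r.
  move=> xk; have [xx|xx] := leP x (2 * x1).
    by apply: IH => //; apply: (le_trans xx); rewrite ler_peMl ?(ltW x20)// exprn_ege1// ler1n.
  have /IH H1 : x1 <= x / 2 by lra.
  have /H H2 : x1 <= x / 2 by lra.
  have {}H1 : N * ln (x / 2 / (2 * x1)) <= q (x / 2).
    by apply: H1; rewrite ler_pdivrMr// mulrAC -exprSr.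
  have xE : 2 * (x / 2) = x by rewrite mulrC divfK.
  rewrite xE in H2; apply: le_trans H2; apply: le_trans (lerD H1 (lexx _)).
  have x0 : 0 < x by lra.
  by rewrite -mulrDr -lnM ?posrE ?divr_gt0// mulrAC divfK.
near=> x; have xx1 : x1 <= x by near: x; apply: nbhs_pinfty_ge; rewrite num_real.
have [k xk] := @bernoulli_exists R 2 (x / (2 * x1)) (ltr1n R 2).
have x20 : 0 < 2 * x1 by lra.
have x0 : 0 < x by lra.
have := key k x xx1; rewrite -ler_pdivrMr// => /(_ xk).
rewrite lnM ?posrE ?invr_gt0// lnV ?posrE//.
have : expR (N * ln (2 * x1)) <= x.
  by near: x; apply: nbhs_pinfty_ge; rewrite num_real.
rewrite -ler_ln ?posrE ?expR_gt0// expRK.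
move: (ln (2 * x1)) (ln x) => A B; rewrite /N; lra.
Unshelve. all: by end_near.
Qed.

(** As [alpha < 1], each doubling multiplies [q x / x] by about 2^(alpha - 1), so it is small at
    some point [2 ^+ k * x2]; monotonicity of [q x / x] keeps it small from there on. *)
Lemma near_q_small (eta : R) : 0 < eta -> \forall x \near +oo, q x <= eta * x.
Proof.
move=> eta0; pose b : R := 2 `^ alpha.
have b0 : 0 < b by rewrite powR_gt0.
have b2 : b < 2.
  rewrite -[X in _ < X](powRr1 (ltW (ltr0Sn R 1))) /b /powR gt_eqF// ltr_expR.
  by rewrite ltr_pM2r ?ln_gt0 ?ltr1n//; case/andP: alpha01.
have e0 : 0 < (2 - b) / 2 by lra.
have [x1 x11 H] := near_pinftyP (near_ratio (ltr0Sn R 1) e0).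
have [x0 Hx0] := q_concave; pose x2 := Num.max x1 x0.
have x21 : x1 <= x2 by rewrite /x2 le_max lexx.
have x20 : x0 <= x2 by rewrite /x2 le_max lexx orbT.
have x2p : 0 < x2 by lra.
pose r := 2 / (b + (2 - b) / 2); have rd : 0 < b + (2 - b) / 2 by lra.
have r1 : 1 < r by rewrite /r ltr_pdivlMr// mul1r; lra.
have rp : 0 < r by lra.
have dec k : r ^+ k * (q (2 ^+ k * x2) / (2 ^+ k * x2)) <= q x2 / x2.
  elim: k => [|k IH]; first by rewrite !mul1r.
  apply: le_trans IH; rewrite exprSr -mulrA ler_pM2l ?exprn_gt0//.
  have y0 : x1 <= 2 ^+ k * x2.
    by apply: (le_trans x21); rewrite ler_peMl ?(ltW x2p)// exprn_ege1// ler1n.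
  have := H _ y0; rewrite exprS -mulrA.
  set y := 2 ^+ k * x2 in y0 *; have yp : 0 < y by lra.
  rewrite -/b => /andP[_ Hy].
  have -> : r * (q (2 * y) / (2 * y)) = q (2 * y) / (b + (2 - b) / 2) / y.
    by rewrite /r mulf_div [_ * (2 * y)]mulrCA -mulf_div divff// mul1r -mulrA -invfM.
  by rewrite ler_wpM2r ?invr_ge0 ?(ltW yp)// ler_pdivrMr// [leRHS]mulrC.
have [k Hk] := bernoulli_exists (q x2 / x2 / eta) r1.
near=> x; have xk : 2 ^+ k * x2 <= x by near: x; apply: nbhs_pinfty_ge; rewrite num_real.
have k0 : x0 <= 2 ^+ k * x2.
  by apply: (le_trans x20); rewrite ler_peMl ?(ltW x2p)// exprn_ege1// ler1n.
have kp : 0 < 2 ^+ k * x2 by rewrite mulr_gt0// exprn_gt0.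
have xp : 0 < x by exact: lt_le_trans xk.
rewrite -ler_pdivrMr//; apply: (le_trans (Hx0 _ _ k0 xk)).
rewrite ler_pdivrMr// in Hk.
have rk : 0 < r ^+ k by rewrite exprn_gt0.
by rewrite -(ler_pM2l rk); apply: le_trans Hk.
Unshelve. all: by end_near.
Qed.

(** Monotonicity of [q] makes regular variation uniform: the ratio is known at the finitely many
    points [delta * r ^+ k] of a geometric grid, and between two neighbours only the factor r^alpha
    is lost. *)
Lemma near_q_lower (delta m eta : R) : 0 < delta -> 0 < eta < 1 ->
  \forall n \near \oo, forall z, delta * n%:R <= z <= m * n%:R ->
    (1 - eta) * (z / n%:R) `^ alpha * q n%:R <= q z.
Proof.
move=> delta0 /andP[eta0 eta1].
have e1 : 0 < 1 - eta by lra.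
(* Crossing one cell of the grid loses the factor [ra], which takes the precision [1 - eta / 2] at
   its left end to [1 - eta]. *)
pose ra := (1 - eta / 2) / (1 - eta); pose r := ra `^ alpha^-1.
have ra1 : 1 < ra by rewrite /ra ltr_pdivlMr// mul1r; lra.
have ra0 : 0 < ra by lra.
have rE : r `^ alpha = ra by rewrite /r -powRrM mulVf ?gt_eqF// powRr1// ltW.
have r1 : 1 < r.
  by rewrite -[1](powRr0 ra) /r /powR gt_eqF// ltr_expR ltr_pM2r ?ln_gt0// invr_gt0.
have rp : 0 < r by lra.
suff H k : \forall n \near \oo, forall z, delta * n%:R <= z <= delta * r ^+ k * n%:R ->
    (1 - eta) * (z / n%:R) `^ alpha * q n%:R <= q z.
  have [k Hk] := bernoulli_exists (m / delta) r1.
  have := H k; apply: filterS => n Hn z /andP[z1 z2]; apply: Hn; rewrite z1/=.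
  by apply: (le_trans z2); rewrite ler_wpM2r// mulrC -ler_pdivrMr.
elim: k => [|k IH].
  near=> n => z; rewrite mulr1 => /andP[z1 z2].
  have n0 : (0 : R) < n%:R by rewrite ltr0n; near: n; exact: nbhs_infty_gt.
  have zE : z = delta * n%:R by apply/eqP; rewrite eq_le z2.
  have : (delta `^ alpha - eta * delta `^ alpha) * q n%:R <= q (delta * n%:R) <=
      (delta `^ alpha + eta * delta `^ alpha) * q n%:R.
    by near: n; apply: near_ratio_nat => //; rewrite mulr_gt0// powR_gt0.
  move=> /andP[+ _]; rewrite zE mulfK ?gt_eqF//.
  by have -> : (1 - eta) * delta `^ alpha = delta `^ alpha - eta * delta `^ alpha by rewrite mulrBl mul1r.
pose c := delta * r ^+ k; have c0 : 0 < c by rewrite mulr_gt0// exprn_gt0.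
have ca : 0 < c `^ alpha by rewrite powR_gt0.
near=> n => z /andP[z1 z2].
have n0 : (0 : R) < n%:R by rewrite ltr0n; near: n; exact: nbhs_infty_gt.
have [zc|zc] := leP z (c * n%:R).
  have : forall z, delta * n%:R <= z <= delta * r ^+ k * n%:R ->
    (1 - eta) * (z / n%:R) `^ alpha * q n%:R <= q z by near: n.
  by apply; rewrite z1.
have : (c `^ alpha - eta / 2 * c `^ alpha) * q n%:R <= q (c * n%:R) <=
      (c `^ alpha + eta / 2 * c `^ alpha) * q n%:R.
  by near: n; apply: near_ratio_nat => //; rewrite mulr_gt0// divr_gt0.
move=> /andP[H _]; have cn : 0 < c * n%:R by rewrite mulr_gt0.
apply: (le_trans _ (q_nd cn (ltW zc))); apply: (le_trans _ H).
rewrite ler_wpM2r ?q_ge0//.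
have zr : z / n%:R <= r * c by rewrite ler_pdivrMr// /c mulrCA -exprS.
have za : (z / n%:R) `^ alpha <= (r * c) `^ alpha.
  apply: ge0_ler_powR; rewrite ?nnegrE ?(ltW alpha0)//.
    by rewrite divr_ge0// (le_trans _ (ltW zc))// ltW.
  by rewrite mulr_ge0// ltW.
rewrite powRM ?(ltW rp) ?(ltW c0)// rE in za.
apply: (le_trans (ler_wpM2l (ltW e1) za)).
by rewrite mulrA /ra [(1 - eta) * _]mulrC divfK ?gt_eqF// mulrBl mul1r.
Unshelve. all: by end_near.
Qed.

(** Holds because q(n) outgrows every multiple of ln n; each union bound over about [n] events
    relies on it. *)
Lemma near_absorb (c c' K : R) : c' < c -> 0 < K ->
  \forall n \near \oo, K * n%:R * expR (- (c * q n%:R)) <= expR (- (c' * q n%:R)).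
Proof.
move=> cc K0; have d0 : 0 < c - c' by rewrite subr_gt0.
near=> n.
have n0 : (0 : R) < n%:R by rewrite ltr0n; near: n; exact: nbhs_infty_gt.
rewrite -ler_pdivlMr ?expR_gt0// -expRN -expRD opprK.
rewrite -[leLHS]lnK ?posrE ?mulr_gt0// ler_expR lnM ?posrE//.
have H1 : 2 / (c - c') * ln (1 * n%:R) <= q (1 * n%:R).
  by near: n; exact: (near_pinfty_nat ltr01 (near_ln_le _)).
have H2 : 2 * ln K / (c - c') <= q n%:R by near: n; exact: near_pinfty_q.
rewrite mul1r mulrAC ler_pdivrMr// in H1; rewrite ler_pdivrMr// in H2.
move: H1 H2; move: (ln K) (ln n%:R) (q n%:R) => A B C; nra.
Unshelve. all: by end_near.
Qed.

(** The general term of the series behind the exponential moment. For large k, q(k + 1) is at most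
    (1 + 2 eta) q(k), so the total exponent is at most a negative multiple of q(k), which beats any
    power of k; the bound is a telescoping term. *)
Lemma near_weight (theta : R) : 0 < theta < 1 -> \forall k \near \oo,
  k.+1%:R * expR (theta * q k.+1%:R) * expR (- q k%:R) <=
    (k.+1%:R * k.+2%:R)^-1 :> R.
Proof.
move=> /andP[t0 t1]; pose eta := (1 - theta) / 2; have eta0 : 0 < eta by rewrite /eta; lra.
(* chosen so that [r `^ alpha + eta <= 1 + 2 eta] and [theta (1 + 2 eta) < 1] *)
pose r := (1 + eta) `^ alpha^-1.
have rE : r `^ alpha = 1 + eta by rewrite /r -powRrM mulVf ?gt_eqF// powRr1//; lra.
have r1 : 1 < r.
  by rewrite -[1](powRr0 (1 + eta)) /r /powR gt_eqF ?ltr_expR ?ltr_pM2r ?ln_gt0 ?invr_gt0//; lra.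
pose ka := 1 - theta * (1 + 2 * eta).
have ka0 : 0 < ka.
  have -> : ka = (1 - theta) ^+ 2 by rewrite /ka /eta expr2; lra.
  by rewrite exprn_gt0//; lra.
near=> k.
have k2 : (2 <= k)%N by near: k; exact: nbhs_infty_ge.
have kp : (2 : R) <= k%:R by rewrite ler_nat.
have kr : k.+1%:R <= r * k%:R :> R.
  suff : (r - 1)^-1 <= k%:R by rewrite -[_^-1]mul1r ler_pdivrMr ?subr_gt0// -natr1; nra.
  by near: k; exact: nbhs_infty_ger.
have H1 : q k.+1%:R <= (1 + 2 * eta) * q k%:R.
  have : (r `^ alpha - eta) * q k%:R <= q (r * k%:R) <= (r `^ alpha + eta) * q k%:R.
    by near: k; apply: near_ratio_nat => //; lra.
  rewrite rE => /andP[_ H]; apply: (le_trans (q_nd _ kr)); first by rewrite ltr0n.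
  by apply: (le_trans H); rewrite le_eqVlt; apply/orP; left; apply/eqP; lra.
(* With [lk] below, 10 yields the fifth power of [k.+2], more than the cube that has to be
   beaten. *)
have H2 : 10 / ka * ln (1 * k%:R) <= q (1 * k%:R).
  by near: k; exact: (near_pinfty_nat ltr01 (near_ln_le _)).
rewrite mul1r mulrAC ler_pdivrMr// in H2.
have lk : ln k.+2%:R <= 2 * ln k%:R :> R.
  rewrite -ln_powR ler_ln ?posrE ?ltr0n ?powR_gt0//; last by lra.
  rewrite (_ : k%:R `^ 2 = k%:R ^+ 2); last by rewrite -powR_mulrn.
  by rewrite -natrX ler_nat; nia.
have H3 : theta * q k.+1%:R - q k%:R <= - (5 * ln k.+2%:R).
  have : theta * q k.+1%:R <= theta * ((1 + 2 * eta) * q k%:R) by rewrite ler_pM2l.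
  move: H2; rewrite /ka; move: (q k.+1%:R) (q k%:R) (ln k.+2%:R) (ln k%:R) lk.
  move=> A B C D; nra.
rewrite -mulrA -expRD.
apply: (@le_trans _ _ (k.+1%:R * expR (- (5 * ln k.+2%:R)))).
  by rewrite ler_wpM2l// ler_expR.
rewrite expRN expRM_natl lnK ?posrE ?ltr0n//.
rewrite ler_pdivrMr ?exprn_gt0 ?ltr0n// mulrC ler_pdivlMr ?mulr_gt0 ?ltr0n//.
rewrite -!natrM -natrX ler_nat.
apply: (@leq_trans (k.+2 ^ 3)%N); last by rewrite leq_exp2l.
by rewrite !expnS expn0 muln1 !leq_mul.
Unshelve. all: by end_near.
Qed.

End exponent.

Lemma bounded_partial_sums (R : realType) (u : nat -> R) : (forall k, 0 <= u k) ->
  (\forall k \near \oo, u k <= (k.+1%:R * k.+2%:R)^-1) ->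
  exists C, forall n, \sum_(0 <= k < n) u k <= C.
Proof.
move=> u0 [N _ HN]; exists (\sum_(0 <= k < N) u k + 1) => n.
have tel m : \sum_(0 <= k < m) (k.+1%:R * k.+2%:R)^-1 = 1 - m.+1%:R^-1 :> R.
  elim: m => [|m IH]; first by rewrite big_nil invr1 subrr.
  rewrite big_nat_recr//= IH -addrA; congr (_ + _).
  have -> : (m.+1%:R * m.+2%:R)^-1 = m.+1%:R^-1 - m.+2%:R^-1 :> R.
    apply: (mulfI (x := m.+1%:R * m.+2%:R)); first by rewrite mulf_neq0.
    rewrite mulfV ?mulf_neq0// mulrBr mulrAC mulfV// mul1r -mulrA mulfV// mulr1.
    by rewrite -[m.+2%:R]natr1; lra.
  by rewrite addrA addNr add0r.
apply: (@le_trans _ _ (\sum_(0 <= k < maxn N n) u k)).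
  rewrite [leRHS](big_cat_nat (n := n))//= ?leq_maxr// lerDl sumr_ge0// => i _.
rewrite (big_cat_nat (n := N))//= ?leq_maxl// lerD2l.
apply: (@le_trans _ _ (\sum_(N <= k < maxn N n) (k.+1%:R * k.+2%:R)^-1)).
  by rewrite !big_nat; apply: ler_sum => k /andP[Nk _]; apply: HN.
have := tel (maxn N n); rewrite (big_cat_nat (n := N))//= ?leq_maxl// tel.
have : (0 : R) < (maxn N n).+1%:R^-1 by rewrite invr_gt0.
have : N.+1%:R^-1 <= 1 :> R by rewrite invf_le1 ?ltr0n// ler1n.
move: (N.+1%:R^-1) ((maxn N n).+1%:R^-1) (\sum_(_ <= _ < _) _) => a b S; lra.
Qed.

(** * Independence and exponential moments *)

Section independence.
Context (R : realType) (d : measure_display) (T : measurableType d).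
Variable P : probability T R.
Implicit Types (X : {RV P >-> R}) (W : T -> R) (f : R -> R).

Import HBNNSimple.

(** Upgrades independence, stated for events, to products of functions: agreement on indicators
    extends to simple functions here, and then to non-negative functions by monotone convergence. *)
Lemma eq_integral_comp_nnsfun W1 W2 X (g : {nnsfun R >-> R}) :
  measurable_fun setT W1 -> measurable_fun setT W2 ->
  (forall w, 0 <= W1 w) -> (forall w, 0 <= W2 w) ->
  (forall A, measurable A -> (\int[P]_w (W1 w * \1_A (X w))%:E =
                              \int[P]_w (W2 w * \1_A (X w))%:E)%E) ->
  (\int[P]_w (W1 w * g (X w))%:E = \int[P]_w (W2 w * g (X w))%:E)%E.
Proof.
move=> mW1 mW2 W10 W20 H.
have mI (r : R) : measurable_fun setT (fun w => \1_(g @^-1` [set r]) (X w) : R).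
  by apply: measurableT_comp => //; apply: measurable_indic.
have I0 (r : R) w : 0 <= r * \1_(g @^-1` [set r]) (X w).
  rewrite indicE; have [|/negP] := boolP (X w \in g @^-1` [set r]).
    by rewrite inE /= => <-; rewrite mulr1.
  by rewrite mulr0.
have E W : measurable_fun setT W -> (forall w, 0 <= W w) ->
    (\int[P]_w (W w * g (X w))%:E = \sum_(r \in range g)
      \int[P]_w (W w * (r * \1_(g @^-1` [set r]) (X w)))%:E)%E.
  move=> mW W0; rewrite -ge0_integral_fsum//.
  - apply: eq_integral => w _; rewrite fsumEFin//; congr _%:E.
    by rewrite fimfunE !fsbig_finite//= mulr_sumr.
  - move=> r; apply/measurable_EFinP; apply: measurable_funM => //.
    exact: measurable_funM.
  - by move=> r w _; rewrite lee_fin mulr_ge0.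
rewrite !E//; apply: eq_fsbigr => r _.
have [r0|r0] := leP 0 r; last first.
  have Z w : r * \1_(g @^-1` [set r]) (X w) = 0.
    apply/eqP; rewrite eq_le I0 andbT mulr_le0_ge0// ?indicE//; exact: ltW.
  by under eq_integral do rewrite Z mulr0; under [RHS]eq_integral do rewrite Z mulr0.
have mA : measurable (g @^-1` [set r]) by rewrite -[X in measurable X]setTI; exact: measurable_funP.
have mWI W : measurable_fun setT W ->
    measurable_fun setT (fun w => (W w * \1_(g @^-1` [set r]) (X w))%:E).
  by move=> mW; apply/measurable_EFinP; apply: measurable_funM.
have pull W : measurable_fun setT W -> (forall w, 0 <= W w) ->
    (\int[P]_w (W w * (r * \1_(g @^-1` [set r]) (X w)))%:E =
     r%:E * \int[P]_w (W w * \1_(g @^-1` [set r]) (X w))%:E)%E.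
  move=> mW W0; under eq_integral do rewrite mulrCA EFinM.
  apply: ge0_integralZl_EFin => //; last exact: mWI.
  by move=> w _; rewrite lee_fin mulr_ge0// indicE.
by rewrite !pull// H.
Qed.

Lemma eq_integral_comp W1 W2 X f :
  measurable_fun setT W1 -> measurable_fun setT W2 ->
  (forall w, 0 <= W1 w) -> (forall w, 0 <= W2 w) ->
  (forall A, measurable A -> (\int[P]_w (W1 w * \1_A (X w))%:E =
                              \int[P]_w (W2 w * \1_A (X w))%:E)%E) ->
  measurable_fun setT f -> (forall x, 0 <= f x) ->
  (\int[P]_w (W1 w * f (X w))%:E = \int[P]_w (W2 w * f (X w))%:E)%E.
Proof.
move=> mW1 mW2 W10 W20 H mf f0.
have /measurable_EFinP mfE := mf.
pose g := nnsfun_approx measurableT mfE.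
have L W : measurable_fun setT W -> (forall w, 0 <= W w) ->
    (limn (fun n => \int[P]_w (W w * g n (X w))%:E) =
     \int[P]_w (W w * f (X w))%:E)%E.
  move=> mW W0; apply/cvg_lim => //.
  have -> : (\int[P]_w (W w * f (X w))%:E =
      \int[P]_w limn (fun n => (W w * g n (X w))%:E))%E.
    apply: eq_integral => w _; apply/esym/cvg_lim => //.
    rewrite EFinM; under eq_fun do rewrite EFinM.
    apply: cvgeZl => //.
    by apply: (cvg_nnsfun_approx measurableT mfE) => // x _; rewrite lee_fin.
  apply: cvg_monotone_convergence => //.
  - move=> n; apply/measurable_EFinP; apply: measurable_funM => //.
    exact: measurableT_comp.
  - by move=> n w _; rewrite lee_fin mulr_ge0.
  - move=> w _ m n mn; rewrite lee_fin ler_wpM2l//.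
    by have /lefP := nd_nnsfun_approx measurableT mfE mn; apply.
rewrite -(L W1)// -(L W2)//; congr (limn _); apply/funext => n.
exact: eq_integral_comp_nnsfun.
Qed.

Variable Z : nat -> {RV P >-> R}.
Hypothesis Z_indep : independent_RVs P Z.
Hypothesis Z_ident : forall (i : nat) (A : set R), measurable A ->
  distribution P (Z i) A = distribution P (Z 0%N) A.

(** Induction on [s1]: each step trades the function at one index [k] for the indicator of an
    arbitrary set, which joins [s2]. Against [Z k], the product of the other factors then integrates
    like the constant [C]. *)
Lemma integral_indep_indic (s1 s2 : seq nat) (f : nat -> R -> R) (c : nat -> R)
    (A : nat -> set R) : uniq (s1 ++ s2) ->
  (forall i, measurable_fun setT (f i)) -> (forall i x, 0 <= f i x) ->
  {in s1, forall i, (\int[P]_w (f i (Z i w))%:E = (c i)%:E)%E} ->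
  (forall i, measurable (A i)) ->
  (\int[P]_w ((\prod_(i <- s1) f i (Z i w)) *
              (\prod_(i <- s2) \1_(A i) (Z i w)))%:E =
   (\prod_(i <- s1) c i)%:E * \prod_(i <- s2) P (Z i @^-1` A i))%E.
Proof.
move=> + mf f0; elim: s1 s2 A => [|k s1 IH] s2 A /= us cE mA.
  rewrite big_nil mul1e -Z_indep//.
  under eq_integral do rewrite big_nil mul1r.
  have mB i : measurable (Z i @^-1` A i).
    by rewrite -[X in measurable X]setTI; exact: measurable_funP.
  rewrite -[in RHS](setIT (\bigcap_(i in _) _)) -integral_indic//; last first.
    by apply: fin_bigcap_measurable => //; exact: finite_seq.
  apply: eq_integral => w _; congr _%:E.
  rewrite indicE; have [|] := boolP (w \in _).
    rewrite inE => wA; rewrite big_seq big1// => i iI.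
    by rewrite indicE mem_set//; exact: wA.
  rewrite notin_setE => wA.
  have [i iI niA] : exists2 i, i \in s2 & ~ A i (Z i w).
    apply: contrapT => H; apply: wA => i /= iI; apply: contrapT => nA.
    by apply: H; exists i.
  apply/eqP; rewrite prodf_seq_eq0; apply/hasP; exists i => //=.
  by rewrite indicE memNset.
have us' : uniq (s1 ++ k :: s2).
  by rewrite -(cat1s k s2) uniq_catCA /= us.
have kE : (\int[P]_w (f k (Z k w))%:E = (c k)%:E)%E by apply: cE; rewrite mem_head.
have cE' : {in s1, forall i, (\int[P]_w (f i (Z i w))%:E = (c i)%:E)%E}.
  by move=> i iI; apply: cE; rewrite inE iI orbT.
pose W1 w := (\prod_(i <- s1) f i (Z i w)) * (\prod_(i <- s2) \1_(A i) (Z i w)).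
have Pfin (i : nat) B : measurable B -> (P (Z i @^-1` B) \is a fin_num)%E.
  move=> mB; apply: fin_num_measure.
  by rewrite -[X in measurable X]setTI; exact: measurable_funP.
pose C := (\prod_(i <- s1) c i) * (\prod_(i <- s2) fine (P (Z i @^-1` A i))).
have CE : (C%:E = (\prod_(i <- s1) c i)%:E * \prod_(i <- s2) P (Z i @^-1` A i))%E.
  rewrite /C EFinM; congr (_ * _)%E; rewrite -prodEFin.
  by apply: eq_bigr => i _; rewrite fineK// Pfin.
have c0 i : i \in s1 -> 0 <= c i.
  by move=> iI; rewrite -lee_fin -cE'// integral_ge0// => w _; rewrite lee_fin.
have C0 : 0 <= C.
  rewrite mulr_ge0//; first by rewrite big_seq prodr_ge0.
  by apply: prodr_ge0 => i _; rewrite fine_ge0.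
have mW1 : measurable_fun setT W1.
  apply: measurable_funM; apply: measurable_prod => i _; first exact: measurableT_comp.
  by apply: measurableT_comp => //; exact: measurable_indic.
have H B : measurable B -> (\int[P]_w (W1 w * \1_B (Z k w))%:E =
    \int[P]_w (cst C w * \1_B (Z k w))%:E)%E.
  move=> mB; have := IH (k :: s2) (fun i => if i == k then B else A i) us' cE'.
  have ks2 : {in s2, forall i, i != k}.
    move=> i iI; apply: contraTneq us => <-.
    by rewrite mem_cat iI orbT.
  rewrite big_cons eqxx.
  have -> : (\prod_(j <- s2) P (Z j @^-1` (if j == k then B else A j)) =
             \prod_(j <- s2) P (Z j @^-1` A j))%E.
    by apply: eq_big_seq => j jI; rewrite (negPf (ks2 j jI)).
  move=> H; have {}H := H _; rewrite muleCA -CE in H.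
  transitivity (P (Z k @^-1` B) * C%:E)%E.
    rewrite -H; last by move=> i; case: ifP.
    apply: eq_integral => w _; congr _%:E; rewrite big_cons eqxx /W1 -mulrA.
    congr (_ * _); rewrite mulrC; congr (_ * _).
    by apply: eq_big_seq => i iI; rewrite (negPf (ks2 i iI)).
  under [RHS]eq_integral do rewrite EFinM.
  rewrite ge0_integralZl_EFin//.
  - rewrite muleC; congr (_ * _)%E.
    rewrite -[in LHS](setIT (Z k @^-1` B)) -integral_indic//.
    by rewrite -[X in measurable X]setTI; exact: measurable_funP.
  - apply/measurable_EFinP; apply: measurableT_comp => //; exact: measurable_indic.
rewrite big_cons.
transitivity (\int[P]_w (W1 w * f k (Z k w))%:E)%E.
  apply: eq_integral => w _; congr _%:E; rewrite big_cons /W1.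
  by rewrite -mulrA mulrC.
rewrite (@eq_integral_comp W1 (cst C) (Z k) (f k) mW1)//.
- under eq_integral do rewrite EFinM.
  rewrite ge0_integralZl_EFin//.
  + by rewrite kE CE muleC EFinM muleA.
  + by move=> w _; rewrite lee_fin.
  + by apply/measurable_EFinP; exact: measurableT_comp.
- by move=> w; rewrite /W1 mulr_ge0// prodr_ge0.
Qed.

Lemma integral_ident (i : nat) f : measurable_fun setT f -> (forall x, 0 <= f x) ->
  (\int[P]_w (f (Z i w))%:E = \int[P]_w (f (Z 0%N w))%:E)%E.
Proof.
move=> mf f0; have /measurable_EFinP mfE := mf.
have f0' x : (0 <= (EFin \o f) x)%E by rewrite /= lee_fin.
have H j := ge0_integral_distribution (Z j) mfE f0'.
rewrite -[LHS](H i) -[RHS](H 0%N).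
by apply: eq_measure_integral => A mA _; exact: Z_ident.
Qed.

(* Chernoff bound for the sum over [s], conditionally on the independent event
   that [Z i] lies in [A i] for all [i] in [K]. *)
Lemma chernoff (s K : seq nat) f (A : nat -> set R) (b M : R) : uniq (s ++ K) ->
  measurable_fun setT f -> (forall i, measurable (A i)) ->
  (\int[P]_w (expR (f (Z 0%N w)))%:E <= M%:E)%E ->
  (P [set w | {in K, forall i, A i (Z i w)} /\ (b <= \sum_(i <- s) f (Z i w))%R] <=
    (expR (- b) * M ^+ size s)%:E * \prod_(i <- K) P (Z i @^-1` A i))%E.
Proof.
move=> us mf mA HM.
have mef : measurable_fun setT (expR \o f) by apply: measurableT_comp.
pose m := fine (\int[P]_w (expR (f (Z 0%N w)))%:E)%E.
have m0 : 0 <= m by rewrite fine_ge0// integral_ge0// => w _; rewrite lee_fin expR_ge0.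
have mE i : (\int[P]_w ((expR \o f) (Z i w))%:E = m%:E)%E.
  rewrite integral_ident//; last by move=> x; rewrite expR_ge0.
  rewrite /m fineK// ge0_fin_numE; last by rewrite integral_ge0// => w _; rewrite lee_fin expR_ge0.
  by apply: le_lt_trans HM _; rewrite ltry.
have mM : m <= M.
  by rewrite -lee_fin -(mE 0%N).
have := @integral_indep_indic s K (fun=> expR \o f) (fun=> m) A us (fun=> mef)
  (fun _ x => expR_ge0 _) (fun i _ => mE i) mA.
rewrite [X in (_ = X%:E * _)%E]big_const_seq count_predT iter_mulr_1 => H.
set G := [set w | _].
have mG : measurable G.
  rewrite (_ : G = (\bigcap_(i in [set` K]) (Z i @^-1` A i)) `&`
     (fun w => \sum_(i <- s) f (Z i w)) @^-1` `[b, +oo[).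
    apply: measurableI.
      apply: fin_bigcap_measurable; first exact: finite_seq.
      by move=> i _; rewrite -[X in measurable X]setTI; exact: measurable_funP.
    rewrite -[X in measurable X]setTI; apply: measurable_sum => // i.
    exact: measurableT_comp.
  apply/seteqP; split => w [wK wb]; split => //=; rewrite ?in_itv/= ?wb//.
  by move: wb; rewrite /= in_itv/= andbT.
pose F w := (\prod_(i <- s) expR (f (Z i w))) * (\prod_(i <- K) \1_(A i) (Z i w)).
have F0 w : 0 <= F w.
  by rewrite mulr_ge0// prodr_ge0// => i _; rewrite expR_ge0.
have mF : measurable_fun setT F.
  apply: measurable_funM; apply: measurable_prod => i _.
    exact: (measurableT_comp mef).
  by apply: measurableT_comp => //; exact: measurable_indic.
apply: (@le_trans _ _ (\int[P]_w (expR (- b) * F w)%:E)%E).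
  rewrite -[G]setIT -integral_indic//; apply: ge0_le_integral => //.
  - by apply/measurable_EFinP; exact: measurable_indic.
  - by apply/measurable_EFinP; exact: measurable_funM.
  - move=> w _; rewrite lee_fin indicE; have [|_] := boolP (w \in G); last first.
      by rewrite mulr_ge0// expR_ge0.
    rewrite inE => -[wK wb]; rewrite /F [X in _ * (_ * X)]big_seq.
    rewrite [X in _ * (_ * X)]big1 ?mulr1; last first.
      by move=> i iK; rewrite indicE mem_set//; exact: wK.
    by rewrite -expR_sum -expRD -expR0 ler_expR addrC subr_ge0.
under eq_integral do rewrite EFinM.
rewrite ge0_integralZl_EFin ?expR_ge0//; last first.
- exact/measurable_EFinP.
- by move=> w _; rewrite lee_fin.
rewrite [X in (_ * X)%E](_ : _ = (m ^+ size s)%:E * \prod_(i <- K) P (Z i @^-1` A i))%E//.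
rewrite muleA -EFinM lee_wpmul2r//; first by apply: prode_ge0.
by rewrite lee_fin ler_wpM2l ?expR_ge0// lerXn2r// ?nnegrE// (le_trans m0).
Qed.

End independence.

(** * Exponential moments of one variable and of its truncation *)

Section truncated_moments.
Context (R : realType) (d : measure_display) (T : measurableType d).
Variables (P : probability T R) (X : {RV P >-> R}) (alpha : R) (q : R -> R).
Hypothesis qH : weibull_exponent alpha q.
Hypothesis X_ge0 : forall w, 0 <= X w.
Hypothesis X_tail : forall x : R, 0 < x ->
  P [set w | x <= X w] = (expR (- q x))%:E.

Let q_nd := exponent_nd qH.
Let q_ge0 := exponent_ge0 qH.

(* [G = sum_k c_k 1{k <= X}] dominates [X exp (theta q(X))] on each
   [{k <= X < k + 1}], and [E G = sum_k c_k P(k <= X)] is a convergent series. *)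
Lemma exp_moment (theta : R) : 0 < theta < 1 -> exists G : T -> \bar R,
  P.-integrable setT G /\
  forall w, ((X w * expR (theta * q (X w)))%:E <= G w)%E.
Proof.
move=> theta01; have /andP[theta0 theta1] := theta01.
pose c (k : nat) : R := k.+1%:R * expR (theta * q k.+1%:R).
pose A (k : nat) : set T := X @^-1` `[k%:R, +oo[.
pose g (k : nat) w : \bar R := (c k * \1_(A k) w)%:E.
have c0 k : 0 <= c k by rewrite mulr_ge0// expR_ge0.
have g0 k w : (0 <= g k w)%E by rewrite lee_fin mulr_ge0// indicE.
have mA k : measurable (A k).
  by rewrite -[X in measurable X]setTI; exact: measurable_funP.
have mg k : measurable_fun setT (g k).
  by apply/measurable_EFinP; apply: measurable_funM => //; exact: measurable_indic.
(* [X_tail] speaks of positive levels only; at [k = 0] the probability is bounded by 1. *)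
pose u (k : nat) : R := c k * (if k == 0 then 1 else expR (- q k%:R)).
have u0 k : 0 <= u k by rewrite mulr_ge0//; case: ifP => // _; exact: expR_ge0.
have [C HC] : exists C, forall n, \sum_(0 <= k < n) u k <= C.
  apply: bounded_partial_sums => //; near=> k.
  have k0 : (0 < k)%N by near: k; exact: nbhs_infty_gt.
  by rewrite /u gtn_eqF//; near: k; exact: near_weight qH _ theta01.
have gu k : (\int[P]_w g k w <= (u k)%:E)%E.
  under eq_integral do rewrite /g EFinM.
  rewrite ge0_integralZl_EFin//.
  - rewrite integral_indic// setIT.
    rewrite (_ : (u k)%:E = (c k)%:E * (if k == 0 then 1 else expR (- q k%:R))%:E)%E//.
    rewrite lee_wpmul2l ?lee_fin//.
    case: ifP => [_|k0]; first exact: probability_le1.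
    have kp : (0 : R) < k%:R by rewrite ltr0n lt0n k0.
    rewrite -X_tail// le_measure ?inE//.
      rewrite (_ : [set w | _] = A k)//.
      by apply/seteqP; split => w; rewrite /A /= in_itv/= andbT.
    by move=> w; rewrite /A /= in_itv/= andbT.
  - by apply/measurable_EFinP; exact: measurable_indic.
pose G w := (\sum_(0 <= k <oo) g k w)%E.
have G0 w : (0 <= G w)%E by apply: nneseries_ge0.
have mG : measurable_fun setT G by apply: ge0_emeasurable_sum.
exists G; split.
  apply/integrableP; split => //.
  under eq_integral do rewrite gee0_abs//.
  rewrite integral_nneseries//; apply: (@le_lt_trans _ _ C%:E); last exact: ltry.
  apply: lime_le.
    by apply: is_cvg_nneseries => k _ _; apply: integral_ge0.
  apply: nearW => n; apply: le_trans (_ : _ <= (\sum_(0 <= k < n) u k)%:E)%E _.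
    by rewrite -sumEFin; apply: lee_sum => k _; exact: gu.
  by rewrite lee_fin.
move=> w; have := X_ge0 w; rewrite le_eqVlt => /orP[/eqP <-|Xp].
  by rewrite mul0r.
pose k := Num.truncn (X w); have /andP[k1 k2] := truncn_itv (X_ge0 w).
rewrite -/k in k1 k2.
apply: le_trans (@nneseries_lim_ge _ (g^~ w) xpredT 0%N k.+1 _); last by [].
rewrite big_nat_recr//=; apply: le_trans (_ : _ <= g k w)%E _; last first.
  by rewrite leeDr// sume_ge0.
rewrite /g indicE mem_set ?mulr1; last by rewrite /A /= in_itv/= k1.
rewrite lee_fin ler_pM ?expR_ge0//; first exact: ltW.
by rewrite ler_expR ler_wpM2l ?(ltW theta0)// q_nd// ltW.
Unshelve. all: by end_near.
Qed.

Lemma integrable_weibull : P.-integrable setT (fun w => (X w)%:E).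
Proof.
have h : 0 < (2^-1 : R) < 1 by rewrite invr_gt0 ltr0n/= invf_lt1// ltr1n.
have [G [iG XG]] := exp_moment h.
apply: le_integrable iG => //; first exact/measurable_EFinP.
move=> w _; rewrite gee0_abs ?lee_fin//; apply: le_trans (lee_abs _).
apply: le_trans (XG w); rewrite lee_fin.
have := X_ge0 w; rewrite le_eqVlt => /orP[/eqP <-|Xp]; first by rewrite mul0r.
by rewrite ler_peMr// -expR0 ler_expR mulr_ge0 ?q_ge0.
Qed.

Definition mean : R := fine 'E_P[X].

Lemma meanE : (\int[P]_w (X w)%:E = mean%:E)%E.
Proof.
rewrite /mean expectation_def fineK//; exact: integrable_fin_num integrable_weibull.
Qed.

(** Values above [b] are sent to 0, not to [b], so that [z - clip b z] is the whole large jump and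
    vanishes for the others. The indicator makes measurability immediate. *)
Definition clip (b z : R) : R := z * \1_(`]-oo, b]%classic : set R) z.

Lemma clipE b z : clip b z = if z <= b then z else 0.
Proof.
by rewrite /clip indicE mem_setE in_itv/=; case: ifP; rewrite ?mulr1 ?mulr0.
Qed.

Lemma measurable_clip b : measurable_fun setT (clip b).
Proof. by apply: measurable_funM => //; apply: measurable_indic. Qed.

(** Both signs follow from [1 - y <= expR (- y)]. It dominates the difference quotients of the
    exponential. *)
Lemma expR_sub1_le (sigma y : R) : sigma = 1 \/ sigma = -1 -> 0 <= y ->
  `|expR (sigma * y) - 1| <= y * expR y.
Proof.
move=> sE y0; have e1 : 1 <= expR y by rewrite -expR0 ler_expR.
have H : 1 - y <= expR (- y) by have := expR_ge1Dx (- y).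
case: sE => ->; rewrite ?mul1r ?mulN1r.
  rewrite ger0_norm ?subr_ge0// lerBlDl -[1](expRxMexpNx_1 y).
  have := ler_wpM2r (expR_ge0 y) H.
  by rewrite mulrBl mul1r [expR (- y) * _]mulrC; lra.
rewrite ler0_norm; last by rewrite subr_le0 -[leRHS]expR0 ler_expR oppr_le0.
by rewrite opprB; have := ler_wpM2l y0 e1; rewrite mulr1; lra.
Qed.

Lemma expR_quadratic (y : R) : `|y| <= 2^-1 -> `|expR y - 1 - y| <= 2 * y ^+ 2.
Proof.
rewrite ler_norml => /andP[y1 y2].
have H1 := expR_ge1Dx y; have H2 := expR_ge1Dx (- y).
have H3 := expRxMexpNx_1 y; have H4 := expR_gt0 y.
have H5 : expR y * (1 - y) <= 1 by rewrite -[leRHS]H3 ler_wpM2l// ltW.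
have H6 : 0 <= y ^+ 2 by exact: sqr_ge0.
rewrite ger0_norm; last by lra.
rewrite expr2 in H6 *.
have H7 : (expR y - 1 - y - 2 * (y * y)) * (1 - y) <= 0.
  have : (expR y - 1 - y - 2 * (y * y)) * (1 - y) =
      expR y * (1 - y) - 1 - y * y * (1 - 2 * y) by lra.
  move=> ->; have : 0 <= y * y * (1 - 2 * y) by rewrite mulr_ge0//; lra.
  lra.
have y1' : 0 < 1 - y by lra.
move: H7; rewrite pmulr_lle0//; lra.
Qed.

(** The difference quotient [f n] of the exponential at scale [th n] tends to [sigma * X w] and is
    dominated through [exp_moment], so its mean tends to [sigma * mean]; the inequality 1 + x <=
    exp(x) turns this back into a bound on the moment. [delta] depends on [s] alone and is fixed
    before [eta]. *)
Lemma near_clip_mgf (s : R) : 0 < s -> exists2 delta : R, 0 < delta &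
  forall sigma eta : R, sigma = 1 \/ sigma = -1 -> 0 < eta -> \forall n \near \oo,
    (\int[P]_w (expR (s * q n%:R / n%:R * (sigma *
        (clip (delta * n%:R) (X w) - mean))))%:E <=
     (expR (s * q n%:R / n%:R * eta))%:E)%E.
Proof.
move=> s0; have /andP[al0 al1] := exponent_itv qH.
(* Solves delta^alpha = 8 s delta. For z <= delta n with z large, q(z)/z is at least q(delta
   n)/(delta n), hence at least 4 s q(n)/n: one factor 2 is spent on the precision of
   [near_ratio_nat]. *)
pose delta := (8 * s) `^ (alpha - 1)^-1.
have s8 : 0 < 8 * s by rewrite mulr_gt0.
have delta0 : 0 < delta by rewrite powR_gt0.
have deltaE : delta `^ alpha = 8 * s * delta.
  rewrite -(mulr_powRB1 (ltW delta0) al0) [RHS]mulrC; congr (_ * _).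
  by rewrite /delta -powRrM mulVf ?powRr1 ?(ltW s8)// subr_eq0 lt_eqF.
exists delta => // sigma eta sE eta0.
pose th (n : nat) : R := s * q n%:R / n%:R.
have h : 0 < (4^-1 : R) < 1 by rewrite invr_gt0 ltr0n/= invf_lt1// ltr1n.
have [G [iG XG]] := exp_moment h.
have [x0' Hx0'] := exponent_concave qH; pose x0 := Num.max 1 x0'.
have x01 : 1 <= x0 by rewrite le_max lexx.
have Hx0 x y : x0 <= x -> x <= y -> q y / y <= q x / x.
  by move=> xx; apply: Hx0'; apply: le_trans xx; rewrite le_max lexx orbT.
have qsmall (e : R) : 0 < e -> \forall n \near \oo, th n <= e.
  move=> e0; near=> n.
  have n0 : (0 : R) < n%:R by rewrite ltr0n; near: n; exact: nbhs_infty_gt.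
  rewrite /th ler_pdivrMr// -ler_pdivlMl// mulrA [s^-1 * e]mulrC.
  have : q (1 * n%:R) <= e / s * (1 * n%:R); last by rewrite !mul1r.
  near: n; exact: near_pinfty_nat ltr01 (near_q_small qH (divr_gt0 e0 s0)).
have [N _ HN] : \forall n \near \oo, [/\ 0 < th n, th n * x0 <= 1 &
    forall z, x0 <= z -> z <= delta * n%:R -> th n * z <= 4^-1 * q z].
  near=> n.
  have n0 : (0 : R) < n%:R by rewrite ltr0n; near: n; exact: nbhs_infty_gt.
  have qn : 0 < q n%:R.
    by apply: (@lt_le_trans _ _ 1) => //; near: n; exact: near_pinfty_q qH _.
  split; first by rewrite /th divr_gt0// mulr_gt0.
    rewrite -ler_pdivlMr; last by lra.
    by near: n; apply: qsmall; rewrite divr_gt0//; lra.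
  move=> z zx0 zn; have zp : 0 < z by lra.
  have H1 := Hx0 _ _ zx0 zn; have dn : 0 < delta * n%:R by rewrite mulr_gt0.
  have : (delta `^ alpha - delta `^ alpha / 2) * q n%:R <= q (delta * n%:R) <=
      (delta `^ alpha + delta `^ alpha / 2) * q n%:R.
    by near: n; apply: near_ratio_nat qH _ _ _ _ => //; rewrite divr_gt0// powR_gt0.
  move=> /andP[H2 _]; rewrite deltaE in H2.
  rewrite ler_pdivrMr// in H1; have {H2}H1 := le_trans H2 H1.
  have H3 : 4 * s * q n%:R <= q z / z * n%:R.
    rewrite -(ler_pM2l delta0); move: H1; set Q := q z / z; lra.
  rewrite /th mulrAC ler_pdivrMr//.
  move: H3; rewrite [q z / z * _]mulrAC ler_pdivlMr//; lra.
pose f (n : nat) w : R := (expR (th n * (sigma * clip (delta * n%:R) (X w))) - 1) / th n.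
have mcl (b : R) : measurable_fun setT (fun w => clip b (X w)).
  by apply: measurableT_comp => //; exact: measurable_clip.
have mf n : measurable_fun setT (f n).
  apply: measurable_funM => //; apply: measurable_funB => //.
  apply: measurableT_comp => //; apply: measurable_funM => //.
  exact: measurable_funM.
(* The factor [expR 1] covers [X w <= x0], where [q x / x] need not be monotone but
   [th n * x0 <= 1]. *)
pose g w : \bar R := ((expR 1)%:E * G w)%E.
have ig : P.-integrable setT g by apply: integrableZl.
have fg n w : (N <= n)%N -> (`|(f n w)%:E| <= g w)%E.
  move=> Nn; have [t0 t1 tz] := HN n Nn.
  have G0 : (0 <= G w)%E.
    by apply: le_trans (XG w); rewrite lee_fin mulr_ge0// expR_ge0.
  rewrite /f clipE; case: ifPn => [Xn|_]; last first.
    rewrite mulr0 mulr0 expR0 subrr mul0r abse0 /g.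
    by rewrite mule_ge0// lee_fin expR_ge0.
  have [Xz|Xp] := leP (X w) 0.
    have -> : X w = 0 by apply/eqP; rewrite eq_le Xz X_ge0.
    rewrite mulr0 mulr0 expR0 subrr mul0r abse0 /g.
    by rewrite mule_ge0// lee_fin expR_ge0.
  apply: (@le_trans _ _ (expR 1 * (X w * expR (4^-1 * q (X w))))%:E); last first.
    by rewrite EFinM /g lee_wpmul2l// lee_fin expR_ge0.
  rewrite abse_EFin lee_fin normrM normfV (gtr0_norm t0) ler_pdivrMr//.
  rewrite mulrCA; apply: (le_trans (expR_sub1_le sE _)).
    by rewrite mulr_ge0// ltW.
  rewrite [expR 1 * _]mulrCA -[X in X <= _]mulrA [th n * _]mulrC.
  rewrite [X w * expR _ * _]mulrC.
  have E : expR (th n * X w) <= expR 1 * expR (4^-1 * q (X w)).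
    rewrite -expRD ler_expR; have [Xx|Xx] := leP (X w) x0.
      apply: (@le_trans _ _ (th n * x0)); first by rewrite ler_wpM2l// ltW.
      by apply: (le_trans t1); rewrite lerDl mulr_ge0 ?q_ge0.
    by rewrite addrC ler_wpDr// tz// ltW.
  have := ler_wpM2l (mulr_ge0 (ltW t0) (X_ge0 w)) E.
  move: (expR (th n * X w)) (expR 1) (expR (4^-1 * q (X w))) (th n) (X w).
  by move=> a b c t x; lra.
(* Shifted by [N], since the domination starts there while [dominated_convergence] asks for it at
   every index. *)
have fcv w : (f (n + N)%N w)%:E @[n --> \oo] --> (sigma * X w)%:E.
  apply/cvg_EFin; first by near=> n.
  rewrite (_ : fine \o _ = (fun n => f (n + N)%N w))//.
  rewrite (@cvg_shiftn N _ (f^~ w)).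
  apply/cvgrPdist_le => e e0; near=> n.
  have Nn : (N <= n)%N by near: n; exact: nbhs_infty_ge.
  have [t0 _ _] := HN n Nn.
  have Xn : X w <= delta * n%:R.
    by rewrite -ler_pdivrMl//; near: n; exact: nbhs_infty_ger.
  rewrite /f clipE Xn; set y := th n * _.
  have yE : `|y| = th n * X w.
    rewrite /y normrM (gtr0_norm t0) normrM (ger0_norm (X_ge0 w)).
    by case: sE => ->; rewrite ?normrN1 ?normr1 mul1r.
  have y2 : `|y| <= 2^-1.
    rewrite yE; apply: (@le_trans _ _ (th n * (X w + 1))).
      by rewrite ler_wpM2l ?(ltW t0)// lerDl.
    rewrite -ler_pdivlMr; last by rewrite ltr_wpDl.
    by near: n; apply: qsmall; rewrite divr_gt0 ?invr_gt0// ltr_wpDl.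
  have -> : sigma * X w - (expR y - 1) / th n = - ((expR y - 1 - y) / th n).
    have yth : y / th n = sigma * X w by rewrite /y mulrC mulKf// gt_eqF.
    by rewrite [in RHS]mulrBl yth opprB.
  rewrite normrN normrM normfV (gtr0_norm t0) ler_pdivrMr//.
  apply: (le_trans (expR_quadratic y2)).
  rewrite -[y ^+ 2]real_normK ?num_real// yE.
  have : th n <= e / (2 * (X w ^+ 2 + 1)).
    by near: n; apply: qsmall; rewrite divr_gt0// mulr_gt0// ltr_wpDl// sqr_ge0.
  have X2 : 0 < 2 * (X w ^+ 2 + 1) by rewrite mulr_gt0// ltr_wpDl// sqr_ge0.
  rewrite ler_pdivlMr// exprMn expr2 => H.
  have := ler_wpM2r (ltW t0) H; have := sqr_ge0 (X w); nra.
have [_ _ cv] := @dominated_convergence _ _ _ P setT measurableT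
  (fun n w => (f (n + N)%N w)%:E) (fun w => (sigma * X w)%:E) g
  (fun n => (measurable_EFinP _ _).2 (mf (n + N)%N)) 
  ((measurable_EFinP _ _).2 (measurable_funM (measurable_cst _) (measurable_funP X)))
  (aeW P (fun w _ => fcv w)) ig (aeW P (fun w n _ => fg (n + N)%N w (leq_addl _ _))).
have limE : (\int[P]_w (sigma * X w)%:E = (sigma * mean)%:E)%E.
  under eq_integral do rewrite EFinM.
  by rewrite integralZl ?integrable_weibull// meanE.
rewrite limE in cv.
move: cv => /fine_cvgP [cvf /cvgrPdist_lt /(_ _ eta0) cve].
have : \forall n \near \oo, fine (\int[P]_w (f n w)%:E)%E <= sigma * mean + eta.
  have H : \forall n \near \oo, fine (\int[P]_w (f (n + N)%N w)%:E)%E <= sigma * mean + eta.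
    by apply: filterS cve => n /=; rewrite ltr_norml => /andP[+ _]; lra.
  move: H => [M _ HM]; exists (M + N)%N => // n /= MN.
  have Nn : (N <= n)%N := leq_trans (leq_addl M N) MN.
  have Mn : (M <= n - N)%N by rewrite leq_subRL// addnC.
  by have := HM _ Mn; rewrite /= subnK.
move=> H; near=> n.
have Nn : (N <= n)%N by near: n; exact: nbhs_infty_ge.
have [t0 _ _] := HN n Nn.
have ifn : P.-integrable setT (fun w => (f n w)%:E).
  apply: le_integrable ig => //; first exact/measurable_EFinP.
  by move=> w _; apply: (le_trans (fg n w Nn)); exact: lee_abs.
have fn : fine (\int[P]_w (f n w)%:E)%E <= sigma * mean + eta by near: n.
pose F := fine (\int[P]_w (f n w)%:E)%E.
have FE : (\int[P]_w (f n w)%:E = F%:E)%E by rewrite /F fineK// integrable_fin_num.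
have E1 : (\int[P]_w (expR (th n * (sigma * clip (delta * n%:R) (X w))))%:E =
    (1 + th n * F)%:E)%E.
  transitivity (\int[P]_w ((1 : R)%:E + (th n)%:E * (f n w)%:E))%E.
    apply: eq_integral => w _; rewrite -EFinM -EFinD; congr _%:E.
    have -> : th n * f n w = expR (th n * (sigma * clip (delta * n%:R) (X w))) - 1.
      by rewrite /f mulrCA mulfV ?gt_eqF// mulr1.
    by rewrite addrC subrK.
  rewrite integralD//.
  - have -> : (\int[P]__ 1 = 1)%E.
      by rewrite (integral_cst P measurableT 1%E) mul1e; exact: probability_setT.
    by rewrite integralZl// FE -EFinM -EFinD.
  - exact: finite_measure_integrable_cst.
  - exact: integrableZl.
have E2 w : (expR (th n * (sigma * (clip (delta * n%:R) (X w) - mean))))%:E =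
    ((expR (- (th n * (sigma * mean))))%:E *
     (expR (th n * (sigma * clip (delta * n%:R) (X w))))%:E)%E.
  by rewrite -EFinM -expRD; congr (expR _)%:E; rewrite mulrBr mulrBr addrC.
under eq_integral do rewrite -/(th n) E2.
rewrite ge0_integralZl_EFin ?expR_ge0//; last first.
  apply/measurable_EFinP; apply: measurableT_comp => //.
  by apply: measurable_funM => //; apply: measurable_funM.
rewrite E1 -EFinM lee_fin -/(th n).
apply: (@le_trans _ _ (expR (- (th n * (sigma * mean))) * expR (th n * (sigma * mean + eta)))).
  rewrite ler_wpM2l ?expR_ge0//; apply: le_trans (expR_ge1Dx _).
  by rewrite lerD2l ler_wpM2l// ltW.
by rewrite -expRD ler_expR; lra.
Unshelve. all: by end_near.
Qed.

End truncated_moments.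

Section union_bound.
Context (R : realType) (d : measure_display) (T : measurableType d).
Variable P : probability T R.

Lemma union_bound (s : seq nat) (F : nat -> set T) (b : R) : 0 <= b ->
  (forall i, measurable (F i)) -> {in s, forall i, (P (F i) <= b%:E)%E} ->
  (P (\bigcup_(i in [set` s]) F i) <= ((size s)%:R * b)%:E)%E.
Proof.
move=> b0 mF; rewrite bigcup_seq; elim: s => [|i s IH] H.
  by rewrite big_nil measure0 mul0r.
rewrite big_cons; have mU : measurable (\big[setU/set0]_(i <- s) F i).
  by apply: bigsetU_measurable.
apply: (le_trans (measureU2 _ (mF i) mU)).
have H1 : (P (F i) <= b%:E)%E by apply: H; rewrite mem_head.
have H2 : (P (\big[setU/set0]_(i <- s) F i) <= ((size s)%:R * b)%:E)%E.
  by apply: IH => j js; apply: H; rewrite inE js orbT.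
by rewrite /= -natr1 mulrDl mul1r addrC EFinD; exact: leeD.
Qed.

End union_bound.

(** * Deviations of the truncated sums and of the large jumps *)

Section deviations.
Context (R : realType) (d : measure_display) (T : measurableType d).
Variables (P : probability T R) (Z : nat -> {RV P >-> R}) (alpha : R) (q : R -> R).
Hypothesis qH : weibull_exponent alpha q.
Hypothesis Z_indep : independent_RVs P Z.
Hypothesis Z_ident : forall (i : nat) (A : set R), measurable A ->
  distribution P (Z i) A = distribution P (Z 0%N) A.
Hypothesis Z_ge0 : forall i w, 0 <= Z i w.
Hypothesis Z_tail : forall x : R, 0 < x ->
  P [set w | x <= Z 0%N w] = (expR (- q x))%:E.

Let alpha0 : 0 < alpha. Proof. by case/andP: (exponent_itv qH). Qed.
Let q_nd := exponent_nd qH.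
Let q_ge0 := exponent_ge0 qH.
Let m := mean (Z 0%N).

Lemma preimage_RV_measurable i (A : set R) : measurable A -> measurable (Z i @^-1` A).
Proof. by move=> mA; rewrite -[X in measurable X]setTI; exact: measurable_funP. Qed.

Lemma tail_ident i (x : R) : 0 < x -> P (Z i @^-1` `[x, +oo[) = (expR (- q x))%:E.
Proof.
move=> x0; have := Z_ident i (measurable_itv `[x, +oo[).
rewrite /distribution /pushforward => ->; rewrite -Z_tail//.
by congr (P _); apply/seteqP; split => w /=; rewrite in_itv/= andbT.
Qed.

(** At the scale [s0 = 2 * c / eps], half of [eps] is lost to the moment bound and exactly [c] is
    left. The event on [K] is carried along for the lower bound, where the estimate is needed
    jointly with prescribed jumps. *)
Lemma clip_sum_le (eps c : R) : 0 < eps -> 0 < c -> exists2 delta : R, 0 < delta &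
  \forall n \near \oo, forall (sigma : R) (s K : seq nat) (A : nat -> set R),
    sigma = 1 \/ sigma = -1 -> uniq (s ++ K) -> (size s <= n)%N ->
    (forall i, measurable (A i)) ->
    (P [set w | {in K, forall i, A i (Z i w)} /\
       (eps * n%:R <= \sum_(i <- s) sigma * (clip (delta * n%:R) (Z i w) - m))%R] <=
     (expR (- (c * q n%:R)))%:E * \prod_(i <- K) P (Z i @^-1` A i))%E.
Proof.
move=> eps0 c0; pose s0 := 2 * c / eps.
have s0p : 0 < s0 by rewrite divr_gt0// mulr_gt0.
have [delta delta0 H] := near_clip_mgf qH (Z_ge0 0%N) Z_tail s0p.
have eta0 : 0 < eps / 2 by rewrite divr_gt0.
exists delta => //; near=> n => sigma s K A sE us sn mA.
have n0 : (0 : R) < n%:R by rewrite ltr0n; near: n; exact: nbhs_infty_gt.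
have qn : 0 < q n%:R.
  by apply: (@lt_le_trans _ _ 1) => //; near: n; exact: near_pinfty_q qH _.
have M : (\int[P]_w (expR (s0 * q n%:R / n%:R *
      (sigma * (clip (delta * n%:R) (Z 0%N w) - m))))%:E <=
    (expR (s0 * q n%:R / n%:R * (eps / 2)))%:E)%E.
  by case: sE => ->; near: n; [apply: (H 1)|apply: (H (-1))] => //; [left|right].
set th := s0 * q n%:R / n%:R in M; have th0 : 0 < th by rewrite divr_gt0// mulr_gt0.
have mf : measurable_fun setT
    (fun z : R => th * (sigma * (clip (delta * n%:R) z - m))).
  apply: measurable_funM => //; apply: measurable_funM => //.
  by apply: measurable_funB => //; exact: measurable_clip.
have := @chernoff _ _ _ _ _ Z_indep Z_ident s K _ A (th * (eps * n%:R)) _ us mf mA M.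
under eq_set => w do rewrite -mulr_sumr ler_pM2l//.
move=> /le_trans; apply; rewrite lee_wpmul2r//; first by apply: prode_ge0.
rewrite lee_fin -expRM_natl -expRD ler_expR.
have thn : th * n%:R = s0 * q n%:R by rewrite /th divfK// gt_eqF.
have s0E : s0 * eps = 2 * c by rewrite /s0 divfK// gt_eqF.
have -> : c * q n%:R = th * n%:R * eps / 2.
  by rewrite thn [s0 * _ * eps]mulrAC s0E; lra.
have : (size s)%:R * (th * (eps / 2)) <= n%:R * (th * (eps / 2)).
  by rewrite ler_wpM2r ?ler_nat// mulr_ge0 ?(ltW th0)// ltW.
move: (size s)%:R n%:R => a b; lra.
Unshelve. all: by end_near.
Qed.

(** For z between delta n and M n the exponent is at most th1 q(z) by the uniform comparison, and t2
    q(z) exceeds this by at least kappa q(n). So large values contribute at most exp(- kappa q(n))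
    times the finite constant [C] from the moment of order [t2]. *)
Lemma large_jump_mgf (delta M theta : R) : 0 < delta -> 0 < theta < 1 ->
  exists kappa C : R, [/\ 0 < kappa, 0 <= C & \forall n \near \oo,
    (\int[P]_w (expR (theta * q n%:R *
       (if (delta * n%:R < Z 0%N w) && (Z 0%N w < M * n%:R)
        then (Z 0%N w / n%:R) `^ alpha else 0)))%:E <=
     (1 + C * expR (- (kappa * q n%:R)))%:E)%E].
Proof.
move=> delta0 /andP[t0 t1].
(* [theta < th1 < t2 < 1]: the first gap pays for the factor [1 - eta] of the uniform comparison,
   the second produces [kappa]. *)
pose t2 := (1 + theta) / 2; pose th1 := (theta + t2) / 2.
have t201 : 0 < t2 < 1 by rewrite /t2; apply/andP; split; lra.
have th10 : 0 < th1 by rewrite /th1 /t2; lra.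
have k0 : 0 < t2 - th1 by rewrite /th1 /t2; lra.
pose eta := 1 - theta / th1.
have thth1 : theta / th1 < 1 by rewrite ltr_pdivrMr// mul1r /th1 /t2; lra.
have eta01 : 0 < eta < 1.
  have : 0 < theta / th1 by rewrite divr_gt0.
  by rewrite /eta; move=> ?; apply/andP; split; lra.
have thE : (1 - eta) * th1 = theta by rewrite /eta opprB addrC subrK divfK// gt_eqF.
have [G [iG ZG]] := exp_moment qH (Z_ge0 0%N) Z_tail t201.
have G0 w : (0 <= G w)%E.
  by apply: le_trans (ZG w); rewrite lee_fin mulr_ge0// expR_ge0.
pose C := fine (\int[P]_w G w)%E.
have CE : (\int[P]_w G w = C%:E)%E by rewrite fineK// integrable_fin_num.
have C0 : 0 <= C by rewrite fine_ge0// integral_ge0.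
pose kappa := (t2 - th1) * (delta `^ alpha / 2).
have da : 0 < delta `^ alpha by rewrite powR_gt0.
exists kappa, C; split => //; first by rewrite mulr_gt0// divr_gt0.
near=> n.
have n0 : (0 : R) < n%:R by rewrite ltr0n; near: n; exact: nbhs_infty_gt.
have dn1 : 1 <= delta * n%:R.
  by rewrite -ler_pdivrMl// mulr1; near: n; exact: nbhs_infty_ger.
have qd : delta `^ alpha / 2 * q n%:R <= q (delta * n%:R).
  have : (delta `^ alpha - delta `^ alpha / 2) * q n%:R <= q (delta * n%:R) <=
      (delta `^ alpha + delta `^ alpha / 2) * q n%:R.
    by near: n; apply: near_ratio_nat qH _ _ _ _ => //; rewrite divr_gt0.
  by move=> /andP[H _]; apply: le_trans H; rewrite ler_wpM2r ?q_ge0//; lra.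
have qz z : delta * n%:R <= z <= M * n%:R ->
    (1 - eta) * (z / n%:R) `^ alpha * q n%:R <= q z.
  by move: z; near: n; exact: near_q_lower qH _ _ _ _ _.
pose k := expR (- (kappa * q n%:R)).
have mZ : measurable_fun setT (Z 0%N : T -> R) by [].
apply: (@le_trans _ _ (\int[P]_w ((1 : R)%:E + k%:E * G w))%E); last first.
  rewrite integralD//.
  - rewrite (integral_cst P measurableT 1%E) mul1e integralZl// CE -EFinM.
    by rewrite [X in (X + _)%E]probability_setT -EFinD lee_fin mulrC.
  - exact: finite_measure_integrable_cst.
  - exact: integrableZl.
apply: ge0_le_integral => //.
- apply/measurable_EFinP; apply: measurableT_comp => //; apply: measurable_funM => //.
  apply: measurable_fun_if => //.
  + apply: measurable_and; first exact: measurable_fun_ltr.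
    exact: measurable_fun_ltr.
  + apply: measurable_funTS; apply: (measurableT_comp (measurable_powR _)).
    exact: measurable_funM.
- apply: emeasurable_funD => //; apply: measurable_funeM.
  exact: measurable_int iG.
- move=> w _; have kG : (0 <= k%:E * G w)%E by rewrite mule_ge0// lee_fin expR_ge0.
  case: ifPn => [/andP[z1 z2]|_]; last by rewrite mulr0 expR0 leeDl.
  set z := Z 0%N w in z1 z2 *.
  have z1' : 1 <= z by rewrite (le_trans dn1)// ltW.
  have zp : 0 < z by lra.
  apply: (@le_trans _ _ (k%:E * G w)%E); last by rewrite leeDr// lee_fin.
  apply: (@le_trans _ _ (k%:E * (z * expR (t2 * q z))%:E)%E); last first.
    by apply: lee_wpmul2l; [rewrite lee_fin expR_ge0|exact: ZG].
  rewrite -EFinM lee_fin mulrCA; apply: (@le_trans _ _ (k * expR (t2 * q z))); last first.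
    by rewrite ler_peMl// mulr_ge0 ?expR_ge0.
  rewrite /k -expRD ler_expR.
  have H1 : (1 - eta) * (z / n%:R) `^ alpha * q n%:R <= q z by apply: qz; rewrite !ltW.
  have H2 : theta * q n%:R * (z / n%:R) `^ alpha <= th1 * q z.
    rewrite -thE; have := ler_wpM2l (ltW th10) H1; lra.
  apply: (le_trans H2).
  have H3 : q (delta * n%:R) <= q z by rewrite q_nd ?(lt_le_trans ltr01)// ltW.
  have := ler_wpM2l (ltW k0) (le_trans qd H3).
  rewrite /kappa; move: (delta `^ alpha) (q n%:R) (q z) => a b e; lra.
Unshelve. all: by end_near.
Qed.

Lemma large_jump_sum_le (delta c c' : R) : 0 < delta -> 0 < c' < c ->
  \forall n \near \oo,
    (P [set w | (c <= \sum_(1 <= i < n.+1)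
       ((Z i w - clip (delta * n%:R) (Z i w)) / n%:R) `^ alpha)%R] <=
     (2 * expR (- (c' * q n%:R)))%:E)%E.
Proof.
move=> delta0 /andP[c'0 cc]; have c0 : 0 < c by exact: lt_trans cc.
pose M := c `^ alpha^-1; have M0 : 0 < M by rewrite powR_gt0.
have ME : M `^ alpha = c by rewrite /M -powRrM mulVf ?gt_eqF// powRr1// ltW.
(* Room on both sides: [c1 < c] for the errors in the exponents, [c' < c1] for the factors of order
   [n]. *)
pose c1 := (c' + c) / 2.
have [c1c' c1c] : c' < c1 /\ c1 < c by rewrite /c1; split; lra.
pose theta := c1 / c.
have theta01 : 0 < theta < 1.
  by rewrite divr_gt0 ?ltr_pdivrMr ?mul1r//; lra.
have thc : theta * c = c1 by rewrite divfK// gt_eqF.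
have [kappa [C [kappa0 C0 HC]]] := large_jump_mgf M delta0 theta01.
have gap : 0 < c - c1 by lra.
near=> n.
have n0 : (0 : R) < n%:R by rewrite ltr0n; near: n; exact: nbhs_infty_gt.
have n1 : (1 : R) <= n%:R by rewrite ler1n -(ltr0n R).
have qn0 : 0 <= q n%:R by exact: q_ge0.
have Hn : (\int[P]_w (expR (theta * q n%:R *
       (if (delta * n%:R < Z 0%N w) && (Z 0%N w < M * n%:R)
        then (Z 0%N w / n%:R) `^ alpha else 0)))%:E <=
    (1 + C * expR (- (kappa * q n%:R)))%:E)%E.
  by near: n; exact: HC.
pose Y (z : R) := if (delta * n%:R < z) && (z < M * n%:R) then (z / n%:R) `^ alpha else 0.
pose f (z : R) := theta * q n%:R * Y z.
have mY : measurable_fun setT Y.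
  apply: measurable_fun_if => //.
    by apply: measurable_and; exact: measurable_fun_ltr.
  apply: measurable_funTS; apply: (measurableT_comp (measurable_powR _)).
  exact: measurable_funM.
have mf : measurable_fun setT f by apply: measurable_funM.
have := @chernoff _ _ _ _ _ Z_indep Z_ident (index_iota 1 n.+1) [::] f (fun=> setT)
  (theta * q n%:R * c) _ _ mf (fun=> measurableT) Hn.
rewrite cats0 iota_uniq big_nil mule1 => /(_ isT) Hch.
set E1 := [set w | _] in Hch.
have b1 : (P E1 <= (expR (- (c' * q n%:R)))%:E)%E.
  apply: (le_trans Hch); rewrite lee_fin.
  (* The product of [n] factors 1 + C exp(- kappa q(n)) stays below [expR 1], since C n exp(- kappa
     q(n)) is eventually at most 1. *)
  apply: (@le_trans _ _ (expR (- (theta * q n%:R * c)) * expR 1)).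
    rewrite ler_wpM2l ?expR_ge0//.
    apply: (@le_trans _ _ (expR (C * expR (- (kappa * q n%:R))) ^+ n)).
      rewrite size_iota subn1 lerXn2r ?nnegrE ?expR_ge0 ?expR_ge1Dx//.
      by rewrite addr_ge0// mulr_ge0// expR_ge0.
    rewrite -expRM_natl ler_expR.
    have : (C + 1) * n%:R * expR (- (kappa * q n%:R)) <= expR (- (0 * q n%:R)).
      by near: n; apply: near_absorb qH _ _ _ _ _; rewrite // ltr_wpDl.
    rewrite mul0r oppr0 expR0; apply: le_trans.
    rewrite mulrCA mulrA ler_wpM2r ?expR_ge0// ler_wpM2r ?(ltW n0)//; lra.
  have : expR 1 * n%:R * expR (- (c1 * q n%:R)) <= expR (- (c' * q n%:R)).
    by near: n; apply: near_absorb qH _ _ _ _ _; rewrite // expR_gt0.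
  apply: le_trans; rewrite mulrAC thc mulrC.
  by rewrite ler_wpM2r ?expR_ge0// ler_peMr// expR_ge0.
pose E2 := \bigcup_(i in [set` index_iota 1 n.+1]) (Z i @^-1` `[M * n%:R, +oo[).
have mE2i i : measurable (Z i @^-1` `[M * n%:R, +oo[) by exact: preimage_RV_measurable.
have b2 : (P E2 <= (expR (- (c' * q n%:R)))%:E)%E.
  have Mn : 0 < M * n%:R by rewrite mulr_gt0.
  apply: (le_trans (union_bound (b := expR (- q (M * n%:R))) _ mE2i _)).
  - exact: expR_ge0.
  - by move=> i _; rewrite tail_ident.
  rewrite size_iota subn1 lee_fin.
  have : (M `^ alpha - (c - c1)) * q n%:R <= q (M * n%:R) <=
      (M `^ alpha + (c - c1)) * q n%:R.
    by near: n; apply: near_ratio_nat qH _ _ _ _.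
  rewrite ME opprB addrC subrK => /andP[H _].
  have : 1 * n%:R * expR (- (c1 * q n%:R)) <= expR (- (c' * q n%:R)).
    by near: n; apply: near_absorb qH _ _ _ _ _.
  by rewrite mul1r; apply: le_trans; rewrite ler_wpM2l ?(ltW n0)// ler_expR lerN2.
have mE1 : measurable E1.
  rewrite (_ : E1 = (fun w => \sum_(i <- index_iota 1 n.+1) f (Z i w)) @^-1`
      `[theta * q n%:R * c, +oo[).
    rewrite -[X in measurable X]setTI; apply: measurable_sum => // i.
    exact: measurableT_comp.
  apply/seteqP; split => w /=; rewrite in_itv/= andbT; first by case.
  by move=> ?; split.
have mE2 : measurable E2 by apply: fin_bigcup_measurable => //; exact: finite_seq.
have mclip i : measurable_fun setT (fun w => clip (delta * n%:R) (Z i w)).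
  by apply: measurableT_comp => //; exact: measurable_clip.
rewrite mulr_natl mulr2n EFinD; apply: le_trans (leeD b1 b2).
apply: le_trans (measureU2 _ mE1 mE2); apply: le_measure; rewrite ?inE.
- rewrite (_ : [set w | _] = (fun w => \sum_(1 <= i < n.+1)
      ((Z i w - clip (delta * n%:R) (Z i w)) / n%:R) `^ alpha) @^-1` `[c, +oo[).
    rewrite -[X in measurable X]setTI; apply: measurable_sum => // i.
    apply: (measurableT_comp (measurable_powR _)); apply: measurable_funM => //.
    exact: measurable_funB.
  by apply/seteqP; split => w /=; rewrite in_itv/= andbT.
- exact: measurableU.
move=> w /= cw; have [[i iI iM]|H] := pselect (exists2 i, i \in index_iota 1 n.+1 & M * n%:R <= Z i w).
  by right; exists i => //=; rewrite in_itv/= iM.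
have tq : 0 <= theta * q n%:R by rewrite mulr_ge0// ltW//; case/andP: theta01.
left; split => //; rewrite -mulr_sumr; apply: (ler_wpM2l tq).
apply: (le_trans cw); rewrite !big_seq; apply: ler_sum => i iI.
have iM : Z i w < M * n%:R by rewrite ltNge; apply/negP => ?; apply: H; exists i.
rewrite clipE /Y iM andbT ltNge; case: (Z i w <= _) => /=; last by rewrite subr0.
by rewrite subrr mul0r powR0 ?gt_eqF.
Unshelve. all: by end_near.
Qed.

End deviations.

Lemma near_forall_lt (N : nat) (Q : nat -> nat -> Prop) :
  (forall i, (i < N)%N -> \forall n \near \oo, Q i n) ->
  \forall n \near \oo, forall i, (i < N)%N -> Q i n.
Proof.
elim: N => [|N IH] H; first by near=> n.
have H1 := IH (fun i iN => H i (ltnW iN)); have H2 := H N (ltnSn N).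
near=> n => i; rewrite ltnS leq_eqVlt => /orP[/eqP ->|]; first by near: n.
by move: i; near: n.
Unshelve. all: by end_near.
Qed.

Lemma lee_prod_seq (R : realType) (s : seq nat) (f g : nat -> \bar R) :
  {in s, forall i, (0 <= f i)%E /\ (f i <= g i)%E} ->
  (\prod_(i <- s) f i <= \prod_(i <- s) g i)%E.
Proof.
elim: s => [|i s IH] H; first by rewrite !big_nil.
have [f0 fg] := H i (mem_head _ _).
have Hs : {in s, forall i, (0 <= f i)%E /\ (f i <= g i)%E}.
  by move=> j js; apply: H; rewrite inE js orbT.
rewrite !big_cons lee_pmul//; last exact: IH.
by rewrite big_seq prode_ge0// => j /Hs [].
Qed.

(** * Probability estimates *)

Section bounds.
Context (R : realType) (d : measure_display) (T : measurableType d).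
Variables (P : probability T R) (Z : nat -> {RV P >-> R}) (alpha : R) (q : R -> R).
Hypothesis qH : weibull_exponent alpha q.
Hypothesis Z_indep : independent_RVs P Z.
Hypothesis Z_ident : forall (i : nat) (A : set R), measurable A ->
  distribution P (Z i) A = distribution P (Z 0%N) A.
Hypothesis Z_ge0 : forall i w, 0 <= Z i w.
Hypothesis Z_tail : forall x : R, 0 < x ->
  P [set w | x <= Z 0%N w] = (expR (- q x))%:E.

Let alpha0 : 0 < alpha. Proof. by case/andP: (exponent_itv qH). Qed.
Let q_nd := exponent_nd qH.
Let q_ge0 := exponent_ge0 qH.
Let m := mean (Z 0%N).

Definition walk (n : nat) (w : T) : cadlag R := sum_cadlag n (fun i => Z i w - m).

Lemma sum_RV_measurable (s : seq nat) (f : nat -> R -> R) (b : R) :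
  (forall i, measurable_fun setT (f i)) ->
  measurable [set w | b <= \sum_(i <- s) f i (Z i w)].
Proof.
move=> mf; rewrite (_ : [set w | _] =
  (fun w => \sum_(i <- s) f i (Z i w)) @^-1` `[b, +oo[).
  rewrite -[X in measurable X]setTI; apply: measurable_sum => // i.
  exact: measurableT_comp.
by apply/seteqP; split => w /=; rewrite in_itv/= andbT.
Qed.

(** Instead of covering the sublevel set of the rate, the proof tests the path formed by the large
    jumps of [w] itself as [zeta]: either its rate exceeds [c], or some centred truncated partial
    sum is large. *)
Lemma upper_bound (c c' eps : R) : 0 < c' < c -> 0 < eps ->
  \forall n \near \oo, forall D : set T, measurable D ->
    (forall w, D w -> forall zeta : cadlag R,
       (weibull_rate alpha zeta <= c%:E)%E -> eps < J1_dist (walk n w) zeta) ->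
    (P D <= (expR (- (c' * q n%:R)))%:E)%E.
Proof.
move=> /andP[c'0 cc] eps0; pose c1 := (c' + c) / 2.
have [c1c' c1c] : c' < c1 /\ c1 < c by rewrite /c1; split; lra.
have c10 : 0 < c1 by lra.
have [delta delta0 HF] := clip_sum_le qH Z_indep Z_ident Z_ge0 Z_tail eps0 c10.
have c1c0 : 0 < c1 < c by rewrite c10.
have HJ := large_jump_sum_le qH Z_indep Z_ident Z_ge0 Z_tail delta0 c1c0.
near=> n => D mD HD.
have n0 : (0 < n)%N by near: n; exact: nbhs_infty_gt.
have n1 : (1 : R) <= n%:R by rewrite ler1n.
have np : (0 : R) < n%:R by rewrite ltr0n.
have bE' : (P [set w | (c <= \sum_(1 <= i < n.+1)
       ((Z i w - clip (delta * n%:R) (Z i w)) / n%:R) `^ alpha)%R] <=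
     (2 * expR (- (c1 * q n%:R)))%:E)%E by near: n; exact: HJ.
pose cl (z : R) := clip (delta * n%:R) z.
have mcl : measurable_fun setT cl by exact: measurable_clip.
pose E := [set w | c <= \sum_(1 <= i < n.+1) ((Z i w - cl (Z i w)) / n%:R) `^ alpha].
have bE : (P E <= (2 * expR (- (c1 * q n%:R)))%:E)%E by exact: bE'.
pose F (sigma : R) (j : nat) :=
  [set w | eps * n%:R <= \sum_(i <- index_iota 1 j.+1) sigma * (cl (Z i w) - m)].
have mF sigma j : measurable (F sigma j).
  apply: (@sum_RV_measurable _ (fun=> fun z => sigma * (cl z - m))) => i.
  by apply: measurable_funM => //; exact: measurable_funB.
have mE : measurable E.
  apply: (@sum_RV_measurable _ (fun=> fun z => ((z - cl z) / n%:R) `^ alpha)) => i.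
  apply: (measurableT_comp (measurable_powR _)); apply: measurable_funM => //.
  exact: measurable_funB.
have bF sigma j : sigma = 1 \/ sigma = -1 -> (j <= n)%N ->
    (P (F sigma j) <= (expR (- (c1 * q n%:R)))%:E)%E.
  move=> sE jn.
  have : forall (sigma : R) (s K : seq nat) (A : nat -> set R),
    sigma = 1 \/ sigma = -1 -> uniq (s ++ K) -> (size s <= n)%N ->
    (forall i, measurable (A i)) ->
    (P [set w | {in K, forall i, A i (Z i w)} /\
       (eps * n%:R <= \sum_(i <- s) sigma * (clip (delta * n%:R) (Z i w) - m))%R] <=
     (expR (- (c1 * q n%:R)))%:E * \prod_(i <- K) P (Z i @^-1` A i))%E.
    by near: n; exact: HF.
  move=> /(_ sigma (index_iota 1 j.+1) [::] (fun=> setT) sE).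
  rewrite cats0 iota_uniq size_iota subn1 big_nil mule1 => /(_ isT jn).
  move=> /(_ (fun=> measurableT)); apply: le_trans.
  rewrite le_eqVlt; apply/orP; left; apply/eqP; congr (P _).
  by apply/seteqP; split => w /=; [move=> ?; split|case].
pose U (sigma : R) := \bigcup_(j in [set` iota 0 n.+1]) F sigma j.
have mU sigma : measurable (U sigma).
  by apply: fin_bigcup_measurable => //; exact: finite_seq.
have bU sigma : sigma = 1 \/ sigma = -1 ->
    (P (U sigma) <= (n.+1%:R * expR (- (c1 * q n%:R)))%:E)%E.
  move=> sE; have := @union_bound _ _ _ P (iota 0 n.+1) (F sigma)
    (expR (- (c1 * q n%:R))) (expR_ge0 _) (mF sigma).
  rewrite size_iota; apply => j; rewrite mem_iota add0n ltnS => /andP[_ jn].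
  exact: bF.
have sub : D `<=` E `|` (U 1 `|` U (-1)).
  move=> w Dw; apply: contrapT => /not_orP[nE /not_orP[nU nV]].
  have y0 i : 0 <= Z i w - cl (Z i w).
    by rewrite /cl clipE; case: ifP => _; rewrite ?subrr ?subr0.
  have r1 : (weibull_rate alpha (sum_cadlag n (fun i => (Z i w - cl (Z i w))%R)) <= c%:E)%E.
    apply: (le_trans (weibull_rate_sum_path alpha0 n0 y0)).
    by rewrite lee_fin ltW// ltNge; apply/negP.
  have := HD w Dw _ r1; rewrite ltNge => /negP; apply.
  apply: J1_dist_sum_cadlag; first exact: ltW.
  move=> j jn.
  (* The mean stays with the truncated variables, so that the jump path has no drift. *)
  have -> : \sum_(1 <= i < j.+1) (Z i w - m - (Z i w - cl (Z i w))) =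
      \sum_(1 <= i < j.+1) (cl (Z i w) - m).
    by apply: eq_bigr => i _; lra.
  have jI : j \in iota 0 n.+1 by rewrite mem_iota add0n ltnS.
  have H1 : \sum_(1 <= i < j.+1) (cl (Z i w) - m) < eps * n%:R.
    rewrite ltNge; apply/negP => H; apply: nU; exists j => //.
    by rewrite /F /=; under eq_bigr do rewrite mul1r.
  have H2 : - \sum_(1 <= i < j.+1) (cl (Z i w) - m) < eps * n%:R.
    rewrite ltNge; apply/negP => H; apply: nV; exists j => //.
    by rewrite /F /=; under eq_bigr do rewrite mulN1r; rewrite sumrN.
  by rewrite ler_norml; apply/andP; split; lra.
have mUU : measurable (U 1 `|` U (-1)) by exact: measurableU.
apply: (@le_trans _ _ (P (E `|` (U 1 `|` U (-1))))).
  by apply: le_measure; rewrite ?inE//; exact: measurableU.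
apply: (le_trans (measureU2 _ mE mUU)).
apply: (le_trans (leeD (lexx _) (measureU2 _ (mU 1) (mU (-1))))).
apply: (le_trans (leeD bE (leeD (bU 1 (or_introl erefl)) (bU (-1) (or_intror erefl))))).
rewrite -!EFinD lee_fin.
(* There are [2 + 2 * n.+1] exponentials in all, at most [6 * n] as [n >= 1]. *)
have : 6 * n%:R * expR (- (c1 * q n%:R)) <= expR (- (c' * q n%:R)).
  by near: n; exact: near_absorb qH _ _ _ _ _.
apply: le_trans; rewrite -!mulrDl ler_wpM2r ?expR_ge0//.
by rewrite -[n.+1%:R]natr1; lra.
Unshelve. all: by end_near.
Qed.

(** The tail at [x + eta] is at most half of the lower bound for the tail at [x], because (x +
    eta)^alpha exceeds x^alpha strictly and q(n) is unbounded. *)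
Lemma window_prob (x e eta : R) (i : nat) : 0 <= x -> 0 < e -> 0 < eta ->
  \forall n \near \oo,
    ((2^-1 * expR (- ((x `^ alpha + e) * q n%:R)))%:E <=
     P (Z i @^-1` `[(x * n%:R)%R, ((x + eta) * n%:R)%R[))%E.
Proof.
move=> x0 e0 eta0; have xe0 : 0 < x + eta by lra.
pose gap := (x + eta) `^ alpha - x `^ alpha.
have gap0 : 0 < gap.
  by rewrite subr_gt0; apply: gt0_ltr_powR; rewrite ?nnegrE//; lra.
(* Two errors [h] leave at least a third of [gap], which q(n) turns into at least [ln 2]. *)
pose h := Num.min e (gap / 3).
have h0 : 0 < h by rewrite lt_min e0 divr_gt0.
have [he hg] : h <= e /\ h <= gap / 3 by rewrite /h; split; rewrite ge_min lexx ?orbT.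
have Hx : \forall n \near \oo, 0 < x -> q (x * n%:R) <= (x `^ alpha + h) * q n%:R.
  have [xp|xn] := ltP 0 x; last by near=> n.
  by apply: filterS (near_ratio_nat qH xp h0) => n /andP[].
near=> n.
have n0 : (0 : R) < n%:R by rewrite ltr0n; near: n; exact: nbhs_infty_gt.
have qn : 3 * ln 2 / gap <= q n%:R by near: n; exact: near_pinfty_q qH _.
have qn0 : 0 <= q n%:R by exact: q_ge0.
have ln2 : 0 < ln 2 :> R by rewrite ln_gt0// ltr1n.
have H1 : ((x + eta) `^ alpha - h) * q n%:R <= q ((x + eta) * n%:R).
  have : ((x + eta) `^ alpha - h) * q n%:R <= q ((x + eta) * n%:R) <=
      ((x + eta) `^ alpha + h) * q n%:R.
    by near: n; apply: near_ratio_nat qH _ _ _ _.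
  by case/andP.
rewrite ler_pdivrMr// in qn.
pose A := expR (- ((x `^ alpha + h) * q n%:R)).
have PE : (A%:E <= P (Z i @^-1` `[(x * n%:R)%R, +oo[))%E.
  (* At [x = 0] the tail formula says nothing, but the event is certain. *)
  move: x0; rewrite le_eqVlt => /orP[/eqP x00|xp].
    have -> : x * n%:R = 0 by rewrite -x00 mul0r.
    have -> : Z i @^-1` `[0, +oo[ = setT.
      by apply/seteqP; split => w //= _; rewrite in_itv/= Z_ge0.
    rewrite probability_setT lee_fin /A -[leRHS]expR0 ler_expR oppr_le0 mulr_ge0//.
    by rewrite addr_ge0 ?powR_ge0// ltW.
  rewrite (tail_ident Z_ident Z_tail); last by rewrite mulr_gt0.
  rewrite lee_fin ler_expR lerN2; move: xp; near: n; exact: Hx.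
have P2 : P (Z i @^-1` `[(x + eta) * n%:R, +oo[) = (expR (- q ((x + eta) * n%:R)))%:E.
  by rewrite (tail_ident Z_ident Z_tail)// mulr_gt0.
have half : expR (- q ((x + eta) * n%:R)) <= 2^-1 * A.
  rewrite -[2^-1]lnK ?posrE ?invr_gt0// -expRD ler_expR lnV ?posrE//.
  apply: (@le_trans _ _ (- (((x + eta) `^ alpha - h) * q n%:R))); first by rewrite lerN2.
  have : 3 * ln 2 <= q n%:R * gap := qn.
  have := ler_wpM2r qn0 hg; rewrite /gap.
  move: (q n%:R) ((x + eta) `^ alpha) (x `^ alpha) (ln 2) => a b c l; lra.
have mI (A' : set R) : measurable A' -> measurable (Z i @^-1` A').
  exact: preimage_RV_measurable.
have : (A%:E <= P (Z i @^-1` `[(x * n%:R)%R, ((x + eta) * n%:R)%R[) +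
    (expR (- q ((x + eta) * n%:R)))%:E)%E.
  apply: (le_trans PE); rewrite -P2; apply: le_trans (measureU2 _ (mI _ _) (mI _ _)) => //.
  apply: le_measure; rewrite ?inE; [exact: mI|apply: measurableU; exact: mI|].
  move=> w /=; rewrite !in_itv/= !andbT => xz.
  by have [|] := leP ((x + eta) * n%:R) (Z i w); [right|left; rewrite xz].
rewrite -leeBlDr// -EFinB; apply: le_trans; rewrite lee_fin.
have : expR (- ((x `^ alpha + e) * q n%:R)) <= A.
  by rewrite ler_expR lerN2 ler_wpM2r// lerD2l.
move: half; lra.
Unshelve. all: by end_near.
Qed.

(** The event [G] of prescribed jumps is itself exponentially unlikely, so absolute bounds on the
    bad events need not beat it. They are estimated jointly with [G], which factors out by
    independence, and each family then costs a fraction of [P G]. *)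
Lemma lower_bound (xi : cadlag R) (a c rho : R) :
  (weibull_rate alpha xi <= a%:E)%E -> a < c -> 0 < rho ->
  \forall n \near \oo, forall D : set T, measurable D ->
    (forall w, J1_dist xi (walk n w) < rho -> D w) ->
    ((expR (- (c * q n%:R)))%:E <= P D)%E.
Proof.
move=> /(weibull_rateP _ _ alpha0) [[x [u S]] Sa] ac rho0.
have [x0 u0 uI _] := S.
have [N0 [eta [N1 [eta0 Hk]]]] := jump_series_J1_dist_lt S rho0.
have Sx : \sum_(0 <= i < N0) x i `^ alpha <= a.
  have := Sa (map u (iota 0 N0)); rewrite big_map /index_iota subn0.
  under eq_bigr do rewrite (jump_series_jumpE _ S).
  apply; first by rewrite map_inj_uniq// iota_uniq.
  by move=> _ /mapP[i _ ->].
(* The [N0] windows lose [e] each, at most half of [c - a] in total. *)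
pose e := (c - a) / (2 * N0.+1%:R).
have e0 : 0 < e by rewrite divr_gt0 ?subr_gt0// mulr_gt0.
have eN : N0%:R * e <= (c - a) / 2.
  have H : e * N0%:R <= e * N0.+1%:R by rewrite ler_wpM2l ?ler_nat// ltW.
  have E : e * (2 * N0.+1%:R) = c - a by rewrite divfK// gt_eqF// mulr_gt0.
  move: H E; move: N0.+1%:R N0%:R => N N'; lra.
have rho4 : 0 < rho / 4 by rewrite divr_gt0.
(* Any positive rate would do in place of 1, as the resulting bound is relative to [P G]. *)
have [delta delta0 HF] := clip_sum_le qH Z_indep Z_ident Z_ge0 Z_tail rho4 ltr01.
(* One half of [eta] is the width of the windows, the other absorbs the centring [m / n]. *)
have eta2 : 0 < eta / 2 by rewrite divr_gt0.
have da : 0 < delta `^ alpha by rewrite powR_gt0.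
have Hw : \forall n \near \oo, forall i j, (i < N0)%N ->
    ((2^-1 * expR (- ((x i `^ alpha + e) * q n%:R)))%:E <=
     P (Z j @^-1` `[(x i * n%:R)%R, ((x i + eta / 2) * n%:R)%R[))%E.
  have : \forall n \near \oo, forall i, (i < N0)%N ->
    ((2^-1 * expR (- ((x i `^ alpha + e) * q n%:R)))%:E <=
     P (Z 0%N @^-1` `[(x i * n%:R)%R, ((x i + eta / 2) * n%:R)%R[))%E.
    by apply: near_forall_lt => i _; exact: window_prob.
  apply: filterS => n H i j iN; apply: (le_trans (H i iN)).
  by have := Z_ident j (measurable_itv `[(x i * n%:R)%R, ((x i + eta / 2) * n%:R)%R[); rewrite /distribution /pushforward => ->.
near=> n => D mD HD.
have nN1 : (N1 <= n)%N by near: n; exact: nbhs_infty_ge.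
have n0 : (0 < n)%N by near: n; exact: nbhs_infty_gt.
have np : (0 : R) < n%:R by rewrite ltr0n.
have qn0 : 0 <= q n%:R by exact: q_ge0.
have [k [kn kI Hy]] := Hk n nN1.
pose K := map k (iota 0 N0).
have uK : uniq K by rewrite map_inj_in_uniq ?iota_uniq.
pose B (i : nat) : set R := `[(x i * n%:R)%R, ((x i + eta / 2) * n%:R)%R[%classic.
pose A (j : nat) : set R := B (index j K).
have mA j : measurable (A j) by exact: measurable_itv.
have AE i : (i < N0)%N -> A (k i) = B i.
  move=> iN; rewrite /A; congr B.
  have -> : k i = nth 0%N K i by rewrite (nth_map 0%N) ?size_iota// nth_iota.
  by rewrite index_uniq// size_map size_iota.
pose G := \bigcap_(j in [set` K]) (Z j @^-1` A j).
have mZA j (A' : set R) : measurable A' -> measurable (Z j @^-1` A').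
  exact: preimage_RV_measurable.
have mG : measurable G.
  by apply: fin_bigcap_measurable; [exact: finite_seq|move=> j _; exact: mZA].
have PG : P G = (\prod_(j <- K) P (Z j @^-1` A j))%E by exact: Z_indep.
have mfin (V : set T) : measurable V -> P V \is a fin_num.
  by move=> mV; exact: fin_num_measure.
have lowG : ((2^-1 ^+ N0 * expR (- ((a + (c - a) / 2) * q n%:R)))%:E <= P G)%E.
  apply: (@le_trans _ _ (\prod_(0 <= i < N0)
      (2^-1 * expR (- ((x i `^ alpha + e) * q n%:R))))%:E).
    rewrite lee_fin big_split/= prodr_const_nat subn0 ler_wpM2l ?exprn_ge0//.
    rewrite -expR_sum ler_expR sumrN lerN2 -mulr_suml ler_wpM2r//.
    by rewrite big_split/= lerD// sumr_const_nat subn0 -[e *+ N0]mulr_natl.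
  rewrite PG /K big_map -prodEFin /index_iota subn0.
  apply: lee_prod_seq => i; rewrite mem_iota add0n => /andP[_ iN].
  split; first by rewrite lee_fin mulr_ge0// expR_ge0.
  rewrite AE//.
  have : forall i j, (i < N0)%N ->
    ((2^-1 * expR (- ((x i `^ alpha + e) * q n%:R)))%:E <=
     P (Z j @^-1` `[(x i * n%:R)%R, ((x i + eta / 2) * n%:R)%R[))%E by near: n; exact: Hw.
  by apply.
pose g := fine (P G).
have gE : P G = g%:E by rewrite /g fineK// mfin.
have g0 : 0 <= g by rewrite fine_ge0.
pose s (j : nat) := [seq i <- index_iota 1 j.+1 | i \notin K].
pose F (sigma : R) (j : nat) := G `&` [set w | rho / 4 * n%:R <=
    \sum_(i <- s j) sigma * (clip (delta * n%:R) (Z i w) - m)].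
have mF sigma j : measurable (F sigma j).
  apply: measurableI => //.
  apply: (@sum_RV_measurable _ (fun=> fun z => sigma * (clip (delta * n%:R) z - m))) => i.
  apply: measurable_funM => //; apply: measurable_funB => //; exact: measurable_clip.
have bF sigma j : sigma = 1 \/ sigma = -1 -> (j <= n)%N ->
    (P (F sigma j) <= (expR (- q n%:R) * g)%:E)%E.
  move=> sE jn.
  have : forall (sigma : R) (s K : seq nat) (A : nat -> set R),
    sigma = 1 \/ sigma = -1 -> uniq (s ++ K) -> (size s <= n)%N ->
    (forall i, measurable (A i)) ->
    (P [set w | {in K, forall i, A i (Z i w)} /\
       (rho / 4 * n%:R <= \sum_(i <- s) sigma * (clip (delta * n%:R) (Z i w) - m))%R] <=
     (expR (- (1 * q n%:R)))%:E * \prod_(i <- K) P (Z i @^-1` A i))%E.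
    by near: n; exact: HF.
  move=> /(_ sigma (s j) K A sE); rewrite mul1r -PG gE -EFinM.
  rewrite (_ : [set w | _] = F sigma j); first last.
    by apply/seteqP; split => w [H1 H2]; split => //.
  apply => //.
    rewrite cat_uniq uK filter_uniq ?iota_uniq// andbT/=.
    by apply/hasPn => i iK; rewrite mem_filter iK.
  by rewrite size_filter (leq_trans (count_size _ _))// size_iota subn1.
(* The indices in [K] are excluded: [G] already prescribes their variables, which may well be
   large. *)
pose H (j : nat) := if j \in K then set0 else
  G `&` (Z j @^-1` `[delta * n%:R, +oo[).
have mH j : measurable (H j).
  by rewrite /H; case: ifP => // _; apply: measurableI => //; exact: mZA.
have dn0 : 0 < delta * n%:R by rewrite mulr_gt0.
have bH j : (P (H j) <= (expR (- q (delta * n%:R)) * g)%:E)%E.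
  rewrite /H; case: ifPn => jK.
    by rewrite measure0 lee_fin mulr_ge0// expR_ge0.
  pose A' i := if i == j then `[delta * n%:R, +oo[%classic else A i.
  have := Z_indep (J := j :: K) (A := A'); rewrite /= jK uK.
  rewrite (_ : \bigcap_(i in _) _ = G `&` (Z j @^-1` `[delta * n%:R, +oo[)); last first.
    apply/seteqP; split => w.
      move=> H'; split.
        move=> i iK; have ij : i == j = false by apply: contraNF jK => /eqP <-.
        have jiK : [set` j :: K] i by rewrite /= inE; apply/orP; right.
        by have := H' i jiK; rewrite /A' ij.
      have jjK : [set` j :: K] j by rewrite /= mem_head.
      by have := H' j jjK; rewrite /A' eqxx.
    move=> [Gw jw] i /=; rewrite in_cons /A'; case: eqP => [->//|_] /= iK.
    exact: Gw.
  move=> -> //; last by move=> i; rewrite /A'; case: ifP.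
  rewrite big_cons /A' eqxx (tail_ident Z_ident Z_tail)// EFinM -gE PG.
  rewrite lee_wpmul2l ?lee_fin ?expR_ge0// !big_seq le_eqVlt; apply/orP; left.
  apply/eqP; apply: eq_bigr => i iK.
  by have -> : i == j = false by apply: contraNF jK => /eqP <-.
pose FU sigma := \bigcup_(j in [set` iota 0 n.+1]) F sigma j.
pose HU := \bigcup_(j in [set` iota 0 n.+1]) H j.
have mFU sigma : measurable (FU sigma).
  by apply: fin_bigcup_measurable => //; exact: finite_seq.
have mHU : measurable HU by apply: fin_bigcup_measurable => //; exact: finite_seq.
have bFU sigma : sigma = 1 \/ sigma = -1 ->
    (P (FU sigma) <= (n.+1%:R * (expR (- q n%:R) * g))%:E)%E.
  move=> sE; have := @union_bound _ _ _ P (iota 0 n.+1) (F sigma)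
    (expR (- q n%:R) * g) (mulr_ge0 (expR_ge0 _) g0) (mF sigma).
  rewrite size_iota; apply => j; rewrite mem_iota add0n ltnS => /andP[_ jn].
  exact: bF.
have bHU : (P HU <= (n.+1%:R * (expR (- q (delta * n%:R)) * g))%:E)%E.
  have := @union_bound _ _ _ P (iota 0 n.+1) H
    (expR (- q (delta * n%:R)) * g) (mulr_ge0 (expR_ge0 _) g0) mH.
  by rewrite size_iota; apply => j _; exact: bH.
have m0 : 0 <= m by rewrite /m /mean fine_ge0// expectation_ge0.
have mn : m <= eta / 2 * n%:R.
  by rewrite -ler_pdivrMl//; near: n; exact: nbhs_infty_ger.
have sub : G `<=` D `|` (HU `|` (FU 1 `|` FU (-1))).
  move=> w Gw; apply: contrapT => /not_orP[nD /not_orP[nH /not_orP[nF1 nF2]]].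
  apply: nD; apply: HD; apply: Hy.
    move=> i iN; have kiK : k i \in K by apply: map_f; rewrite mem_iota.
    have := Gw (k i) kiK; rewrite AE// /B /= in_itv/= => /andP[b1 b2].
    rewrite ler_norml; apply/andP; split.
      by rewrite lerBrDr ler_pdivlMr//; lra.
    by rewrite lerBlDr ler_pdivrMr//; lra.
  move=> j jn.
  have jI : j \in iota 0 n.+1 by rewrite mem_iota add0n ltnS.
  have clE i : i \in s j -> clip (delta * n%:R) (Z i w) = Z i w.
    rewrite mem_filter mem_index_iota ltnS => /andP[iK /andP[_ ij]].
    rewrite clipE ifT// leNgt; apply/negP => di; apply: nH; exists i.
      by have iI : i \in iota 0 n.+1; rewrite ?mem_iota ?add0n ?ltnS ?(leq_trans ij).
    by rewrite /H (negPf iK); split => //=; rewrite in_itv/= (ltW di).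
  have E sigma : \sum_(i <- s j) sigma * (clip (delta * n%:R) (Z i w) - m) =
      sigma * \sum_(1 <= i < j.+1 | i \notin K) (Z i w - m).
    rewrite mulr_sumr -[RHS]big_filter; apply: eq_big_seq => i iS.
    by rewrite clE.
  have H1 : \sum_(1 <= i < j.+1 | i \notin K) (Z i w - m) < rho / 4 * n%:R.
    rewrite ltNge; apply/negP => H1; apply: nF1; exists j => //.
    by split => //=; rewrite E mul1r.
  have H2 : - \sum_(1 <= i < j.+1 | i \notin K) (Z i w - m) < rho / 4 * n%:R.
    rewrite ltNge; apply/negP => H2; apply: nF2; exists j => //.
    by split => //=; rewrite E mulN1r.
  rewrite ler_norml lerNl; apply/andP.
  by split; [exact: (ltW H2)|exact: (ltW H1)].
have mFF : measurable (FU 1 `|` FU (-1)) by exact: measurableU.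
have mHF : measurable (HU `|` (FU 1 `|` FU (-1))) by exact: measurableU.
have tot : (P G <= P D + ((n.+1%:R * (expR (- q (delta * n%:R)) * g))%:E +
    ((n.+1%:R * (expR (- q n%:R) * g))%:E + (n.+1%:R * (expR (- q n%:R) * g))%:E)))%E.
  apply: (@le_trans _ _ (P (D `|` (HU `|` (FU 1 `|` FU (-1)))))).
    by apply: le_measure; rewrite ?inE//; exact: measurableU.
  apply: (le_trans (measureU2 _ mD mHF)); apply: leeD => //.
  apply: (le_trans (measureU2 _ mHU mFF)); apply: leeD => //.
  apply: (le_trans (measureU2 _ (mFU _) (mFU _))); apply: leeD; apply: bFU;
    by [left|right].
pose p := fine (P D); have pE : P D = p%:E by rewrite /p fineK// mfin.
rewrite gE in tot lowG; rewrite pE in tot *; rewrite -!EFinD lee_fin in tot.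
rewrite lee_fin in lowG; rewrite lee_fin.
(* Each of the three families takes at most [g / 8], which leaves more than [g / 2] to [D]. *)
have small1 : n.+1%:R * expR (- q n%:R) <= 8^-1.
  have : 16 * n%:R * expR (- (1 * q n%:R)) <= expR (- (0 * q n%:R)).
    by near: n; exact: near_absorb qH _ _ _ _ _.
  rewrite mul0r oppr0 expR0 mul1r -[n.+1%:R]natr1.
  have : (1 : R) <= n%:R by rewrite ler1n.
  have := expR_gt0 (- q n%:R); move: n%:R (expR _) => N E; nra.
have small2 : n.+1%:R * expR (- q (delta * n%:R)) <= 8^-1.
  have : 16 * n%:R * expR (- (delta `^ alpha / 2 * q n%:R)) <= expR (- (0 * q n%:R)).
    by near: n; apply: near_absorb qH _ _ _ _ _ => //; rewrite divr_gt0.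
  have : (delta `^ alpha - delta `^ alpha / 2) * q n%:R <= q (delta * n%:R) <=
      (delta `^ alpha + delta `^ alpha / 2) * q n%:R.
    by near: n; apply: near_ratio_nat qH _ _ _ _ => //; rewrite divr_gt0.
  move=> /andP[qd _].
  have : expR (- q (delta * n%:R)) <= expR (- (delta `^ alpha / 2 * q n%:R)).
    by rewrite ler_expR lerN2; apply: le_trans qd; rewrite ler_wpM2r//; lra.
  rewrite mul0r oppr0 expR0 -[n.+1%:R]natr1.
  have : (1 : R) <= n%:R by rewrite ler1n.
  have := expR_gt0 (- q (delta * n%:R)).
  move: n%:R (expR _) (expR (- q (delta * n%:R))) => N E' E; nra.
have gp : g / 2 <= p.
  have t1 := ler_wpM2r g0 small1; have t2 := ler_wpM2r g0 small2.
  move: tot t1 t2; rewrite !mulrA; move: (_ * g) (_ * g) => X Y; lra.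
(* The power [2 ^+ N0] comes from the windows and the last factor 2 from [g / 2]; the factor [n] is
   at least 1. *)
have : 2 ^+ N0.+1 * n%:R * expR (- (c * q n%:R)) <= expR (- ((a + (c - a) / 2) * q n%:R)).
  by near: n; apply: near_absorb qH _ _ _ _ _; rewrite ?exprn_gt0//; lra.
rewrite exprVn ler_pdivrMl ?exprn_gt0// in lowG; rewrite exprS => fin.
have U0 : (0 : R) < 2 ^+ N0 by rewrite exprn_gt0.
have n1 : (1 : R) <= n%:R by rewrite ler1n.
apply: le_trans gp; rewrite -(ler_pM2l U0).
have {lowG} := le_trans fin lowG.
have : 2 * 2 ^+ N0 * 1 * expR (- (c * q n%:R)) <=
    2 * 2 ^+ N0 * n%:R * expR (- (c * q n%:R)).
  by rewrite ler_wpM2r ?expR_ge0// ler_wpM2l// mulr_ge0// ltW.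
move: n%:R (2 ^+ N0 : R) (expR _) => W Y X; lra.
Unshelve. all: by end_near.
Qed.

End bounds.

(** * Limits on the logarithmic scale *)

Section limits.
Context (R : realType).

Lemma limn_esup_le_near (u : nat -> \bar R) (l : \bar R) :
  (\forall n \near \oo, (u n <= l)%E) -> (limn_esup u <= l)%E.
Proof.
move=> H; rewrite /limn_esup limf_esupE; apply: le_trans (_ : _ <= ereal_sup (u @` [set n | (u n <= l)%E]))%E _.
  by apply: ereal_inf_lbound; exists [set n | (u n <= l)%E].
by apply: ge_ereal_sup => _ [n un <-].
Qed.

Lemma limn_einf_ge_near (u : nat -> \bar R) (l : \bar R) :
  (\forall n \near \oo, (l <= u n)%E) -> (l <= limn_einf u)%E.
Proof.
move=> H; rewrite /limn_einf leeNr; apply: limn_esup_le_near.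
by apply: filterS H => n; rewrite leeN2.
Qed.

Lemma lne_le_mul (p : \bar R) (a c : R) : 0 < a -> (0 <= p)%E ->
  (p <= (expR (- (c * a)))%:E)%E -> (lne p / a%:E <= (- c)%:E)%E.
Proof.
move=> a0; case: p => [r|//|//]; rewrite lee_fin => r0; rewrite lee_fin => rc.
have ai : (a%:E^-1 = (a^-1)%:E)%E by rewrite inver gt_eqF.
move: r0; rewrite le_eqVlt => /orP[/eqP <-|r0].
  by rewrite le0_lneNy// ai gt0_mulNye ?leNye// lte_fin invr_gt0.
rewrite lne_EFin// ai -EFinM lee_fin ler_pdivrMr// mulNr.
by rewrite -[leRHS]expRK ler_ln ?posrE ?expR_gt0.
Qed.

Lemma lne_ge_mul (p : \bar R) (a c : R) : 0 < a -> p \is a fin_num ->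
  ((expR (- (c * a)))%:E <= p)%E -> ((- c)%:E <= lne p / a%:E)%E.
Proof.
move=> a0; case: p => [r| |]// _; rewrite lee_fin => rc.
have r0 : 0 < r by apply: lt_le_trans rc; exact: expR_gt0.
have ai : (a%:E^-1 = (a^-1)%:E)%E by rewrite inver gt_eqF.
rewrite lne_EFin// ai -EFinM lee_fin ler_pdivlMr// mulNr.
by rewrite -[leLHS]expRK ler_ln ?posrE ?expR_gt0.
Qed.

End limits.

(** * Borel measurability of the walk *)

Section measurability.
Context (R : realType) (d : measure_display) (T : measurableType d).
Variables (Z : nat -> T -> R) (m : R).
Hypothesis mZ : forall i, measurable_fun setT (Z i).

Let W n w : cadlag R := sum_cadlag n (fun i => Z i w - m).

(** The walk is 1-Lipschitz in finitely many variables for the sup norm: at most [n] errors [e] are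
    divided by [n]. *)
Lemma walk_cylinder n w w' (e : R) : 0 <= e ->
  (forall i, (i <= n)%N -> `|Z i w - Z i w'| <= e) -> J1_dist (W n w) (W n w') <= e.
Proof.
move=> e0 H; apply: J1_dist_sum_cadlag => // j jn.
apply: (le_trans (ler_norm_sum _ _ _)).
apply: (@le_trans _ _ (\sum_(1 <= i < j.+1) e)).
  rewrite !big_nat; apply: ler_sum => i /andP[_ ij].
  have -> : Z i w - m - (Z i w' - m) = Z i w - Z i w' by lra.
  by apply: H; rewrite (leq_trans _ jn).
by rewrite sumr_const_nat subn1 -[e *+ _]mulr_natr ler_wpM2l ?ler_nat.
Qed.

(* The preimage of an open set is the union of the cylinders with rational
   centers and radii that it contains. *)
Lemma measurable_walk n (A : set (cadlag R)) : borel A -> measurable (W n @^-1` A).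
Proof.
pose C (p : seq rat * nat) := [set w | forall i, (i <= n)%N ->
  `|Z i w - ratr (nth 0 p.1 i)| < p.2.+1%:R^-1].
have mC p : measurable (C p).
  rewrite (_ : C p = \bigcap_(i in [set` iota 0 n.+1])
      ((Z i) @^-1` ball (ratr (nth 0 p.1 i) : R) p.2.+1%:R^-1)).
    apply: fin_bigcap_measurable => [|i _]; first exact: finite_seq.
    rewrite -[X in measurable X]setTI; apply: mZ => //.
    exact: measurable_ball.
  apply/seteqP; split => w H i.
    move=> iI; have : i \in iota 0 n.+1 by [].
    by rewrite mem_iota add0n ltnS => /andP[_ /H]; rewrite /ball/= distrC.
  move=> iN; have iI : i \in iota 0 n.+1 by rewrite mem_iota add0n ltnS.
  by have := H i iI; rewrite /= /ball/= distrC.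
suff openW U : open U -> measurable (W n @^-1` U).
  move: A; apply: smallest_sub => [|U /openW//].
  split => [|B mB|F mF].
  - by rewrite /= preimage_set0.
  - by rewrite /= setTD preimage_setC; exact: measurableC.
  - by rewrite /= preimage_bigcup; exact: bigcupT_measurable.
move=> oU; pose J := [set p | C p `<=` W n @^-1` U].
rewrite (_ : W n @^-1` U = \bigcup_(p in J) C p); last first.
  apply/seteqP; split => [w Uw|w [p Jp]]; last exact: Jp.
  have [/= e e0 eU] : exists2 e : R, 0 < e & ball (W n w) e `<=` U.
    have /nbhs_ballP[e e0 H] : nbhs (W n w) U by apply: open_nbhs_nbhs; split.
    by exists e.
  (* Two points of a cylinder of radius [k.+1%:R^-1] differ by less than twice the radius in each
     variable. *)
  pose k := Num.truncn (2 / e); have k0 : (0 : R) < k.+1%:R by [].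
  have ke : 2 * k.+1%:R^-1 < e.
    by rewrite ltr_pdivrMr// mulrC -ltr_pdivrMr//; exact: truncnS_gt.
  have /choice [r rP] : forall i, exists r : rat, `|Z i w - ratr r| < k.+1%:R^-1.
    move=> i; have h : Z i w - k.+1%:R^-1 < Z i w + k.+1%:R^-1.
      have : (0 : R) < k.+1%:R^-1 by rewrite invr_gt0.
      by move: (k.+1%:R^-1) => x; lra.
    have [r] := rat_in_itvoo h; rewrite in_itv/= => /andP[r1 r2].
    exists r; move: (k.+1%:R^-1) (ratr r : R) r1 r2 => x y r1 r2.
    by rewrite ltr_norml; apply/andP; split; lra.
  have rE i : (i <= n)%N -> (mkseq r n.+1)`_i = r i by move=> iN; exact: nth_mkseq.
  exists (mkseq r n.+1, k); last by move=> i iN; rewrite rE.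
  move=> w' Cw'; apply: eU; rewrite /= /ball/=; apply: le_lt_trans ke.
  apply: walk_cylinder => [|i iN]; first by rewrite mulr_ge0.
  have := Cw' i iN; rewrite rE// [(_, k).2]/=.
  have := rP i; have := ler_distD (ratr (r i)) (Z i w) (Z i w').
  by rewrite (distrC (ratr _) (Z i w')); move: (k.+1%:R^-1) => x; lra.
rewrite bigcup_mkcond; apply: countable_bigcupT_measurable => [|p]; first exact: countableP.
by case: ifP.
Qed.

End measurability.

(** * The large deviation bounds *)

Section large_deviations.
Context (R : realType) (d : measure_display) (T : measurableType d).
Variables (P : probability T R) (Z : nat -> {RV P >-> R}) (alpha : R) (q : R -> R).
Hypothesis qH : weibull_exponent alpha q.
Hypothesis Z_indep : independent_RVs P Z.
Hypothesis Z_ident : forall (i : nat) (A : set R), measurable A ->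
  distribution P (Z i) A = distribution P (Z 0%N) A.
Hypothesis Z_ge0 : forall i w, 0 <= Z i w.
Hypothesis Z_tail : forall x : R, 0 < x ->
  P [set w | x <= Z 0%N w] = (expR (- q x))%:E.

Let alpha0 : 0 < alpha. Proof. by case/andP: (exponent_itv qH). Qed.

Lemma near_q_gt0 : \forall n \near \oo, 0 < q n%:R.
Proof.
by apply: filterS (near_pinfty_q qH 1) => n; exact: lt_le_trans.
Qed.

Lemma LDP_lower (A : set (cadlag R)) : borel A ->
  (- ereal_inf (@weibull_rate R alpha @` A°) <=
     limn_einf (fun n => lne (P (walk Z n @^-1` A)) / (q n%:R)%:E))%E.
Proof.
move=> bA; rewrite leeNl; apply: le_ereal_inf_tmp => _ [xi Axi <-].
have [rho rho0 sub] : exists2 rho : R, 0 < rho & ball xi rho `<=` A.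
  have /nbhs_ballP[rho /= rho0 H] : nbhs xi A by [].
  by exists rho.
have I0 : (0 <= weibull_rate alpha xi)%E.
  exact: (weibull_rate_lsc (exponent_itv qH)).1.
case E : (weibull_rate alpha xi) I0 => [a| |]// _; last exact: leey.
have Ia : (weibull_rate alpha xi <= a%:E)%E by rewrite E.
rewrite leeNl; apply/lee_addgt0Pr => e e0; have ae : a < a + e by rewrite ltrDl.
rewrite -EFinN -leeBlDr// -EFinB; apply: limn_einf_ge_near; near=> n.
rewrite -opprD; apply: lne_ge_mul.
- by near: n; exact: near_q_gt0.
- by apply: fin_num_measure; exact: measurable_walk.
- have : forall D : set T, measurable D ->
      (forall w, J1_dist xi (walk Z n w) < rho -> D w) ->
      ((expR (- ((a + e) * q n%:R)))%:E <= P D)%E.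
    by near: n; apply: (lower_bound qH Z_indep Z_ident Z_ge0 Z_tail Ia ae rho0).
  apply; first exact: measurable_walk.
  by move=> w wr; exact: sub.
Unshelve. all: by end_near.
Qed.

(** As [g] is non-increasing, its limit at 0 is a supremum and one [e] can be fixed. If [c2 < g e],
    the paths in [A] are farther than [e] from every path of rate at most [c2], since such a path
    would otherwise lie in [closed_nbhd A e]. *)
Lemma LDP_upper (A : set (cadlag R)) : borel A ->
  (limn_esup (fun n => lne (P (walk Z n @^-1` A)) / (q n%:R)%:E) <=
    - lim (ereal_inf (@weibull_rate R alpha @` closed_nbhd A e) @[e --> 0^'+]))%E.
Proof.
move=> bA; pose g (e : R) := ereal_inf (@weibull_rate R alpha @` closed_nbhd A e).
have g_dec e e' : e <= e' -> (g e' <= g e)%E.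
  move=> ee; apply: ereal_inf_le_tmp; apply: image_subset => x.
  by rewrite /closed_nbhd/= => /le_trans; apply; rewrite lee_fin.
have gl : g e @[e --> 0^'+] --> ereal_sup [set g x | x in [set` Interval (BRight 0) (BRight (1 : R))]].
  apply: nonincreasing_at_right_cvge => //; first by rewrite bnd_simp.
  by move=> x y _ _ xy; exact: g_dec.
rewrite (cvg_lim _ gl)//.
(* Settles the case [g e <= 0], where no positive level lies below [g e]. *)
have up0 : (limn_esup (fun n => lne (P (walk Z n @^-1` A)) / (q n%:R)%:E) <= 0)%E.
  apply: limn_esup_le_near; near=> n; rewrite -[0%E]/((0 : R)%:E) -[0]oppr0.
  apply: lne_le_mul => //; first by near: n; exact: near_q_gt0.
  by rewrite mul0r oppr0 expR0; apply: probability_le1; exact: measurable_walk.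
rewrite leeNr; apply: ge_ereal_sup => _ [e /= + <-]; rewrite in_itv/= => /andP[e0 _].
have [ge0|] := leP (g e) 0%E.
  by rewrite (le_trans ge0)// leeNr oppe0.
move=> g0; rewrite leeNr.
have key (c : R) : 0 < c -> (c%:E < g e)%E ->
    (limn_esup (fun n => lne (P (walk Z n @^-1` A)) / (q n%:R)%:E) <= (- c)%:E)%E.
  move=> c0 cg.
  (* [upper_bound] needs room between its two levels. *)
  have [c2 [cc2 c2g]] : exists c2 : R, c < c2 /\ (c2%:E < g e)%E.
    case: (g e) cg => [r|_|//].
      rewrite lte_fin => cr; exists ((c + r) / 2); rewrite lte_fin; split; lra.
    by exists (c + 1); rewrite ltry; split => //; lra.
  apply: limn_esup_le_near; near=> n; apply: lne_le_mul => //.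
    by near: n; exact: near_q_gt0.
  have : forall D : set T, measurable D ->
      (forall w, D w -> forall zeta : cadlag R,
         (weibull_rate alpha zeta <= c2%:E)%E -> e < J1_dist (walk Z n w) zeta) ->
      (P D <= (expR (- (c * q n%:R)))%:E)%E.
    near: n; apply: (upper_bound qH Z_indep Z_ident Z_ge0 Z_tail) => //.
    by rewrite c0.
  apply; first exact: measurable_walk.
  move=> w Aw zeta Iz; rewrite ltNge; apply/negP => dz.
  have : (g e <= weibull_rate alpha zeta)%E.
    apply: ereal_inf_lbound; exists zeta => //; rewrite /closed_nbhd/=.
    apply: (@le_trans _ _ (mdist zeta (walk Z n w))%:E).
      by apply: ereal_inf_lbound; exists (walk Z n w).
    rewrite lee_fin; suff -> : mdist zeta (walk Z n w) = J1_dist (walk Z n w) zeta by [].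
    exact: J1_dist_sym.
  by move=> /le_trans /(_ Iz); rewrite leNgt c2g.
case: (g e) g0 key => [r|_ key|//].
  rewrite lte_fin => r0 key; apply/lee_addgt0Pr => h h0.
  (* The maximum with [r / 2] keeps [c] positive when [h >= r]. *)
  pose c := Num.max (r - h) (r / 2).
  have c0 : 0 < c by rewrite lt_max divr_gt0 ?orbT.
  have cr : c < r by rewrite gt_max; apply/andP; split; lra.
  apply: (le_trans (key c c0 _)); first by rewrite lte_fin.
  have : r - h <= c by rewrite le_max lexx.
  by rewrite -EFinN -EFinD lee_fin; lra.
rewrite /= leeNy_eq; apply/eqP/eq_ninfty => t.
have t0 : 0 < Num.max 1 (- t) by rewrite lt_max ltr01.
apply: (le_trans (key _ t0 (ltry _))); rewrite lee_fin lerNl.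
by rewrite le_max lexx orbT.
Unshelve. all: by end_near.
Qed.

End large_deviations.

(** * The exponent read off from the tail *)

Section exponent_of_tail.
Context (R : realType) (d : measure_display) (T : measurableType d).
Variables (P : probability T R) (X : {RV P >-> R}) (L : R -> R) (alpha : R).
Hypothesis alpha01 : 0 < alpha < 1.
Hypothesis X_tail : forall x : R, 0 < x ->
  P [set w | x <= X w] = (expR (- (L x * x `^ alpha)))%:E.
Hypothesis L_slow : slowly_varying L.
Hypothesis L_noninc : exists x0 : R, forall x y : R, x0 <= x -> x <= y ->
  L y * y `^ (alpha - 1) <= L x * x `^ (alpha - 1).

Let q x := L x * x `^ alpha.
Let alpha0 : 0 < alpha. Proof. by case/andP: alpha01. Qed.

Lemma measurable_tail (x : R) : measurable [set w | x <= X w].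
Proof.
rewrite (_ : [set w | _] = X @^-1` `[x, +oo[).
  by rewrite -[Y in measurable Y]setTI; exact: measurable_funP.
by apply/seteqP; split => w /=; rewrite in_itv/= andbT.
Qed.

Lemma exponent_of_tail_nd x y : 0 < x -> x <= y -> q x <= q y.
Proof.
move=> x0 xy; have y0 : 0 < y by exact: lt_le_trans xy.
have : (P [set w | (y <= X w)%R] <= P [set w | (x <= X w)%R])%E.
  apply: le_measure; rewrite ?inE; [exact: measurable_tail..|].
  by move=> w /=; exact: le_trans.
by rewrite !X_tail// lee_fin ler_expR lerN2.
Qed.

(** The variable is finite everywhere, so the tail events decrease to the empty set and their
    probabilities to 0. *)
Lemma exponent_of_tail_pinfty (M : R) : \forall x \near +oo, M <= q x.
Proof.
have cv : P [set w | n.+1%:R <= X w] @[n --> \oo] --> P (\bigcap_n [set w | n.+1%:R <= X w]).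
  apply: nonincreasing_cvg_mu => //.
  - exact: le_lt_trans (probability_le1 P (measurable_tail _)) (ltry 1).
  - by move=> n; exact: measurable_tail.
  - by apply: bigcap_measurable => // n _; exact: measurable_tail.
  - move=> i j ij; apply/subsetPset => w /=; apply: le_trans.
    by rewrite ler_nat ltnS.
have e0 : \bigcap_n [set w | n.+1%:R <= X w] = set0.
  apply/seteqP; split => // w /= H.
  have := H (Num.truncn (X w)) Logic.I; rewrite /= leNgt => /negP; apply.
  exact: truncnS_gt.
rewrite e0 measure0 in cv.
move/fine_cvgP : cv => [_ /cvgrPdist_lt /(_ _ (expR_gt0 (- M)))] [N _ HN].
have HNN := HN N (leqnn N); near=> x.
apply: le_trans (_ : _ <= q N.+1%:R) _; last first.
  by apply: exponent_of_tail_nd => //; near: x; apply: nbhs_pinfty_ge; rewrite num_real.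
move: HNN; rewrite /= X_tail//= sub0r normrN ger0_norm ?expR_ge0// ltr_expR ltrN2.
exact: ltW.
Unshelve. all: by end_near.
Qed.

Lemma weibull_exponent_of_tail : weibull_exponent alpha q.
Proof.
have [[x1 [_ Lpos]] L_ratio] := L_slow.
split => //.
- exact: exponent_of_tail_nd.
- move=> x x0; have := probability_le1 P (measurable_tail x).
  by rewrite X_tail// lee_fin -[leRHS]expR0 ler_expR oppr_le0.
- exact: exponent_of_tail_pinfty.
- move=> c c0.
  have H : L (c * x) / L x * c `^ alpha @[x --> +oo] --> 1 * c `^ alpha.
    by apply: cvgMl; exact: L_ratio.
  rewrite mul1r in H; apply: cvg_trans H; apply: near_eq_cvg; near=> x.
  have x0 : 0 < x by near: x; apply: nbhs_pinfty_gt; rewrite num_real.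
  have Lx : 0 < L x by apply: Lpos; near: x; apply: nbhs_pinfty_ge; rewrite num_real.
  rewrite /q powRM ?(ltW c0) ?(ltW x0)// invfM.
  have xa : x `^ alpha != 0 by rewrite gt_eqF// powR_gt0.
  rewrite mulrA -[RHS]mulrA mulrACA -!mulrA; congr (_ * _).
  by rewrite [LHS]mulrC [RHS]mulrCA [X in _ = _ * X]mulrCA mulfV// mulr1.
(* Division by [x] turns the exponent into L(x) x^(alpha - 1), the function that is assumed
   non-increasing; the maximum with 1 keeps [x] positive. *)
- have [x0 H] := L_noninc; exists (Num.max 1 x0) => x y.
  rewrite ge_max => /andP[x1' x0x] xy.
  have xp : 0 < x by lra.
  have yp : 0 < y by lra.
  have E z : 0 < z -> q z / z = L z * z `^ (alpha - 1).
    by move=> z0; rewrite /q -(mulr_powRB1 (ltW z0) alpha0) mulrCA mulrAC mulfV ?mul1r ?gt_eqF.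
  by rewrite !E//; exact: H.
Unshelve. all: by end_near.
Qed.

End exponent_of_tail.

Theorem theorem2p2 (R : realType) (d : measure_display) (T : measurableType d)
    (P : probability T R) (Z : nat -> {RV P >-> R}) (L : R -> R) (alpha : R)
    (Z_indep : independent_RVs P Z)
    (Z_ident : forall (i : nat) (A : set R), measurable A ->
       distribution P (Z i) A = distribution P (Z 0%N) A)
    (Z_ge0 : forall (i : nat) (w : T), 0 <= Z i w)
    (alpha_gt0 : 0 < alpha) (alpha_lt1 : alpha < 1)
    (L_slow : slowly_varying L)
    (Z_tail : forall x : R, 0 < x ->
       P [set w | x <= Z 0%N w] = (expR (- (L x * x `^ alpha)))%:E)
    (L_noninc : exists x0 : R, forall x y : R, x0 <= x -> x <= y ->
       L y * y `^ (alpha - 1) <= L x * x `^ (alpha - 1)) :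
  extended_LDP P
    (fun n w => sum_cadlag n (fun i => Z i w - fine 'E_P[Z 0%N]))
    (fun n => L n%:R * n%:R `^ alpha)
    (@weibull_rate R alpha).
Proof.
have alpha01 : 0 < alpha < 1 by rewrite alpha_gt0.
have qH := weibull_exponent_of_tail alpha01 Z_tail L_slow L_noninc.
split.
- by move=> n A; apply: measurable_walk.
- exact: near_q_gt0 qH.
- apply/cvgryPge => M; exact: near_pinfty_q qH M.
- exact: weibull_rate_lsc.
- move=> A bA r; split; last exact: (LDP_upper qH Z_indep Z_ident Z_ge0 Z_tail bA).
    exact: (LDP_lower qH Z_indep Z_ident Z_ge0 Z_tail bA).
  exact: limn_einf_sup.
Qed.
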